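(* For $j=1,2$ let $0<b_j<\infty$, $\beta_j\in[0,\pi)$, and let $q_j\in L^1([0,b_j])$ be real-valued. Let $m(z;b_j,\beta_j)$, $z\in\mathbb{C}\setminus\mathbb{R}$, be the $m$-function of the self-adjoint Schrödinger operator $H(b_j,\beta_j)=-\frac{d^2}{dx^2}+q_j$ in $L^2([0,b_j])$ with boundary conditions $g(0_+)=0$ and $\sin(\beta_j)g'(b_{j,-})+\cos(\beta_j)g(b_{j,-})=0$. Let $0<a<\min(b_1,b_2)$, $0<\varepsilon<\pi/2$, and suppose that $$|m(z;b_1,\beta_1)-m(z;b_2,\beta_2)| = O\big(e^{-2\,\mathrm{Im}(z^{1/2})\,a}\big)\quad\text{as } |z|\to\infty$$ along the ray $\arg(z)=\pi-\varepsilon$. Then $q_1=q_2$ a.e. on $[0,a]$.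
   Context: The branch of the square root is fixed by $\mathrm{Im}(z^{1/2})\ge 0$. For real-valued $q\in L^1([0,b])$ and $\beta\in[0,\pi)$, $H(b,\beta)g=-g''+qg$ with domain $$\{g\in L^2([0,b]) : g,g'\ \text{absolutely continuous on }[0,b];\ g(0_+)=0;\ \sin(\beta)g'(b_-)+\cos(\beta)g(b_-)=0;\ -g''+qg\in L^2([0,b])\}.$$ For $z\in\mathbb{C}\setminus\mathbb{R}$ let $\psi(z,\cdot;b,\beta)$ be the nonzero solution (unique up to constant multiples) of $-\psi''+[q-z]\psi=0$ on $[0,b]$ with $\sin(\beta)\psi'(z,b_-;b,\beta)+\cos(\beta)\psi(z,b_-;b,\beta)=0$. The $m$-function is $m(z;b,\beta)=\psi'(z,0_+;b,\beta)/\psi(z,0_+;b,\beta)$. (Here $m(z;b_j,\beta_j)$ is formed with the potential $q_j$.) *)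

(* Defs.v *)
From HB Require Import structures.
From mathcomp Require Import all_boot all_order all_algebra.
From mathcomp Require Import all_classical all_reals all_analysis.
From mathcomp Require Import complex.

Set Implicit Arguments.
Unset Strict Implicit.
Unset Printing Implicit Defensive.

Import Order.TTheory GRing.Theory Num.Theory.
Import numFieldNormedType.Exports.

Local Open Scope classical_set_scope.
Local Open Scope ring_scope.
Local Open Scope complex_scope.

(* Absolute continuity of f on [a, b]; the intervals ]u i, v i[ range over
   finite families of pairwise non-overlapping subintervals of [a, b]. *)
Definition abs_cont (R : realType) (a b : R) (f : R -> R) : Prop :=
  forall e : R, 0 < e -> exists2 d : R, 0 < d &
    forall (n : nat) (u v : 'I_n -> R),
      (forall i, a <= u i /\ u i <= v i /\ v i <= b) ->
      (forall i j, i != j -> v i <= u j \/ v j <= u i) ->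
      \sum_(i < n) (v i - u i) < d ->
      \sum_(i < n) `|f (v i) - f (u i)| < e.

(* Complex-valued functions of a real variable are treated componentwise. *)
Definition cabs_cont (R : realType) (a b : R) (f : R -> R[i]) : Prop :=
  abs_cont a b (fun x => complex.Re (f x)) /\
  abs_cont a b (fun x => complex.Im (f x)).

Definition is_cderive (R : realType) (f : R -> R[i]) (x : R) (y : R[i]) : Prop :=
  is_derive x 1 (fun t : R => complex.Re (f t)) (complex.Re y) /\
  is_derive x 1 (fun t : R => complex.Im (f t)) (complex.Im y).

(* psi solves - psi'' + (q - z) psi = 0 on [0, b], with psi and psi' absolutely
   continuous on [0, b]. The function dpsi is psi' extended continuously to the
   endpoints, so that psi'(0_+) = dpsi 0 and psi'(b_-) = dpsi b; likewise
   psi(0_+) = psi 0 and psi(b_-) = psi b. *)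
Definition is_solution (R : realType) (q : R -> R) (b : R) (z : R[i])
    (psi dpsi : R -> R[i]) : Prop :=
  [/\ cabs_cont 0 b psi,
      cabs_cont 0 b dpsi,
      (forall x, x \in `]0, b[ -> is_cderive psi x (dpsi x)) &
      {ae @lebesgue_measure R, forall x, x \in `]0, b[ ->
        exists2 ddpsi : R[i], is_cderive dpsi x ddpsi &
          - ddpsi + ((q x)%:C - z) * psi x = 0}].

Definition is_weyl_solution (R : realType) (q : R -> R) (b beta : R) (z : R[i])
    (psi dpsi : R -> R[i]) : Prop :=
  [/\ is_solution q b z psi dpsi,
      (exists2 x, x \in `[0, b] & psi x != 0) &
      (sin beta)%:C * dpsi b + (cos beta)%:C * psi b = 0].

(* m(z; b, beta) = psi'(0_+) / psi(0_+). For q integrable on [0, b] and z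
   non-real, the nonzero solution psi exists, is unique up to a constant factor,
   and psi 0 != 0 (otherwise z would be a non-real eigenvalue of H(b, beta)), so
   the set below is a singleton; xget's default 0 plays no role in that case. *)
Definition m_function (R : realType) (q : R -> R) (b beta : R) (z : R[i]) : R[i] :=
  xget 0 [set w : R[i] | exists psi dpsi : R -> R[i],
    is_weyl_solution q b beta z psi dpsi /\ w = dpsi 0 / psi 0].

(* The point of modulus r and argument theta. *)
Definition polar (R : realType) (r theta : R) : R[i] :=
  (r * cos theta) +i* (r * sin theta).

(* sqrtC is the branch of the square root with nonnegative imaginary part. *)
Definition im_sqrt (R : realType) (z : R[i]) : R := complex.Im (sqrtC z).

(* Main.v *)
Require Import Defs.
From mathcomp Require Import all_boot all_order all_algebra.
From mathcomp Require Import all_classical all_reals all_analysis.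
From mathcomp Require Import complex measurable_realfun.
From mathcomp Require Import ring lra zify.

Import Order.TTheory GRing.Theory Num.Theory.
Import numFieldNormedType.Exports.

(* Bennewitz's argument. Let phi_j, theta_j be the solutions with
   phi_j(0) = theta_j'(0) = 0 and phi_j'(0) = theta_j(0) = 1, and let
   u_j = theta_j + m_j phi_j. For fixed x in ]0, a[,
     F(z) = phi_1 theta_2 - phi_2 theta_1
          = phi_1 u_2 - phi_2 u_1 + (m_1 - m_2) phi_1 phi_2
   is entire of order 1/2. Along the ray phi_j = O(e^(kx) / |z|^(1/2)) and
   u_j = O(e^(-kx)) with k = Im z^(1/2), so F = O(|z|^(-1/2)) there, hence also
   on the conjugate ray. By Phragmen-Lindelof in the two sectors cut out by the
   rays, F = O(|z|^(-1/2)) everywhere, so F(0) = 0. At z = 0 this reads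
   phi_1 theta_2 = phi_2 theta_1 on ]0, a[; as both Wronskians are 1, it follows
   that phi_1 = phi_2 and theta_1 = theta_2, whence q_1 = q_2 a.e. *)

Set Implicit Arguments.
Unset Strict Implicit.
Unset Printing Implicit Defensive.

Local Open Scope classical_set_scope.
Local Open Scope ring_scope.

(** * Absolutely continuous functions *)

Section AbsolutelyContinuous.
Context {R : realType}.
Implicit Types (a b : R) (f g h : R -> R).

(** Since q_j is only integrable, psi'' exists only almost everywhere; every differential inequality
    therefore goes through one monotonicity criterion for absolutely continuous functions. Of entire
    functions the argument needs the maximum principle on rectangles and the mean value bound at 0.
    Both hold for locally uniform limits of polynomials, and the Picard series exhibits phi_j and
    theta_j as such limits. Order 1/2 makes even the large sector admissible, because its opening 2
    (pi - eps) is below 2 pi. The factor |z|^(-1/2) is gained from phi_j, since phi_j(0) = 0. The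
    decay of u_j is obtained without expanding m_j: with kp^2 = - z, the moduli of psi' + kp psi and
    psi' - kp psi are compared from b_j, where the boundary condition balances them, back to 0. The
    condition x < a lets the factor e^(-2ka) of m_1 - m_2 absorb the growth e^(2kx) of phi_1 phi_2.
    The passage to the conjugate ray rests on the q_j being real. The point z = 0 is real, so there
    the equations concern real functions, and two solutions with Wronskian 1 determine the
    potential. *)

Lemma abs_cont_uniform a b f (e : R) : abs_cont a b f -> 0 < e ->
  exists2 d, 0 < d & forall u v, a <= u -> u <= v -> v <= b ->
    v - u < d -> `|f v - f u| < e.
Proof.
move=> fac e0; have [d d0 fd] := fac e e0; exists d => // u v au uv vb vud.
have := fd 1%N (fun=> u) (fun=> v); rewrite !big_ord1; apply => //.
by move=> i j; rewrite !ord1.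
Qed.

(** The closure properties below (Lipschitz functions, sums, products, exponentials) all reduce to
    this domination: a family of intervals short enough for both [f] and [g] is short enough for
    [h]. *)
Lemma abs_cont_dom a b f g h (M : R) : abs_cont a b f -> abs_cont a b g ->
  (forall u v, a <= u -> u <= v -> v <= b ->
     `|h v - h u| <= M * (`|f v - f u| + `|g v - g u|)) ->
  abs_cont a b h.
Proof.
move=> fac gac hfg e e0.
(* No sign of [M] is assumed; [M'] is a positive constant above it. *)
pose M' := `|M| + 1.
have M'0 : 0 < M' by rewrite ltr_wpDl.
have e20 : 0 < e / 2 / M' by rewrite !divr_gt0.
have [d1 d10 fd1] := fac _ e20.
have [d2 d20 gd2] := gac _ e20.
exists (Num.min d1 d2); first by rewrite lt_min d10.
move=> n u v uv disj; rewrite lt_min => /andP[s1 s2].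
have {}fd1 := fd1 _ _ _ uv disj s1.
have {}gd2 := gd2 _ _ _ uv disj s2.
apply: (@le_lt_trans _ _
  (M' * (\sum_(i < n) `|f (v i) - f (u i)| + \sum_(i < n) `|g (v i) - g (u i)|))).
  rewrite -big_split mulr_sumr; apply: ler_sum => i _.
  have [au [uvi vb]] := uv i.
  apply: (le_trans (hfg _ _ au uvi vb)); apply: ler_wpM2r; first by rewrite addr_ge0.
  by rewrite (le_trans (ler_norm _))// lerDl.
rewrite -ltr_pdivlMl// (lt_le_trans (ltrD fd1 gd2))//.
by rewrite -mulrDl -splitr mulrC.
Qed.

Lemma abs_cont_lipschitz a b f (M : R) :
  (forall u v, a <= u -> u <= v -> v <= b -> `|f v - f u| <= M * (v - u)) ->
  abs_cont a b f.
Proof.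
move=> fM; apply: (@abs_cont_dom a b id id f M).
- move=> e e0; exists e => // n u v uv _; apply: le_lt_trans.
  by apply: ler_sum => i _; rewrite ger0_norm// subr_ge0; have [_ []] := uv i.
- move=> e e0; exists e => // n u v uv _; apply: le_lt_trans.
  by apply: ler_sum => i _; rewrite ger0_norm// subr_ge0; have [_ []] := uv i.
move=> u v au uv vb; apply: (le_trans (fM u v au uv vb)).
(* A negative [M] is compatible with the hypothesis only on a degenerate interval. *)
have M0 : 0 <= M \/ u = v.
  move: uv; rewrite le_eqVlt => /predU1P[->|uv]; first by right.
  left; have := fM u v au (ltW uv) vb; have := normr_ge0 (f v - f u); nra.
have [M0'|->] := M0; last by rewrite subrr normr0 mulr0 addr0 mulr0.
by apply: ler_wpM2l => //; rewrite (ger0_norm (_ : 0 <= v - u)) ?subr_ge0// lerDl subr_ge0.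
Qed.

Lemma abs_cont_cst a b (c : R) : abs_cont a b (fun=> c).
Proof. by apply: (@abs_cont_lipschitz _ _ _ 0) => *; rewrite subrr normr0 mul0r. Qed.

Lemma abs_cont_id a b : abs_cont a b id.
Proof.
by apply: (@abs_cont_lipschitz _ _ _ 1) => u v _ uv _; rewrite mul1r ger0_norm ?subr_ge0.
Qed.

Lemma abs_contD a b f g : abs_cont a b f -> abs_cont a b g ->
  abs_cont a b (fun x => f x + g x).
Proof.
move=> fac gac; apply: (@abs_cont_dom a b f g _ 1) => // u v _ _ _.
by rewrite mul1r opprD addrACA ler_normD.
Qed.

Lemma abs_contZ a b f c : abs_cont a b f -> abs_cont a b (fun x => c * f x).
Proof.
move=> fac; apply: (@abs_cont_dom a b f f _ `|c|) => // u v _ _ _.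
by rewrite -mulrBr normrM ler_wpM2l// lerDl.
Qed.

Lemma abs_contN a b f : abs_cont a b f -> abs_cont a b (fun x => - f x).
Proof.
move=> fac; apply: (@abs_cont_dom a b f f _ 1) => // u v _ _ _.
by rewrite -opprD normrN mul1r lerDl.
Qed.

Lemma abs_contB a b f g : abs_cont a b f -> abs_cont a b g ->
  abs_cont a b (fun x => f x - g x).
Proof. by move=> fac gac; apply: abs_contD => //; exact: abs_contN. Qed.

Lemma abs_contS a b a' b' f : a <= a' -> b' <= b ->
  abs_cont a b f -> abs_cont a' b' f.
Proof.
move=> aa bb fac e e0; have [d d0 fd] := fac e e0; exists d => // n u v uv.
apply: fd => i; have [au [uvi vb]] := uv i; split; first exact: le_trans au.
by split => //; exact: le_trans bb.
Qed.

Lemma eq_abs_cont a b f g : (forall x, a <= x <= b -> f x = g x) ->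
  abs_cont a b f -> abs_cont a b g.
Proof.
move=> fg fac; apply: (@abs_cont_dom a b f f _ 1) => // u v au uv vb.
rewrite mul1r -!fg ?lerDl//; first by rewrite au (le_trans uv).
by rewrite vb (le_trans au).
Qed.


(** Continuous induction: at the supremum of the points where [P] holds, the local step carries [P]
    past the supremum unless [b] is reached. It stands for a compactness argument; the shape
    [u <= c <= v] is that of an interval tagged by [c]. *)
Lemma real_induction a b (P : R -> Prop) : a <= b -> P a ->
  (forall c, a <= c <= b -> exists2 d, 0 < d &
     forall u v, a <= u <= c -> c <= v <= b -> v - u < d -> P u -> P v) ->
  P b.
Proof.
move=> ab Pa step.
pose A := [set x | a <= x <= b /\ P x].
have Aa : A a by split; rewrite ?lexx.
have supA : has_sup A.
  by split; [exists a|exists b => x [/andP[]]].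
have ac : a <= sup A by apply: ub_le_sup Aa; exact: supA.2.
have cb : sup A <= b by apply: ge_sup; [exists a|move=> x [/andP[]]].
have [|d d0 dP] := step (sup A); first by rewrite ac.
have d20 : 0 < d / 2 by rewrite divr_gt0.
have [u [/andP[au ub] Pu] cu] := sup_adherent d20 supA.
have uc : u <= sup A by apply: ub_le_sup; [exact: supA.2|split => //; rewrite au].
have [bc|cb'] := leP b (sup A + d / 2).
  by apply: (dP u b) => //; [rewrite au|rewrite cb lexx|lra].
suff : sup A + d / 2 <= sup A by lra.
apply: ub_le_sup; first exact: supA.2.
split; first by apply/andP; split; lra.
by apply: (dP u) => //; [rewrite au|apply/andP; split; lra|lra].
Qed.

Lemma abs_cont_bounded a b f : a <= b -> abs_cont a b f ->
  exists2 M, 0 < M & forall x, a <= x <= b -> `|f x| <= M.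
Proof.
move=> ab fac; have [d d0 fd] := abs_cont_uniform fac ltr01.
apply: (@real_induction a b
  (fun y => exists2 M, 0 < M & forall x, a <= x <= y -> `|f x| <= M)) => //.
  exists (`|f a| + 1); first by rewrite ltr_wpDl.
  by move=> x /le_anti ->; rewrite lerDl.
move=> c _; exists d => // u v /andP[au uc] /andP[cv vb] vud [M M0 fM].
exists (M + 1); first by rewrite addr_gt0.
move=> x /andP[ax xv]; have [xu|ux] := leP x u.
  by rewrite (le_trans (fM x _)) ?ax// lerDl.
have -> : f x = f u + (f x - f u) by ring.
rewrite (le_trans (ler_normD _ _))// lerD//.
  by apply: fM; rewrite au lexx.
by apply/ltW/fd => //; [exact: ltW|exact: le_trans vb|lra].
Qed.

Lemma abs_contM a b f g : a <= b -> abs_cont a b f -> abs_cont a b g ->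
  abs_cont a b (fun x => f x * g x).
Proof.
move=> ab fac gac.
have [M M0 fM] := abs_cont_bounded ab fac.
have [N N0 gN] := abs_cont_bounded ab gac.
apply: (@abs_cont_dom a b f g _ (M + N)) => // u v au uv vb.
have -> : f v * g v - f u * g u = f v * (g v - g u) + g u * (f v - f u) by ring.
rewrite (le_trans (ler_normD _ _))// !normrM.
have fv : `|f v| <= M by rewrite fM// vb (le_trans au).
have gu : `|g u| <= N by rewrite gN// au (le_trans uv).
have := normr_ge0 (g v - g u); have := normr_ge0 (f v - f u).
have := normr_ge0 (f v); have := normr_ge0 (g u); nra.
Qed.

Lemma abs_cont_expR a b f : a <= b -> abs_cont a b f ->
  abs_cont a b (fun x => expR (f x)).
Proof.
move=> ab fac; have [M M0 fM] := abs_cont_bounded ab fac.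
apply: (@abs_cont_dom a b f f _ (expR M)) => // u v au uv vb.
have expB (x y : R) : x <= y -> y <= M -> expR y - expR x <= expR M * (y - x).
  move=> xy yM; have -> : expR y - expR x = expR y * (1 - expR (x - y)).
    by rewrite mulrBr mulr1 -expRD addrCA subrr addr0.
  have h : 1 - expR (x - y) <= y - x by have := expR_ge1Dx (x - y); lra.
  apply: (@le_trans _ _ (expR y * (y - x))); first by rewrite ler_wpM2l ?expR_ge0.
  by rewrite ler_wpM2r ?subr_ge0// ler_expR.
have fu : f u <= M by rewrite (le_trans (ler_norm _))// fM// au (le_trans uv).
have fv : f v <= M by rewrite (le_trans (ler_norm _))// fM// vb (le_trans au).
apply: (@le_trans _ _ (expR M * `|f v - f u|)); last first.
  by rewrite ler_wpM2l ?expR_ge0// lerDl.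
have [uv'|vu'] := leP (f u) (f v).
  by rewrite !ger0_norm ?subr_ge0 ?ler_expR//; exact: expB.
rewrite distrC [X in _ <= _ * X]distrC !ger0_norm ?subr_ge0 ?ler_expR; [|exact: ltW..].
by apply: expB => //; exact: ltW.
Qed.

(** Composition with [clamp] extends a function on [[a, b]] to the line by its boundary values, so
    that theorems on globally continuous functions apply. *)
Definition clamp a b (x : R) : R := Num.max a (Num.min b x).

Lemma clamp_itv a b x : a <= b -> a <= clamp a b x <= b.
Proof. by move=> ab; rewrite /clamp le_max lexx/= ge_max ab ge_min lexx. Qed.

Lemma clamp_id a b x : a <= x <= b -> clamp a b x = x.
Proof.
by move=> /andP[ax xb]; rewrite /clamp (min_r xb) (max_r ax).
Qed.

Lemma clampB a b u v : u <= v -> clamp a b u <= clamp a b v /\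
  clamp a b v - clamp a b u <= v - u.
Proof.
move=> uv; rewrite /clamp /Num.max /Num.min.
repeat match goal with |- context[if ?c then _ else _] => case: ifPn end;
  rewrite -?leNgt => *; split; lra.
Qed.

Lemma abs_cont_clamp_continuous a b f : a <= b -> abs_cont a b f ->
  continuous (fun x => f (clamp a b x)).
Proof.
move=> ab fac x; apply/cvgrPdist_lt => e e0.
have [d d0 fd] := abs_cont_uniform fac e0.
near=> y.
have xyd : `|x - y| < d by near: y; exact: cvgr_dist_lt.
have h u v : u <= v -> v - u < d ->
    `|f (clamp a b v) - f (clamp a b u)| < e.
  move=> uv vud; have [c1 c2] := clampB a b uv.
  have /andP[? ?] := clamp_itv u ab; have /andP[? ?] := clamp_itv v ab.
  by apply: fd => //; exact: le_lt_trans vud.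
have [xy|yx] := leP x y.
  by rewrite distrC; apply: h => //; move: xyd; rewrite distrC ger0_norm ?subr_ge0.
by apply: h; [exact: ltW|move: xyd; rewrite ger0_norm ?subr_ge0// ltW].
Unshelve. all: by end_near. Qed.

Lemma abs_cont_IVT_gt0 a b f : a <= b -> abs_cont a b f ->
  (forall x, a <= x <= b -> f x != 0) -> 0 < f a -> 0 < f b.
Proof.
move=> ab fac f0 fa; rewrite ltNge; apply/negP => fb.
have cf := abs_cont_clamp_continuous ab fac.
have ca : clamp a b a = a by rewrite clamp_id// lexx.
have cb : clamp a b b = b by rewrite clamp_id// lexx andbT.
have [||c cab fc] := @IVT R (fun x => f (clamp a b x)) a b 0 ab.
- by apply: continuous_subspaceT.
- by rewrite ca cb; apply/andP; split; [rewrite ge_min fb orbT|rewrite le_max (ltW fa)].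
by have /eqP := f0 _ (clamp_itv c ab).
Qed.

End AbsolutelyContinuous.

(** * Monotonicity from the sign of the derivative almost everywhere *)

Section Monotone.
Context {R : realType}.
Implicit Types (a b : R) (f g h : R -> R).
Notation mu := (@lebesgue_measure R).

Lemma is_derive_bound f (x d e : R) : is_derive x 1 f d -> 0 < e ->
  exists2 r, 0 < r & forall y, `|y - x| < r ->
    `|f y - f x - d * (y - x)| <= e * `|y - x|.
Proof.
move=> [fx dfx] e0.
have /cvgrPdist_lt/(_ _ e0) : h^-1 *: (f (h *: 1 + x) - f x) @[h --> 0^'] --> d.
  by rewrite -dfx; exact: fx.
rewrite near_withinE => /nbhs_ballP[r /= r0 hr].
exists r => // y yr; have [->|yx] := eqVneq y x.
  by rewrite !subrr mulr0 subrr normr0 mulr0.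
have yx0 : y - x != 0 by rewrite subr_eq0.
have := hr (y - x); rewrite /ball/= sub0r normrN => /(_ yr yx0).
rewrite [_ *: 1]mulr1 subrK => /ltW h.
have -> : f y - f x - d * (y - x) = - (d - (y - x)^-1 *: (f y - f x)) * (y - x).
  by rewrite [_ *: _]/GRing.scale/=; field.
by rewrite normrM normrN ler_wpM2r.
Qed.

Lemma lebesgue_measureS (A B : set R) : measurable A -> measurable B -> A `<=` B ->
  (mu A <= mu B)%E.
Proof. by move=> mA mB AB; apply: le_measure; rewrite ?inE. Qed.

(* Cousin-type argument: on a fine enough partition the intervals tagged by a
   point of the null set D lie in an open set U of small measure, where absolute
   continuity bounds the variation; on the others f decreases by at most
   e1 times the length. P x says that [a, x] has such a partition, s listing its
   intervals in U. *)
Lemma abs_cont_nondecreasing a b f : a <= b -> abs_cont a b f ->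
  {ae mu, forall x, x \in `]a, b[ -> exists2 d, is_derive x 1 f d & 0 <= d} ->
  f a <= f b.
Proof.
move=> ab fac [A [mA A0 badA]].
apply/ler_addgt0Pr => e e0.
(* The slope loss [e1 * (b - a)] stays below [e / 2]; the [+ 1] keeps the divisor positive when
   [a = b]. The other half of [e] pays for the variation over the listed intervals. *)
pose e1 := e / 2 / (b - a + 1).
have ba0 : 0 < b - a + 1 by lra.
have e10 : 0 < e1 by rewrite !divr_gt0.
have e20 : 0 < e / 2 by rewrite divr_gt0.
have [d d0 fd] := fac _ e20.
pose I u v : set R := [set` `]u, v]].
have muI u v : u <= v -> mu (I u v) = (v - u)%:E.
  rewrite /I lebesgue_measure_itv/= lte_fin; case: ifPn => //.
  by rewrite -leNgt => vu uv; congr EFin; lra.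
have mI u v : measurable (I u v) by exact: measurable_itv.
(* The endpoints join the null set, so that a point outside [U] is interior and has a derivative. *)
pose D := A `|` [set a; b].
have mab : measurable [set a; b] by exact: measurableU.
have mD : measurable D by exact: measurableU.
have D0 : mu D = 0.
  apply: null_set_setU => //.
  apply: null_set_setU => //; exact: lebesgue_measure_set1.
have Dfin : (mu D < +oo)%E by rewrite D0.
have [U [oU DU Ud]] := @lebesgue_regularity_outer R D d mD Dfin d0.
have mU : measurable U by exact: open_measurable.
have {}Ud : (mu U < d%:E)%E.
  rewrite (_ : U = (U `\` D) `|` D); last by rewrite setUC setDUK.
  apply: le_lt_trans Ud; rewrite -[leRHS]adde0 -D0.
  by apply: measureU2 => //; exact: measurableD.
pose sumlen (s : seq (R * R)) := \sum_(p <- s) (p.2 - p.1).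
pose sumvar (s : seq (R * R)) := \sum_(p <- s) `|f p.2 - f p.1|.
pose P x := exists s : seq (R * R),
  [/\ forall p, p \in s -> [/\ a <= p.1, p.1 <= p.2 & p.2 <= x],
      pairwise (fun p q => p.2 <= q.1) s,
      ((sumlen s)%:E <= mu (U `&` `]-oo, x]))%E &
      f a - e1 * (x - a) - sumvar s <= f x].
have mUx (x : R) : measurable (U `&` `]-oo, x]) by exact: measurableI.
have : P b.
  apply: (real_induction ab).
    exists [::]; split => //; first by rewrite /sumlen big_nil.
    by rewrite /sumvar big_nil subrr mulr0 !subr0.
  move=> c /andP[ac cb].
  have [Uc|nUc] := pselect (U c).
    have [r /= r0 rU] : nbhs_ball c U.
      by apply/nbhs_ballP; move: oU; rewrite openE => /(_ _ Uc).
    exists r => // u v /andP[au uc] /andP[cv vb] vur [s [s1 s2 s3 s4]].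
    exists (rcons s (u, v)); split.
    - move=> p; rewrite mem_rcons inE => /predU1P[->/=|ps]; first by split => //; exact: le_trans cv.
      have [? ? h3] := s1 p ps; split => //; exact: le_trans h3 (le_trans uc cv).
    - rewrite pairwise_rcons s2 andbT; apply/allP => p ps /=.
      by have [? ? ?] := s1 p ps.
    (* The new interval lies in [U] and is disjoint from the part of [U] up to [u], so the total
       length stays below the measure of the part of [U] up to [v]. *)
    - rewrite /sumlen big_rcons /= EFinD.
      apply: (@le_trans _ _ (mu (U `&` `]-oo, u]) + mu (I u v))%E).
        apply: leeD => //.
        by rewrite muI//; exact: le_trans cv.
      have disj : (U `&` `]-oo, u]) `&` I u v = set0.
        apply/seteqP; split => x // [[_ xu] ux].
        move: xu ux; rewrite /I/= !in_itv/= => xu /andP[ux _].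
        by move: xu; rewrite leNgt ux.
      have <- : mu (U `&` `]-oo, u] `|` I u v) = (mu (U `&` `]-oo, u]) + mu (I u v))%E.
        have := @measureU _ _ _ mu _ _ (mUx u) (mI u v) disj; exact: id.
      apply: lebesgue_measureS; [exact: (measurableU _ _ (mUx u) (mI u v))|exact: mUx|].
      move=> x [[Ux]|]; rewrite /I/= !in_itv/=.
        move=> xu; split => //; exact: le_trans xu (le_trans uc cv).
      move=> /andP[ux xv]; split => //; apply: rU; rewrite /ball/= ltr_norml.
      by move: ux xv uc cv vur; clear; lra.
    - rewrite /sumvar big_rcons /=.
      move: s4; rewrite -/(sumvar s) => s4.
      have := ler_norm (- (f v - f u)); rewrite normrN => h.
      have h2 : e1 * (u - a) <= e1 * (v - a).
        by rewrite ler_wpM2l ?(ltW e10)// lerD2r (le_trans uc).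
      by move: s4 h h2; clear; lra.
  have [ca cb'] : a < c /\ c < b.
    rewrite !lt_neqAle ac cb !andbT; split; apply/eqP => h; apply: nUc;
      apply: DU; right; [left|right]; by rewrite h.
  have [l fl l0] : exists2 l, is_derive c 1 f l & 0 <= l.
    apply: contrapT => nl; apply: nUc; apply: DU; left; apply: badA => /= h.
    by apply: nl; apply: h; rewrite in_itv/= ca.
  (* Since [u <= c <= v], the expansions at [c] towards both sides add up to
     [f v - f u >= - e1 * (v - u)]; the list [s] is kept. *)
  have [r r0 rf] := is_derive_bound fl e10.
  exists r => // u v /andP[au uc] /andP[cv vb] vur [s [s1 s2 s3 s4]].
  exists s; split => //.
  - move=> p ps; have [? ? h3] := s1 p ps; split => //; exact: le_trans h3 (le_trans uc cv).
  - apply: (le_trans s3); apply: lebesgue_measureS => // x /= [Ux].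
    by rewrite !in_itv/= => xu; split => //; exact: le_trans xu (le_trans uc cv).
  - have : `|u - c| < r by rewrite ler0_norm ?subr_le0//; move: uc cv vur; clear; lra.
    have : `|v - c| < r by rewrite ger0_norm ?subr_ge0//; move: uc cv vur; clear; lra.
    move=> /rf + /rf; rewrite ler_norml ger0_norm ?subr_ge0// => /andP[hv _].
    rewrite ler_norml ler0_norm ?subr_le0// => /andP[_ hu].
    have : 0 <= l * (v - c) by rewrite mulr_ge0 ?subr_ge0.
    have : 0 <= l * (c - u) by rewrite mulr_ge0 ?subr_ge0.
    by move: s4 hv hu; clear; rewrite !mulrBr; lra.
move=> [s [s1 s2 s3 s4]].
have svar : sumvar s < e / 2.
  have := fd (size s) (fun i => (nth (a, a) s i).1) (fun i => (nth (a, a) s i).2).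
  rewrite -(@big_mkord _ _ _ (size s) xpredT
    (fun i => (nth (a, a) s i).2 - (nth (a, a) s i).1)) -(big_nth (a, a) xpredT
    (fun p => p.2 - p.1)).
  rewrite -(@big_mkord _ _ _ (size s) xpredT
    (fun i => `|f (nth (a, a) s i).2 - f (nth (a, a) s i).1|)) -(big_nth (a, a) xpredT
    (fun p => `|f p.2 - f p.1|)).
  apply.
  - by move=> i; have [|? ? ?] := s1 (nth (a, a) s i); [exact: mem_nth|split].
  - move=> i j ij; move/(pairwiseP (a, a)): s2 => s2.
    have [ij'|ji|/val_inj/eqP] := ltgtP (val i) (val j); last by rewrite (negPf ij).
      by left; apply: s2 => //; rewrite inE.
    by right; apply: s2 => //; rewrite inE.
  - rewrite -lte_fin (le_lt_trans s3)// (le_lt_trans _ Ud)//.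
    by apply: lebesgue_measureS => //; exact: subIsetl.
have : e1 * (b - a) <= e / 2.
  rewrite /e1 mulrAC ler_pdivrMr// ler_wpM2l ?(ltW e20)//; lra.
lra.
Qed.


Lemma ae_lebesgueS (P Q : R -> Prop) : (forall x, P x -> Q x) ->
  {ae mu, forall x, P x} -> {ae mu, forall x, Q x}.
Proof.
by move=> PQ; apply: filterS => //; exact: (ae_filter_ringOfSetsType mu).
Qed.

Lemma ae_lebesgueI (P Q : R -> Prop) : {ae mu, forall x, P x} ->
  {ae mu, forall x, Q x} -> {ae mu, forall x, P x /\ Q x}.
Proof. by apply: filterI; exact: (ae_filter_ringOfSetsType mu). Qed.

Lemma abs_cont_le a b f : abs_cont a b f ->
  {ae mu, forall x, x \in `]a, b[ -> exists2 d, is_derive x 1 f d & 0 <= d} ->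
  forall x y, a <= x -> x <= y -> y <= b -> f x <= f y.
Proof.
move=> fac df x y ax xy yb; apply: abs_cont_nondecreasing => //.
  exact: abs_contS fac.
apply: ae_lebesgueS df => t df txy; apply: df; move: txy; rewrite !in_itv/=.
by move=> /andP[xt ty]; rewrite (le_lt_trans ax)// (lt_le_trans ty).
Qed.

Lemma abs_cont_constant a b f : abs_cont a b f ->
  {ae mu, forall x, x \in `]a, b[ -> is_derive x 1 f 0} ->
  forall x, a <= x <= b -> f x = f a.
Proof.
move=> fac df x /andP[ax xb]; apply/eqP; rewrite eq_le; apply/andP; split.
  rewrite -lerN2; apply: (abs_cont_le (abs_contN fac)) => //.
  apply: ae_lebesgueS df => t /[apply] dt; exists (- 0); last by rewrite oppr0.
  exact: is_deriveN.
apply: (abs_cont_le fac) => //.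
by apply: ae_lebesgueS df => t /[apply] dt; exists 0.
Qed.

End Monotone.

(** * Integrals as absolutely continuous functions *)

Section Primitive.
Context {R : realType}.
Implicit Types (a b : R) (f g h q : R -> R).
Notation mu := (@lebesgue_measure R).

Definition primitive q (x : R) : R := (\int[mu]_(t in `[0, x]) q t)%R.

Lemma primitive0 q : primitive q 0 = 0.
Proof. by rewrite /primitive set_itv1 Rintegral_set1. Qed.

Lemma integrable_itvS b q x : x <= b -> mu.-integrable `[0, b] (EFin \o q) ->
  mu.-integrable `[0, x] (EFin \o q).
Proof.
move=> xb; apply: integrableS => //.
by apply: subset_itvl; rewrite bnd_simp.
Qed.

Lemma primitiveB b q u v : mu.-integrable `[0, b] (EFin \o q) ->
  0 <= u -> u <= v -> v <= b ->
  primitive q v - primitive q u = (\int[mu]_(t in `]u, v]) q t)%R.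
Proof.
move=> iq u0 uv vb; apply: Rintegral_itvB; rewrite ?bnd_simp//.
exact: integrable_itvS iq.
Qed.

Lemma integrable_restrict b q : mu.-integrable `[0, b] (EFin \o q) ->
  mu.-integrable [set: R] (EFin \o (q \_ `[0, b])).
Proof. by move=> iq; rewrite -restrict_EFin; apply/(integrable_mkcond _ _).1. Qed.

(** The integral of [|q|] over sets of small measure is small; this is applied to the union of the
    intervals []u i, v i]], half-open so that intervals sharing an endpoint are disjoint. *)
Lemma abs_cont_primitive b q : mu.-integrable `[0, b] (EFin \o q) ->
  abs_cont 0 b (primitive q).
Proof.
move=> iq e e0.
have iq' := integrable_restrict iq.
have [d [d0 dP]] := integral_normr_continuous iq' e0.
exists d => // n u v uv disj sd.
have mI i : measurable [set` `]u i, v i]] by exact: measurable_itv.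
pose A := \big[setU/set0]_(i < n) [set` `]u i, v i]].
have mA : measurable A by apply: bigsetU_measurable => i _; exact: mI.
have tI : trivIset setT (fun i => [set` `]u i, v i]]).
  apply/trivIsetP => i j _ _ ij; apply/seteqP; split => x //=.
  rewrite !in_itv/= => -[/andP[ux xv] /andP[uy yv]].
  have [h|h] := disj i j ij; lra.
have Ad : (mu A < d%:E)%E.
  rewrite /A measure_semi_additive_ord//=.
  rewrite (eq_bigr (fun i => (v i - u i)%:E)); last first.
    move=> i _; rewrite lebesgue_measure_itv/= lte_fin; case: ifPn => //.
    by rewrite -leNgt => vu; have [_ [? _]] := uv i; congr EFin; lra.
  by rewrite sumEFin lte_fin.
apply: le_lt_trans (dP A mA Ad).
set q' := q \_ `[0, b].
have iB (B : set R) : measurable B -> mu.-integrable B (EFin \o (fun x => `|q' x|)).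
  move=> mB; apply: (@integrableS _ _ _ mu setT) => //.
  exact: (@integrable_abse _ _ _ mu setT (EFin \o q')).
have -> : \int[mu]_(x in A) `|q' x| = \sum_(i < n) \int[mu]_(x in [set` `]u i, v i]]) `|q' x|.
  rewrite {1}/Rintegral /A integral_bigsetU_EFin//=.
  - rewrite (eq_bigr (fun i => (\int[mu]_(x in [set` `]u i, v i]]) `|q' x|)%:E)).
      by rewrite sumEFin.
    by move=> i _; rewrite /Rintegral fineK//; apply: integrable_fin_num => //; exact: (iB _ (mI i)).
  - by rewrite index_enum_uniq.
  - by apply: sub_trivIset tI.
  - exact: (measurable_int mu (iB _ mA)).
apply: ler_sum => i _; have [au [uvi vb]] := uv i.
rewrite (primitiveB iq)//.
have -> : \int[mu]_(t in `]u i, v i]) q t = \int[mu]_(t in `]u i, v i]) q' t.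
  apply: eq_Rintegral => x; rewrite inE/= in_itv/= => /andP[ux xv].
  rewrite /q' patchE mem_set//= in_itv/=; lra.
apply: le_normr_Rintegral => //.
exact: integrableS iq'.
Qed.

Lemma is_derive_primitive b q : mu.-integrable `[0, b] (EFin \o q) ->
  {ae mu, forall x, x \in `]0, b[ -> is_derive x 1 (primitive q) (q x)}.
Proof.
move=> iq; have iq' := integrable_restrict iq; set q' := q \_ `[0, b] in iq'.
have iqy y : mu.-integrable [set` Interval (BLeft 0) (BRight y)] (EFin \o q').
  exact: integrableS iq'.
have := @FTC1 R q' (BLeft 0) iqy (integrable_locally (measurable_itv _) iq).
apply: ae_lebesgueS => x dx; rewrite in_itv/= => /andP[x0 xb].
have [|d1 d2] := dx; first by rewrite /= lte_fin.
rewrite -/(primitive q') in d1 d2.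
have <- : q' x = q x.
  by rewrite /q' patchE mem_set//= in_itv/= !ltW.
rewrite -d2 derive1E.
have : is_derive x 1 (primitive q') ('D_1 (primitive q') x) by exact: DeriveDef.
apply: near_eq_is_derive => //.
near=> y.
have yb : y < b by near: y; exact: lt_nbhsl.
apply: eq_Rintegral => t; rewrite inE/= in_itv/= => /andP[t0 ty].
by rewrite /q' patchE mem_set//= in_itv/= t0 (le_trans ty)// ltW.
Unshelve. all: by end_near. Qed.

(** The everywhere version serves [psi], which must be differentiable at each interior point; the
    almost everywhere version serves [psi']. *)
Lemma is_derive_primitive_continuous b q : mu.-integrable `[0, b] (EFin \o q) ->
  forall x, x \in `]0, b[ -> {for x, continuous q} -> is_derive x 1 (primitive q) (q x).
Proof.
move=> iq x; rewrite in_itv/= => /andP[x0 xb] cq.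
have [|d1 d2] := @continuous_FTC1 R q (BLeft 0) x b xb iq _ cq.
  by rewrite /= lte_fin.
by rewrite -d2 derive1E; exact: DeriveDef.
Qed.

End Primitive.

(** * The maximum principle and Phragmen-Lindelof *)

Section ComplexModulus.
Context {R : realType}.
Local Notation C := R[i].
Local Notation cn := ComplexField.Normc.normc.
Implicit Types (z w t : C).

Lemma cn_ge0 z : 0 <= cn z.
Proof. by case: z => x y; exact: sqrtr_ge0. Qed.

Lemma cnD z w : cn (z + w) <= cn z + cn w. Proof. exact: le_normcD. Qed.

Lemma cnN z : cn (- z) = cn z. Proof. exact: normcN. Qed.

Lemma cnB z w : cn (z - w) = cn (w - z). Proof. by rewrite -cnN opprB. Qed.

Lemma cnM z w : cn (z * w) = cn z * cn w. Proof. exact: ComplexField.Normc.normcM. Qed.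

Lemma cn1 : cn (1 : C) = 1. Proof. exact: ComplexField.Normc.normc1. Qed.

Lemma cn0 : cn (0 : C) = 0. Proof. exact: ComplexField.Normc.normc0. Qed.

Lemma cnX z n : cn (z ^+ n) = cn z ^+ n.
Proof. by elim: n => [|n IH]; rewrite ?expr0 ?cn1// !exprS cnM IH. Qed.

Lemma cn_eq0 z : cn z = 0 -> z = 0. Proof. exact: ComplexField.Normc.eq0_normc. Qed.

Lemma cn_real (x : R) : cn (x%:C)%C = `|x|.
Proof. by rewrite /= expr0n/= addr0 sqrtr_sqr. Qed.

Lemma cn_sqr z : cn z ^+ 2 = complex.Re z ^+ 2 + complex.Im z ^+ 2.
Proof. by case: z => x y /=; rewrite sqr_sqrtr// addr_ge0 ?sqr_ge0. Qed.

Lemma cn_Re z : `|complex.Re z| <= cn z.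
Proof.
rewrite -(@ler_pXn2r _ 2)// ?nnegrE ?cn_ge0// cn_sqr real_normK ?num_real//.
by rewrite lerDl sqr_ge0.
Qed.

Lemma cn_Im z : `|complex.Im z| <= cn z.
Proof.
rewrite -(@ler_pXn2r _ 2)// ?nnegrE ?cn_ge0// cn_sqr real_normK ?num_real//.
by rewrite lerDr sqr_ge0.
Qed.

Lemma cn_le z : cn z <= `|complex.Re z| + `|complex.Im z|.
Proof.
rewrite -(@ler_pXn2r _ 2)// ?nnegrE ?cn_ge0// ?addr_ge0// cn_sqr sqrrD.
rewrite !real_normK ?num_real//.
have := mulr_ge0 (normr_ge0 (complex.Re z)) (normr_ge0 (complex.Im z)); lra.
Qed.

Lemma cn_conj z : cn (conjc z) = cn z.
Proof. by case: z => x y /=; rewrite sqrrN. Qed.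

Lemma cn_natr n : cn (n%:R : C) = n%:R.
Proof. by rewrite -[n%:R in LHS](rmorph_nat (real_complex R)) cn_real ger0_norm. Qed.

(* Averaging p over t and - t gives a polynomial of half the degree in t ^+ 2, so
   the mean value property follows by induction without roots of unity. The
   second part is the equality case. *)
Lemma poly_mean (p : {poly C}) (rho M : R) : 0 <= rho ->
  (forall t, cn t = rho -> cn p.[t] <= M) ->
  cn p.[0] <= M /\ (M <= cn p.[0] -> forall t, cn t = rho -> M <= cn p.[t]).
Proof.
have [n] := ubnP (size p); elim: n => // n IH in p rho *; rewrite ltnS => pn rho0 pM.
have [p1|p1] := leqP (size p) 1.
  have [c pc] : exists c, p = c%:P by exists p`_0; exact: size1_polyC.
  have cr : cn ((rho%:C)%C : C) = rho by rewrite cn_real ger0_norm.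
  have := pM _ cr; rewrite pc !hornerC; split=> // cM t _.
  by rewrite hornerC.
pose e := even_poly p.
have en : (size e < n)%N.
  apply: leq_trans pn; apply: leq_ltn_trans (size_even_poly p) _.
  by case: (size p) p1 => [|[|k]] // _; rewrite uphalf_half /=; lia.
have eE t : 2%:R * e.[t ^+ 2] = p.[t] + p.[- t].
  have pE s : p.[s] = e.[s ^+ 2] + (odd_poly p).[s ^+ 2] * s.
    by rewrite -{1}[p]poly_even_odd hornerD hornerM !horner_comp !hornerE.
  by rewrite !pE sqrrN; ring.
have ptN t : cn t = rho -> cn p.[t] <= M /\ cn p.[- t] <= M.
  by move=> tr; split; apply: pM; rewrite ?cnN.
have eP t : 2 * cn e.[t ^+ 2] <= cn p.[t] + cn p.[- t].
  by rewrite -(cn_natr 2) -cnM eE cnD.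
have sqr_root w : cn w = rho ^+ 2 -> exists2 t, cn t = rho & w = t ^+ 2.
  move=> wr; exists (sqrtC w); last by rewrite sqrtCK.
  by apply/eqP; rewrite -(@eqrXn2 _ 2)// ?cn_ge0// -cnX sqrtCK wr.
have [|h1 h2] := IH e (rho ^+ 2) en (sqr_ge0 _).
  move=> w /sqr_root[t tr ->]; have := eP t; have [] := ptN t tr; lra.
have e0 : e.[0] = p.[0].
  have := eE 0; rewrite expr0n/= oppr0 => h.
  by apply: (@mulfI _ 2%:R); rewrite ?pnatr_eq0// h; ring.
(* If the average over [t] and [- t] reaches [M] while neither value exceeds [M], both values reach
   it. *)
rewrite -e0; split => // /h2 {}h2 t tr.
have := h2 (t ^+ 2); rewrite cnX tr => /(_ erefl).
have := eP t; have [] := ptN t tr; lra.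
Qed.

Lemma continuous_horner (p : {poly C}) :
  continuous (fun v : R * R => complex.Re p.[v.1 +i* v.2]%C) /\
  continuous (fun v : R * R => complex.Im p.[v.1 +i* v.2]%C).
Proof.
elim/poly_ind: p => [|p c [IH1 IH2]].
  split; [have -> : (fun v : R * R => complex.Re (0 : {poly C}).[v.1 +i* v.2]%C) = cst 0
         |have -> : (fun v : R * R => complex.Im (0 : {poly C}).[v.1 +i* v.2]%C) = cst 0];
    by [apply/funext => v; rewrite horner0 | exact: cst_continuous].
have E (v : R * R) : (p * 'X + c%:P).[v.1 +i* v.2]%C = Complex
    (complex.Re p.[v.1 +i* v.2]%C * v.1 - complex.Im p.[v.1 +i* v.2]%C * v.2 + complex.Re c)
    (complex.Re p.[v.1 +i* v.2]%C * v.2 + complex.Im p.[v.1 +i* v.2]%C * v.1 + complex.Im c).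
  by rewrite !hornerE; case: (p.[_]) c => [x y] [c1 c2].
split.
- have -> : (fun v : R * R => complex.Re (p * 'X + c%:P).[v.1 +i* v.2]%C) =
    (fun v : R * R => complex.Re p.[v.1 +i* v.2]%C * v.1 - complex.Im p.[v.1 +i* v.2]%C * v.2 + complex.Re c).
    by apply/funext => v; rewrite E.
  move=> v; apply: cvgD; last exact: cvg_cst.
  by apply: cvgB; apply: cvgM; [exact: IH1|exact: cvg_fst|exact: IH2|exact: cvg_snd].
- have -> : (fun v : R * R => complex.Im (p * 'X + c%:P).[v.1 +i* v.2]%C) =
    (fun v : R * R => complex.Re p.[v.1 +i* v.2]%C * v.2 + complex.Im p.[v.1 +i* v.2]%C * v.1 + complex.Im c).
    by apply/funext => v; rewrite E.
  move=> v; apply: cvgD; last exact: cvg_cst.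
  by apply: cvgD; apply: cvgM; [exact: IH1|exact: cvg_snd|exact: IH2|exact: cvg_fst].
Qed.

(* A maximum attained inside is attained on the whole of the largest circle
   inscribed around it, which meets the boundary. *)
Lemma poly_max_rectangle (p : {poly C}) (x0 x1 y0 y1 M : R) :
  (forall x y, x0 <= x <= x1 -> y0 <= y <= y1 ->
     [|| x == x0, x == x1, y == y0 | y == y1] -> cn p.[x +i* y]%C <= M) ->
  forall x y, x0 <= x <= x1 -> y0 <= y <= y1 -> cn p.[x +i* y]%C <= M.
Proof.
move=> pM x y xx yy.
pose f (v : R * R) := cn p.[v.1 +i* v.2]%C.
have [cRe cIm] := continuous_horner p.
have cf : continuous f.
  have -> : f = (fun v => Num.sqrt (complex.Re p.[v.1 +i* v.2]%C ^+ 2 + complex.Im p.[v.1 +i* v.2]%C ^+ 2)).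
    by apply/funext => v; rewrite /f; case: (p.[_]).
  move=> v; apply: continuous_comp; last exact: sqrt_continuous.
  by apply: cvgD; rewrite /= -?expr2; under eq_fun do rewrite expr2; apply: cvgM; [exact: cRe|exact: cRe|exact: cIm|exact: cIm].
pose A := `[x0, x1] `*` `[y0, y1] : set (R * R).
have [|||[xm ym]] := @compact_EVT_max _ R f A.
- by exists (x, y); split; rewrite /= in_itv.
- by apply: compact_setX; exact: segment_compact.
- exact: continuous_subspaceT.
rewrite inE /A/= !in_itv/= => -[xm01 ym01] fm.
have {}fm u v : x0 <= u <= x1 -> y0 <= v <= y1 -> cn p.[u +i* v]%C <= f (xm, ym).
  by move=> ux vy; apply: (fm (u, v)); rewrite inE; split; rewrite /= in_itv.
apply: le_trans (fm x y xx yy) _.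
rewrite leNgt; apply/negP => Mf.
have bd : ~~ [|| xm == x0, xm == x1, ym == y0 | ym == y1].
  by apply: contraL Mf; rewrite -leNgt; exact: pM.
pose d := Num.min (Num.min (xm - x0) (x1 - xm)) (Num.min (ym - y0) (y1 - ym)).
have [dx0 dx1 dy0 dy1] : [/\ d <= xm - x0, d <= x1 - xm, d <= ym - y0 & d <= y1 - ym].
  by rewrite /d !ge_min !lexx ?orbT.
have d0 : 0 <= d by rewrite /d !le_min !subr_ge0; lra.
pose q := p \Po ('X + ((xm +i* ym)%C)%:P).
have qE (u v : R) : q.[(u +i* v)%C] = p.[((xm + u) +i* (ym + v))%C].
  rewrite /q horner_comp !hornerE; congr (p.[_]).
  by rewrite addrC.
have q0 : q.[0] = p.[(xm +i* ym)%C].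
  by have := qE 0 0; rewrite !addr0.
have [|_ h] := @poly_mean q d (f (xm, ym)) d0.
  move=> t td; have := cn_Re t; have := cn_Im t; rewrite td !ler_norml.
  case: t td => u v /= _ uu vv; rewrite qE; apply: fm; lra.
rewrite q0 lexx in h; have {}h := h isT.
have key (u v : R) : cn (u +i* v)%C = d ->
    [|| xm + u == x0, xm + u == x1, ym + v == y0 | ym + v == y1] -> False.
  move=> uvd bd'; have := h _ uvd; rewrite qE leNgt => /negP; apply.
  apply: le_lt_trans Mf; apply: pM => //.
    by have := cn_Re (u +i* v)%C; rewrite uvd ler_norml/=; lra.
  by have := cn_Im (u +i* v)%C; rewrite uvd ler_norml/=; lra.
have cnr (u : R) : `|u| = d -> cn (u +i* 0)%C = d by rewrite -cn_real.
have cni (u : R) : `|u| = d -> cn (0 +i* u)%C = d.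
  by move=> <-; rewrite /= expr0n/= add0r sqrtr_sqr.
have nd : `|- d| = d by rewrite normrN ger0_norm.
have pd : `|d| = d by rewrite ger0_norm.
have : [|| d == xm - x0, d == x1 - xm, d == ym - y0 | d == y1 - ym].
  rewrite /d /Num.min; repeat (case: ifPn => _); by rewrite eqxx ?orbT.
case/or4P => /eqP dE.
- by apply: (key (- d) 0); [exact: cnr|rewrite dE; apply/or4P/Or41/eqP; lra].
- by apply: (key d 0); [exact: cnr|rewrite dE; apply/or4P/Or42/eqP; lra].
- by apply: (key 0 (- d)); [exact: cni|rewrite dE; apply/or4P/Or43/eqP; lra].
- by apply: (key 0 d); [exact: cni|rewrite dE; apply/or4P/Or44/eqP; lra].
Qed.

End ComplexModulus.

(** * The exponential and locally uniform limits of polynomials *)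

Section ComplexExponential.
Context {R : realType}.
Local Notation C := R[i].
Local Notation cn := ComplexField.Normc.normc.
Implicit Types (z w t : C) (F G : C -> C).

Definition cexp z : C := Complex (expR (complex.Re z) * cos (complex.Im z))
                                 (expR (complex.Re z) * sin (complex.Im z)).

Lemma cexpD z w : cexp (z + w) = cexp z * cexp w.
Proof.
case: z w => [a b] [c d]; rewrite /cexp/= expRD cosD sinD; congr Complex; ring.
Qed.

Lemma cexp0 : cexp 0 = 1.
Proof. by rewrite /cexp/= expR0 cos0 sin0 mulr1 mulr0. Qed.

Lemma cn_cexp z : cn (cexp z) = expR (complex.Re z).
Proof.
rewrite /= !exprMn -mulrDr cos2Dsin2 mulr1 sqrtr_sqr ger0_norm//.
Qed.

Lemma cexpMn z n : cexp (z *+ n) = cexp z ^+ n.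
Proof. by elim: n => [|n IH]; rewrite ?mulr0n ?expr0 ?cexp0// mulrS cexpD IH exprS. Qed.

Lemma abs_sin_le (y : R) : `|sin y| <= `|y|.
Proof.
have h (x : R) : 0 < x -> `|sin x| <= x.
  move=> x0; have [|c _] := @MVT R sin cos 0 x x0.
    by apply: continuous_subspaceT; exact: continuous_sin.
  rewrite sin0 !subr0 => ->; rewrite normrM (gtr0_norm x0) ler_piMl ?(ltW x0)//.
  by rewrite ler_norml cos_geN1 cos_le1.
have [y0|y0|->] := ltgtP y 0; last by rewrite sin0.
  by rewrite -normrN -sinN (ltr0_norm y0) h// oppr_gt0.
by rewrite (gtr0_norm y0) h.
Qed.

Lemma abs_cosB1_le (y : R) : `|cos y - 1| <= y ^+ 2 / 2.
Proof.
have -> : cos y - 1 = - (2 * sin (y / 2) ^+ 2).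
  have e : cos y = cos (y / 2) * cos (y / 2) - sin (y / 2) * sin (y / 2).
    by rewrite -cosD -splitr.
  have := cos2Dsin2 (y / 2); rewrite e !expr2; lra.
rewrite normrN normrM ger0_norm// normrX.
have := abs_sin_le (y / 2); rewrite -(@ler_pXn2r _ 2)// ?nnegrE//.
by rewrite [X in _ <= X]real_normK ?num_real// exprMn => h; lra.
Qed.

Lemma abs_sinB_le (y : R) : `|y| <= 1 -> `|sin y - y| <= y ^+ 2.
Proof.
have h (x : R) : 0 < x -> x <= 1 -> `|sin x - x| <= x ^+ 2.
  move=> x0 x1; have [|c] := @MVT R (fun t : R => sin t - t) (fun t : R => cos t - 1) 0 x x0.
    apply: continuous_subspaceT => t; apply: cvgB; [exact: continuous_sin|exact: cvg_id].
  rewrite in_itv/= => /andP[c0 cx].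
  rewrite sin0 !subr0 => ->; rewrite normrM (gtr0_norm x0) expr2 ler_wpM2r ?(ltW x0)//.
  apply: le_trans (abs_cosB1_le c) _; nra.
have [y0|y0|->] := ltgtP y 0; last by rewrite sin0 subrr normr0 sqr_ge0.
  rewrite (ltr0_norm y0) => y1.
  by rewrite -normrN opprB addrC -sinN -[_ ^+ 2]sqrrN -[X in sin _ + X]opprK h ?oppr_gt0.
by rewrite (gtr0_norm y0) => y1; exact: h.
Qed.

Lemma abs_expRB1B_le (x : R) : `|x| <= 1 / 2 -> `|expR x - 1 - x| <= 2 * x ^+ 2.
Proof.
rewrite ler_norml => /andP[x1 x2].
have h1 := expR_ge1Dx x; have h2 := expR_ge1Dx (- x).
have h3 : expR x * expR (- x) = 1 by rewrite -expRD subrr expR0.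
have h0 := expR_gt0 x.
rewrite ger0_norm; last by lra.
nra.
Qed.

(** What counts is the quadratic order of the remainder: over the [n] factors of [cexp (z / n) ^+ n]
    it leaves a total error of order [1 / n]. *)
Lemma cexp_taylor1 w : cn w <= 1 / 2 -> cn (cexp w - (1 + w)) <= 8 * cn w ^+ 2.
Proof.
move=> w1; have Re1 := le_trans (cn_Re w) w1; have Im1 := le_trans (cn_Im w) w1.
rewrite cn_sqr; apply: le_trans (cn_le _) _.
case: w {w1} Re1 Im1 => x y /= x1 y1.
have hx := abs_expRB1B_le x1.
have hs : `|sin y - y| <= y ^+ 2 by apply: abs_sinB_le; lra.
have hc := abs_cosB1_le y.
have e2 : 0 <= expR x <= 2.
  rewrite expR_ge0/=; move: hx; rewrite ler_norml => /andP[_ hx].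
  move: x1; rewrite ler_norml => /andP[? ?].
  have : x ^+ 2 <= 1 / 4 by nra.
  lra.
have re : `|expR x * cos y - (1 + x)| <= 2 * x ^+ 2 + y ^+ 2.
  have -> : expR x * cos y - (1 + x) = (expR x - 1 - x) + expR x * (cos y - 1) by ring.
  apply: le_trans (ler_normD _ _) _; apply: lerD => //.
  rewrite normrM ger0_norm; last by case/andP: e2.
  by have := normr_ge0 (cos y - 1); nra.
have ex : `|expR x - 1| <= 2 * `|x|.
  have -> : expR x - 1 = (expR x - 1 - x) + x by ring.
  apply: le_trans (ler_normD _ _) _.
  have : x ^+ 2 = `|x| ^+ 2 by rewrite real_normK ?num_real.
  by have := normr_ge0 x; nra.
have im : `|expR x * sin y - (0 + y)| <= 2 * y ^+ 2 + (x ^+ 2 + y ^+ 2).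
  have -> : expR x * sin y - (0 + y) = expR x * (sin y - y) + (expR x - 1) * y by ring.
  apply: le_trans (ler_normD _ _) _; apply: lerD.
    rewrite normrM ger0_norm; last by case/andP: e2.
    by have := normr_ge0 (sin y - y); nra.
  rewrite normrM; have <- : `|x| ^+ 2 = x ^+ 2 by rewrite real_normK ?num_real.
  have <- : `|y| ^+ 2 = y ^+ 2 by rewrite real_normK ?num_real.
  apply: (@le_trans _ _ (2 * `|x| * `|y|)); first by rewrite ler_wpM2r.
  by have := sqr_ge0 (`|x| - `|y|); nra.
have := sqr_ge0 x; have := sqr_ge0 y; lra.
Qed.

Lemma cn_exprB_le (z w : C) (M : R) n : cn z <= M -> cn w <= M ->
  cn (z ^+ n.+1 - w ^+ n.+1) <= n.+1%:R * M ^+ n * cn (z - w).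
Proof.
move=> zM wM; have M0 : 0 <= M := le_trans (cn_ge0 _) zM.
elim: n => [|n IH]; first by rewrite !expr1 expr0 !mul1r.
have -> : z ^+ n.+2 - w ^+ n.+2 = z * (z ^+ n.+1 - w ^+ n.+1) + (z - w) * w ^+ n.+1.
  by rewrite [z ^+ n.+2]exprS [w ^+ n.+2]exprS; ring.
apply: le_trans (cnD _ _) _; rewrite !cnM cnX.
have h1 : cn z * cn (z ^+ n.+1 - w ^+ n.+1) <= M * (n.+1%:R * M ^+ n * cn (z - w)).
  by apply: ler_pM => //; exact: cn_ge0.
have h2 : cn (z - w) * cn w ^+ n.+1 <= cn (z - w) * M ^+ n.+1.
  by rewrite ler_wpM2l ?cn_ge0// lerXn2r ?nnegrE ?cn_ge0.
apply: le_trans (lerD h1 h2) _.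
rewrite -[n.+2]addn1 natrD exprS; by rewrite le_eqVlt; apply/orP; left; apply/eqP; ring.
Qed.

(* Stands in for "entire". *)
Definition polyapprox F := forall r e : R, 0 < e ->
  exists p : {poly C}, forall z, cn z <= r -> cn (F z - p.[z]) <= e.

Lemma polyapprox_horner (p : {poly C}) : polyapprox (fun z => p.[z]).
Proof. by move=> r e e0; exists p => z _; rewrite subrr cn0 ltW. Qed.

Lemma polyapprox_cst (c : C) : polyapprox (fun=> c).
Proof. by move=> r e e0; exists c%:P => z _; rewrite hornerC subrr cn0 ltW. Qed.

Lemma polyapprox_id : polyapprox id.
Proof. by move=> r e e0; exists 'X => z _; rewrite hornerX subrr cn0 ltW. Qed.

Lemma polyapproxD F G : polyapprox F -> polyapprox G -> polyapprox (fun z => F z + G z).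
Proof.
move=> hF hG r e e0; have e20 : 0 < e / 2 by rewrite divr_gt0.
have [p hp] := hF r _ e20; have [q hq] := hG r _ e20.
exists (p + q) => z zr; rewrite hornerD opprD addrACA.
by rewrite (splitr e); apply: le_trans (cnD _ _) _; apply: lerD; [exact: hp|exact: hq].
Qed.

Lemma horner_bounded (p : {poly C}) (r : R) :
  exists2 M, 0 < M & forall z, cn z <= r -> cn p.[z] <= M.
Proof.
elim/poly_ind: p => [|p c [M M0 hM]].
  by exists 1 => // z _; rewrite horner0 cn0.
exists (M * (`|r| + 1) + cn c).
  by rewrite ltr_wpDr ?cn_ge0// mulr_gt0// ltr_wpDl.
move=> z zr; rewrite !hornerE; apply: le_trans (cnD _ _) _; rewrite lerD2r cnM.
apply: ler_pM; rewrite ?cn_ge0 ?hM//.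
by rewrite (le_trans zr)// (le_trans (ler_norm _))// lerDl.
Qed.

Lemma polyapprox_bounded F (r : R) : polyapprox F ->
  exists2 M, 0 < M & forall z, cn z <= r -> cn (F z) <= M.
Proof.
move=> hF; have [p hp] := hF r 1 ltr01; have [M M0 hM] := horner_bounded p r.
exists (1 + M) => [|z zr]; first by rewrite addr_gt0.
rewrite -[F z](subrK p.[z]); apply: le_trans (cnD _ _) _.
by apply: lerD; [exact: hp|exact: hM].
Qed.

Lemma polyapprox_lim F : (forall r e : R, 0 < e -> exists2 G, polyapprox G &
    forall z, cn z <= r -> cn (F z - G z) <= e) -> polyapprox F.
Proof.
move=> hF r e e0; have e20 : 0 < e / 2 by rewrite divr_gt0.
have [G hG FG] := hF r _ e20; have [p hp] := hG r _ e20.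
exists p => z zr; rewrite (splitr e) -[F z](subrK (G z)) -addrA.
by apply: le_trans (cnD _ _) _; apply: lerD; [exact: FG|exact: hp].
Qed.

Lemma polyapproxZ_poly F (p : {poly C}) : polyapprox F -> polyapprox (fun z => F z * p.[z]).
Proof.
move=> hF r e e0; have [M M0 hM] := horner_bounded p r.
have eM0 : 0 < e / M by rewrite divr_gt0.
have [q hq] := hF r _ eM0; exists (q * p) => z zr.
rewrite hornerM -mulrBl cnM -(divfK (lt0r_neq0 M0) e).
by apply: ler_pM; rewrite ?cn_ge0 ?hq ?hM.
Qed.

Lemma polyapproxM F G : polyapprox F -> polyapprox G -> polyapprox (fun z => F z * G z).
Proof.
move=> hF hG; apply: polyapprox_lim => r e e0.
have [M M0 hM] := polyapprox_bounded r hF.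
have eM0 : 0 < e / M by rewrite divr_gt0.
have [q hq] := hG r _ eM0; exists (fun z => F z * q.[z]); first exact: polyapproxZ_poly.
move=> z zr; rewrite -mulrBr cnM mulrC -(divfK (lt0r_neq0 M0) e).
by apply: ler_pM; rewrite ?cn_ge0 ?hq ?hM.
Qed.

Lemma polyapprox_comp F G : polyapprox F -> polyapprox G -> polyapprox (fun z => F (G z)).
Proof.
move=> hF hG; apply: polyapprox_lim => r e e0.
have [M M0 hM] := polyapprox_bounded r hG.
have [p hp] := hF M _ e0; exists (fun z => p.[G z]); last first.
  by move=> z zr; apply: hp; exact: hM.
elim/poly_ind: p {hp} => [|p c IH].
  under eq_fun do rewrite horner0; exact: polyapprox_cst.
under eq_fun do rewrite !hornerE.
by apply: polyapproxD; [exact: polyapproxM|exact: polyapprox_cst].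
Qed.

(** The polynomials are [(1 + z / n) ^+ n], compared with [cexp (z / n) ^+ n]. Both bases have
    modulus at most [expR (r' / n)], so the n-th power multiplies the Taylor error by at most
    [n * expR r']. *)
Lemma polyapprox_cexp : polyapprox cexp.
Proof.
move=> r e e0; pose r' := `|r| + 1.
have r'0 : 0 < r' by rewrite ltr_wpDl.
have rr' : r <= r' by rewrite (le_trans (ler_norm _))// lerDl.
(* The first bound puts [z / n] in the range of [cexp_taylor1], the second makes the final error at
   most [e]. *)
pose N := Num.max (2 * r') (8 * r' ^+ 2 * expR r' / e).
pose n := Num.truncn `|N|; have nN : N < n.+1%:R.
  by apply: le_lt_trans (ler_norm _) _; exact: truncnS_gt.
have [n1 n2] : 2 * r' < n.+1%:R /\ 8 * r' ^+ 2 * expR r' / e < n.+1%:R.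
  by move: nN; rewrite gt_max => /andP[].
have np : 0 < n.+1%:R :> R by [].
exists ((1 + (n.+1%:R)^-1 *: 'X) ^+ n.+1) => z zr.
pose w := (n.+1%:R)^-1 * z.
have wz : z = w *+ n.+1 by rewrite /w -mulr_natl mulrA divff ?mul1r// pnatr_eq0.
rewrite horner_exp !hornerE -/w {1}wz cexpMn.
have cw : cn w <= r' / n.+1%:R.
  by rewrite /w cnM ComplexField.Normc.normcV cn_natr mulrC ler_wpM2r ?invr_ge0// (le_trans zr).
have cw2 : cn w <= 1 / 2.
  by apply: le_trans cw _; rewrite ler_pdivrMr//; lra.
have M1 : cn (cexp w) <= expR (r' / n.+1%:R).
  by rewrite cn_cexp ler_expR (le_trans _ cw)// (le_trans (ler_norm _))// cn_Re.
have M2 : cn (1 + w) <= expR (r' / n.+1%:R).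
  apply: le_trans (cnD _ _) _; rewrite cn1; apply: le_trans (expR_ge1Dx _).
  by rewrite lerD2l.
apply: le_trans (cn_exprB_le n M1 M2) _.
have E1 : expR (r' / n.+1%:R) ^+ n <= expR r'.
  rewrite -expRM_natl ler_expR mulrA ler_pdivrMr//.
  by rewrite mulrC ler_wpM2l ?(ltW r'0)// ler_nat.
have T := cexp_taylor1 cw2.
have E2 : cn w ^+ 2 <= (r' / n.+1%:R) ^+ 2 by rewrite lerXn2r ?nnegrE ?cn_ge0 ?divr_ge0 ?(ltW r'0).
apply: (@le_trans _ _ (n.+1%:R * expR r' * (8 * (r' / n.+1%:R) ^+ 2))).
  apply: ler_pM; rewrite ?cn_ge0 ?mulr_ge0 ?exprn_ge0 ?expR_ge0//.
    by rewrite ler_wpM2l.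
  by apply: le_trans T _; rewrite ler_wpM2l.
have -> : n.+1%:R * expR r' * (8 * (r' / n.+1%:R) ^+ 2) = 8 * r' ^+ 2 * expR r' / n.+1%:R.
  by field; rewrite addrC natr1 lt0r_neq0.
by rewrite ler_pdivrMr// [leRHS]mulrC -ler_pdivrMr// ltW.
Qed.

End ComplexExponential.

(** * Phragmen-Lindelof in a sector *)

Section PhragmenLindelof.
Context {R : realType}.
Local Notation C := R[i].
Local Notation cn := ComplexField.Normc.normc.
Implicit Types (z w : C) (F G : C -> C).

Lemma polyapprox_max_rectangle F (x0 x1 y0 y1 M : R) : polyapprox F ->
  (forall x y, x0 <= x <= x1 -> y0 <= y <= y1 ->
     [|| x == x0, x == x1, y == y0 | y == y1] -> cn (F (x +i* y)%C) <= M) ->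
  forall x y, x0 <= x <= x1 -> y0 <= y <= y1 -> cn (F (x +i* y)%C) <= M.
Proof.
move=> hF FM x y xx yy; apply/ler_addgt0Pr => e e0.
have e20 : 0 < e / 2 by rewrite divr_gt0.
have [p hp] := hF (`|x0| + `|x1| + (`|y0| + `|y1|)) _ e20.
have inr u v : x0 <= u <= x1 -> y0 <= v <= y1 ->
    cn (u +i* v)%C <= `|x0| + `|x1| + (`|y0| + `|y1|).
  have aux (a b t : R) : a <= t <= b -> `|t| <= `|a| + `|b|.
    move=> /andP[at_ tb]; have := ler_norm b; have := ler_norm (- a).
    have := normr_ge0 a; have := normr_ge0 b.
    by rewrite normrN ler_norml => *; apply/andP; split; lra.
  by move=> ux vy; apply: le_trans (cn_le _) _; apply: lerD; exact: aux.
have pM : cn p.[(x +i* y)%C] <= M + e / 2.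
  apply: (@poly_max_rectangle _ p x0 x1 y0 y1) => // u v ux vy bd.
  rewrite -[p.[_]](subrK (F (u +i* v)%C)) addrC; apply: le_trans (cnD _ _) _.
  by apply: lerD; [exact: FM|rewrite cnB; apply: hp; exact: inr].
rewrite (splitr e) addrA -[F _](subrK p.[(x +i* y)%C]) addrC; apply: le_trans (cnD _ _) _.
by apply: lerD => //; apply: hp; exact: inr.
Qed.

Lemma expR_large (a M : R) : 0 < a -> exists s0, forall s, s0 <= s -> M <= expR (a * s).
Proof.
move=> a0; exists (`|M| / a) => s; rewrite ler_pdivrMr// mulrC => h.
by have := expR_ge1Dx (a * s); have := ler_norm M; lra.
Qed.

(* The sector |arg z - c| <= w0 is read in the coordinate w = log z = s + it, and F
   is multiplied by exp (w / 2 - d exp (rho (w - ic))) with 1/2 < rho < pi / (2 w0);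
   then d tends to 0. *)
Lemma phragmen_lindelof_strip F (c w0 K A : R) : polyapprox F ->
  0 < w0 -> w0 < pi -> 0 < K -> 0 < A ->
  (forall s t, cn (F (cexp (s +i* t)%C)) <= A * expR (A * expR (s / 2))) ->
  (forall s t, `|t - c| = w0 -> cn (F (cexp (s +i* t)%C)) * expR (s / 2) <= K) ->
  forall s t, `|t - c| <= w0 -> cn (F (cexp (s +i* t)%C)) * expR (s / 2) <= K.
Proof.
move=> hF w00 w0pi K0 A0 growth bd s t tw.
have pi0 := @pi_gt0 R.
(* The midpoint of the admissible range, which is nonempty because [w0 < pi]. *)
pose rho := (1 / 2 + pi / (2 * w0)) / 2.
have pw : 1 / 2 < pi / (2 * w0) by rewrite ltr_pdivlMr ?mulr_gt0//; lra.
have rho12 : 1 / 2 < rho by rewrite /rho; lra.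
have rhow : rho * w0 < pi / 2.
  have : pi / (2 * w0) * w0 = pi / 2 by field; rewrite lt0r_neq0.
  by rewrite /rho; nra.
have rhow0 : 0 < rho * w0 by rewrite mulr_gt0//; lra.
(* Positive because [rho * w0 < pi / 2]: on the whole strip the damping factor has modulus at most
   [exp (- d kp exp (rho u))], [u] being the real part. *)
pose kp := cos (rho * w0).
have kp0 : 0 < kp by apply: cos_gt0_pihalf; rewrite rhow andbT; lra.
have coskp u : `|u - c| <= w0 -> kp <= cos (rho * (u - c)).
  move=> uw; have -> : cos (rho * (u - c)) = cos (rho * `|u - c|).
    by rewrite -[in LHS]cos_norm normrM (@gtr0_norm _ rho)//; lra.
  have h0 := normr_ge0 (u - c).
  have r0 : 0 <= rho by lra.
  have h1 : rho * `|u - c| <= rho * w0 by rewrite ler_wpM2l.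
  have h2 : 0 <= rho * `|u - c| by rewrite mulr_ge0.
  have i1 : rho * `|u - c| \in `[0, pi] by rewrite in_itv/= h2/=; lra.
  have i2 : rho * w0 \in `[0, pi] by rewrite in_itv/=; apply/andP; split; lra.
  by rewrite /kp leNgt ltr_cos// -leNgt.
pose X := cn (F (cexp (s +i* t)%C)) * expR (s / 2).
have [//|KX] := leP X K; exfalso.
(* [d] is so small that at the given point the damped product still exceeds [K], which the maximum
   principle for [G] will contradict. *)
have [d d0 dX] : exists2 d, 0 < d & K * expR (d * expR (rho * s)) < X.
  have XK1 : 1 < X / K by rewrite ltr_pdivlMr// mul1r.
  exists (ln (X / K) / 2 / expR (rho * s)).
    by rewrite !divr_gt0 ?expR_gt0// ln_gt0.
  rewrite divfK ?lt0r_neq0 ?expR_gt0//.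
  have : expR (ln (X / K) / 2) < X / K.
    have XK0 : 0 < X / K by lra.
    rewrite -[ltRHS]lnK ?posrE// ltr_expR ltr_pdivrMr//.
    by have := ln_gt0 XK1; lra.
  by rewrite ltr_pdivlMr// mulrC.
pose cc : C := Complex 0 c.
pose G w := F (cexp w) * cexp (((1 / 2)%:C)%C * w) *
  cexp ((- d)%:C%C * cexp ((rho%:C)%C * (w + (- cc)))).
have hG : polyapprox G.
  apply: polyapproxM; first apply: polyapproxM.
  - by apply: polyapprox_comp => //; exact: polyapprox_cexp.
  - apply: polyapprox_comp; first exact: polyapprox_cexp.
    by apply: polyapproxM; [exact: polyapprox_cst|exact: polyapprox_id].
  - apply: polyapprox_comp; first exact: polyapprox_cexp.
    apply: polyapproxM; first exact: polyapprox_cst.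
    apply: polyapprox_comp; first exact: polyapprox_cexp.
    apply: polyapproxM; first exact: polyapprox_cst.
    by apply: polyapproxD; [exact: polyapprox_id|exact: polyapprox_cst].
have GE u v : cn (G (u +i* v)%C) = cn (F (cexp (u +i* v)%C)) * expR (u / 2) *
    expR (- d * (expR (rho * u) * cos (rho * (v - c)))).
  rewrite /G !cnM !cn_cexp; congr (_ * expR _ * expR _).
    by rewrite /= mul0r subr0; lra.
  by rewrite /= !mul0r !subr0 addr0.
(* [expR (rho * u)] is [expR (u / 2)] times [expR (sg / 2 * u)]; this surplus eventually beats any
   constant in the growth exponent. *)
pose sg := 2 * rho - 1.
have sg0 : 0 < sg by rewrite /sg; lra.
have dk0 : 0 < d * kp by rewrite mulr_gt0.
(* On the right edge, [s1] makes damping beat growth and [s2] brings the remainder below [K]. On the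
   left edge [F] is bounded, and [s3] makes the weight [expR (u / 2)] small enough. *)
have [s1 hs1] : exists s1, forall u, s1 <= u -> (A + 2) / (d * kp) <= expR (sg / 2 * u).
  by apply: expR_large; rewrite divr_gt0.
have [s2 hs2] : exists s2, forall u, s2 <= u -> A / K <= expR (1 / 2 * u).
  by apply: expR_large.
have [s3 hs3] : exists s3, forall u, s3 <= u -> A * expR A / K <= expR (1 / 2 * u).
  by apply: expR_large.
pose sr := `|s1| + `|s2| + `|s|.
pose sl := - (`|s3| + `|s|).
have KG : cn (G (s +i* t)%C) <= K.
  apply: (@polyapprox_max_rectangle G sl sr (c - w0) (c + w0)) => //.
  - move=> u v uu; rewrite GE => /andP[v1 v2] bdr.
    have vw : `|v - c| <= w0 by rewrite ler_norml; move: v1 v2; clear; lra.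
    have ck := coskp v vw.
    have e1 := expR_gt0 (rho * u).
    have ex1 : expR (- d * (expR (rho * u) * cos (rho * (v - c)))) <= 1.
      rewrite -[leRHS]expR0 ler_expR mulNr oppr_le0 mulr_ge0 ?(ltW d0)//.
      by rewrite mulr_ge0 ?expR_ge0// (le_trans (ltW kp0)).
    have ex0 := expR_ge0 (- d * (expR (rho * u) * cos (rho * (v - c)))).
    have F0 : 0 <= cn (F (cexp (u +i* v)%C)) * expR (u / 2) by rewrite mulr_ge0 ?cn_ge0 ?expR_ge0.
    have gr := growth u v.
    have [uE|uE|vE] : [\/ u = sl, u = sr | `|v - c| = w0].
      case/or4P: bdr => /eqP ->; [exact: Or31|exact: Or32|apply: Or33|apply: Or33].
        by rewrite addrAC subrr sub0r normrN gtr0_norm.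
      by rewrite addrAC subrr add0r gtr0_norm.
    + have u0 : u <= 0 by rewrite uE /sl oppr_le0 addr_ge0.
      have := hs3 (- u); have -> : s3 <= - u.
        by rewrite uE /sl opprK (le_trans (ler_norm _))// lerDl.
      move=> /(_ isT); rewrite ler_pdivrMr// => hs.
      apply: le_trans (_ : cn (F (cexp (u +i* v)%C)) * expR (u / 2) <= _).
        by rewrite ler_piMr.
      apply: (@le_trans _ _ (A * expR A * expR (u / 2))).
        rewrite ler_wpM2r ?expR_ge0//; apply: le_trans gr _.
        rewrite ler_wpM2l ?(ltW A0)// ler_expR ler_piMr ?(ltW A0)//.
        by rewrite -[leRHS]expR0 ler_expR; move: u0; clear; lra.
      apply: le_trans (ler_wpM2r (expR_ge0 _) hs) _.
      rewrite mulrAC -expRD; have -> : 1 / 2 * - u + u / 2 = 0 by clear; lra.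
      by rewrite expR0 mul1r.
    + have us1 : s1 <= u by rewrite uE /sr -addrA (le_trans (ler_norm _))// lerDl addr_ge0.
      have us2 : s2 <= u by rewrite uE /sr -addrA addrCA (le_trans (ler_norm _))// lerDl addr_ge0.
      have {}hs1 := hs1 u us1; have {}hs2 := hs2 u us2.
      move: hs1; rewrite ler_pdivrMr// => hs1.
      move: hs2; rewrite ler_pdivrMr// => hs2.
      pose Y := expR (u / 2).
      have Y0 : 0 < Y by exact: expR_gt0.
      have hY : expR (1 / 2 * u) = Y by rewrite /Y; congr expR; clear; lra.
      have rE : expR (rho * u) = Y * expR (sg / 2 * u).
        by rewrite /Y -expRD; congr expR; rewrite /sg; clear; lra.
      (* Of the [(A + 2) * Y] gained by damping, [A * Y] cancels the growth of [F], one [Y] the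
         weight [expR (u / 2) = Y <= expR Y], and the last [Y] is left as decay. *)
      apply: (@le_trans _ _ (A * expR (A * Y) * expR Y * expR (- ((A + 2) * Y)))).
        apply: ler_pM => //.
          apply: ler_pM; rewrite ?cn_ge0 ?expR_ge0//.
          by rewrite -/Y; move: (expR_ge1Dx Y); clear; lra.
        rewrite ler_expR mulNr lerN2 rE.
        apply: (@le_trans _ _ (Y * (expR (sg / 2 * u) * (d * kp)))).
          by rewrite mulrC ler_wpM2l ?(ltW Y0).
        have : 0 <= Y * expR (sg / 2 * u) * d * (cos (rho * (v - c)) - kp).
          by rewrite mulr_ge0 ?subr_ge0// mulr_ge0 ?(ltW d0)// mulr_ge0 ?expR_ge0.
        by clear; lra.
      have -> : A * expR (A * Y) * expR Y * expR (- ((A + 2) * Y)) = A * expR (- Y).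
        rewrite -!mulrA -!expRD; congr (_ * expR _); ring.
      rewrite expRN ler_pdivrMr ?expR_gt0//.
      apply: le_trans hs2 _; rewrite hY mulrC ler_wpM2l ?(ltW K0)//.
      by move: (expR_ge1Dx Y); clear; lra.
    + apply: le_trans (bd u v vE).
      by rewrite ler_piMr.
  - rewrite /sl /sr; have := ler_norm s; have := ler_norm (- s); rewrite normrN.
    have := normr_ge0 s1; have := normr_ge0 s2; have := normr_ge0 s3.
    by clear; move=> *; apply/andP; split; lra.
  - by move: tw; rewrite ler_norml; clear => /andP[? ?]; apply/andP; split; lra.
have := GE s t; rewrite -/X => GX.
have : X * expR (- (d * expR (rho * s))) <= cn (G (s +i* t)%C).
  rewrite GX; apply: ler_wpM2l; first by rewrite (le_trans (ltW K0))// ltW.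
  rewrite ler_expR mulNr lerN2 ler_wpM2l ?(ltW d0)// ler_piMr ?expR_ge0//.
rewrite expRN -/X => h; have {h}h := le_trans h KG.
by move: h; rewrite ler_pdivrMr ?expR_gt0// leNgt dX.
Qed.

End PhragmenLindelof.

(** * Vanishing at 0 from decay along a ray *)

Section RayUniqueness.
Context {R : realType}.
Local Notation C := R[i].
Local Notation cn := ComplexField.Normc.normc.
Implicit Types (z w : C) (F G : C -> C).

Lemma cexp_polar (s t : R) : cexp (s +i* t)%C = polar (expR s) t.
Proof. by []. Qed.

Lemma cn_polar (r t : R) : 0 <= r -> cn (polar r t) = r.
Proof.
by move=> r0; rewrite /= !exprMn -mulrDr cos2Dsin2 mulr1 sqrtr_sqr ger0_norm.
Qed.

Lemma polarP z : z != 0 -> exists2 t, - pi <= t <= pi & z = polar (cn z) t.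
Proof.
move=> z0; have r0 : 0 < cn z.
  by rewrite lt0r cn_ge0 andbT; apply: contraNneq z0 => /cn_eq0 ->.
case: z z0 r0 => x y _; set r := cn _ => r0.
have rE : r ^+ 2 = x ^+ 2 + y ^+ 2 by rewrite /r cn_sqr.
have xr : -1 <= x / r <= 1.
  have := cn_Re (x +i* y)%C; rewrite -/r/= -ler_norml normrM normfV (gtr0_norm r0).
  by rewrite ler_pdivrMr// mul1r.
have cx : cos (acos (x / r)) = x / r by rewrite acosK// in_itv.
have sx : sin (acos (x / r)) = `|y| / r.
  rewrite sin_acos//; have -> : 1 - (x / r) ^+ 2 = (y / r) ^+ 2.
    have : (r / r) ^+ 2 = (x / r) ^+ 2 + (y / r) ^+ 2 by rewrite !expr_div_n rE mulrDl.
    by rewrite divff ?lt0r_neq0// expr1n => ->; ring.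
  by rewrite sqrtr_sqr normrM normfV (gtr0_norm r0).
have a0 := acos_ge0 xr; have ap := acos_lepi xr.
have [y0|y0] := leP 0 y.
  exists (acos (x / r)); first by apply/andP; split => //; lra.
  rewrite /polar cx sx ger0_norm//; congr Complex; field; exact: lt0r_neq0.
exists (- acos (x / r)); first by apply/andP; split; lra.
rewrite /polar cosN sinN cx sx ltr0_norm//; congr Complex; field; exact: lt0r_neq0.
Qed.

Lemma sqrt_expR (s : R) : Num.sqrt (expR s) = expR (s / 2).
Proof.
rewrite {1}(splitr s) expRD -expr2 sqrtr_sqr ger0_norm//; exact: expR_ge0.
Qed.

(** The sectors have half-openings [pi - eps] and [eps], both below [pi] as the strip lemma
    requires. The resulting bound on large circles is carried to the origin by [poly_mean], applied
    to a polynomial close to [F]. *)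
Lemma bounded_ray_eq0 F (eps K A : R) : polyapprox F -> 0 < eps < pi / 2 ->
  (forall z, cn (F (conjc z)) = cn (F z)) ->
  (forall z, cn (F z) <= A * expR (A * Num.sqrt (cn z))) ->
  (forall r, 0 < r -> cn (F (polar r (pi - eps))) * Num.sqrt r <= K) ->
  F 0 = 0.
Proof.
move=> hF /andP[eps0 epspi] conjF growth ray.
pose A' := `|A| + 1; have A'0 : 0 < A' by rewrite ltr_wpDl.
pose K' := `|K| + 1; have K'0 : 0 < K' by rewrite ltr_wpDl.
have AA' : A <= A' by have := ler_norm A; rewrite /A'; lra.
have KK' : K <= K' by have := ler_norm K; rewrite /K'; lra.
have gr s t : cn (F (cexp (s +i* t)%C)) <= A' * expR (A' * expR (s / 2)).
  apply: le_trans (growth _) _; rewrite cn_cexp /= sqrt_expR.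
  apply: (@le_trans _ _ (A' * expR (A * expR (s / 2)))).
    by rewrite ler_wpM2r ?expR_ge0.
  by rewrite ler_wpM2l ?(ltW A'0)// ler_expR ler_wpM2r ?expR_ge0.
have ray1 s : cn (F (cexp (s +i* (pi - eps))%C)) * expR (s / 2) <= K'.
  by rewrite cexp_polar -sqrt_expR (le_trans (ray _ (expR_gt0 _))).
have ray2 s : cn (F (cexp (s +i* (- (pi - eps)))%C)) * expR (s / 2) <= K'.
  have -> : cexp (s +i* (- (pi - eps)))%C = conjc (cexp (s +i* (pi - eps))%C).
    by rewrite /cexp/= cosN sinN mulrN.
  by rewrite conjF; exact: ray1.
have ray3 s : cn (F (cexp (s +i* (pi + eps))%C)) * expR (s / 2) <= K'.
  have -> : cexp (s +i* (pi + eps))%C = cexp (s +i* (- (pi - eps)))%C.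
    have e : pi + eps = - (pi - eps) + pi *+ 2 by rewrite mulr2n; ring.
    by rewrite /cexp/= e cosD2pi sinD2pi.
  exact: ray2.
have pi0 := @pi_gt0 R.
have sec1 s t : `|t| <= pi - eps -> cn (F (cexp (s +i* t)%C)) * expR (s / 2) <= K'.
  move=> tw; apply: (@phragmen_lindelof_strip _ F 0 (pi - eps) K' A') => //; try lra.
    move=> u v; rewrite subr0 => vE.
    by have [v0|v0] := leP 0 v; [have -> : v = pi - eps by rewrite -vE ger0_norm
      | have -> : v = - (pi - eps) by rewrite -vE ltr0_norm// opprK]; rewrite ?ray1 ?ray2.
  by rewrite subr0.
have sec2 s t : `|t - pi| <= eps -> cn (F (cexp (s +i* t)%C)) * expR (s / 2) <= K'.
  move=> tw; apply: (@phragmen_lindelof_strip _ F pi eps K' A') => //; try lra.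
  move=> u v vE; have [v0|v0] := leP 0 (v - pi).
    by have -> : v = pi + eps by rewrite -vE ger0_norm//; ring.
  by have -> : v = pi - eps by rewrite -vE ltr0_norm//; ring.
have all z : z != 0 -> cn (F z) * Num.sqrt (cn z) <= K'.
  move=> z0; have [t /andP[t1 t2] zE] := polarP z0.
  have r0 : 0 < cn z by rewrite lt0r cn_ge0 andbT; apply: contraNneq z0 => /cn_eq0 ->.
  pose s := ln (cn z); have sE : expR s = cn z by rewrite /s lnK// posrE.
  rewrite -sE sqrt_expR.
  have [h|h] := leP `|t| (pi - eps).
    by have := sec1 s t h; rewrite cexp_polar sE -zE.
  have [t0|t0] := leP 0 t.
    have := sec2 s t; rewrite cexp_polar sE -zE; apply.
    by move: h; rewrite ger0_norm// => h; rewrite ler_norml; apply/andP; split; lra.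
  have := sec2 s (t + pi *+ 2); rewrite cexp_polar sE /polar cosD2pi sinD2pi -/(polar _ t) -zE.
  apply; move: h; rewrite ltr0_norm// => h; rewrite ler_norml mulr2n; apply/andP; split; lra.
apply: cn_eq0; apply/eqP; rewrite eq_le cn_ge0 andbT; apply/ler_addgt0Pr => e e0.
(* On the circle of radius [r] the bound [K' / sqrt r] is exactly [e / 2]; the two remaining
   quarters of [e] pay for exchanging [F] and [p] on the circle and at 0. *)
rewrite add0r; pose r := (K' / (e / 2)) ^+ 2.
have e20 : 0 < e / 2 / 2 by rewrite !divr_gt0.
have q0 : 0 < K' / (e / 2) by rewrite !divr_gt0.
have r0 : 0 < r by rewrite exprn_gt0.
have sr : Num.sqrt r = K' / (e / 2) by rewrite sqrtr_sqr gtr0_norm.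
have [p hp] := hF r _ e20.
have pb t : cn t = r -> cn p.[t] <= e / 2 + e / 2 / 2.
  move=> tr; rewrite -[p.[t]](subrK (F t)) addrC; apply: le_trans (cnD _ _) _; apply: lerD.
    have t0 : t != 0 by apply: contraTneq r0 => t0; rewrite -tr t0 cn0 ltxx.
    have := all t t0; rewrite tr sr -ler_pdivlMr// => h; apply: le_trans h _.
    by rewrite invf_div mulrC divfK// lt0r_neq0.
  by rewrite cnB; apply: hp; rewrite tr.
have [h _] := poly_mean (ltW r0) pb.
rewrite -[F 0](subrK p.[0]); apply: le_trans (cnD _ _) _.
have : cn (F 0 - p.[0]) <= e / 2 / 2 by apply: hp; rewrite cn0 ltW.
lra.
Qed.

End RayUniqueness.

(** * Fundamental solutions *)

Local Notation integrable_on b f := ((@lebesgue_measure _).-integrable `[0, b] (EFin \o f)).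

Section IntegrableOn.
Context {R : realType}.
Implicit Types (a b : R) (f g h q : R -> R).
Notation mu := (@lebesgue_measure R).

Lemma eq_integrable_on b f g : (forall x, 0 <= x <= b -> f x = g x) ->
  integrable_on b f -> integrable_on b g.
Proof.
move=> fg; apply: eq_integrable => //= x; rewrite inE/= in_itv/= => xb.
by rewrite fg.
Qed.

Lemma integrable_onD b f g : integrable_on b f -> integrable_on b g ->
  integrable_on b (fun x => f x + g x).
Proof. by move=> hf hg; exact: (integrableD _ hf hg). Qed.

Lemma integrable_onZ b f (c : R) : integrable_on b f -> integrable_on b (fun x => c * f x).
Proof. by move=> hf; exact: (integrableZl _ c hf). Qed.

Lemma integrable_onN b f : integrable_on b f -> integrable_on b (fun x => - f x).
Proof. by move=> /(integrable_onZ (-1)); apply: eq_integrable_on => x _; rewrite mulN1r. Qed.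

Lemma integrable_onB b f g : integrable_on b f -> integrable_on b g ->
  integrable_on b (fun x => f x - g x).
Proof. by move=> hf hg; apply: integrable_onD => //; exact: integrable_onN. Qed.

Lemma integrable_on_norm b f : integrable_on b f -> integrable_on b (fun x => `|f x|).
Proof. by move=> hf; exact: (integrable_abse hf). Qed.

Lemma integrable_onS b b' f : b' <= b -> integrable_on b f -> integrable_on b' f.
Proof. exact: integrable_itvS. Qed.

Lemma integrable_onMac b q f : 0 <= b -> integrable_on b q -> abs_cont 0 b f ->
  integrable_on b (fun x => q x * f x).
Proof.
move=> b0 iq fac; pose h x := f (clamp 0 b x).
have ch : continuous h by exact: abs_cont_clamp_continuous.
have mh : measurable_fun `[0, b] h.
  by apply: measurable_funTS; exact: continuous_measurable_fun.
have bh : [bounded h x | x in `[0, b]].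
  have [M M0 fM] := abs_cont_bounded b0 fac.
  exists M; split; first exact: num_real.
  move=> N MN x _; apply: le_trans (ltW MN).
  by apply: fM; exact: clamp_itv.
have := integrableMl _ iq mh bh; move=> /(_ (measurable_itv _)).
apply: eq_integrable => // x; rewrite inE/= in_itv/= => xb.
by rewrite /h clamp_id.
Qed.

Lemma integrable_on_cst b (c : R) : integrable_on b (fun=> c).
Proof.
apply: continuous_compact_integrable; first exact: segment_compact.
by apply: continuous_subspaceT => x; exact: cst_continuous.
Qed.

Lemma integrable_on_ac b f : 0 <= b -> abs_cont 0 b f -> integrable_on b f.
Proof.
move=> b0 fac; have := integrable_onMac b0 (integrable_on_cst b 1) fac.
by apply: eq_integrable_on => x _; rewrite mul1r.
Qed.

Lemma primitiveD b f g x : integrable_on b f -> integrable_on b g -> x <= b ->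
  primitive (fun t => f t + g t) x = primitive f x + primitive g x.
Proof. by move=> hf hg xb; apply: RintegralD => //; exact: integrable_onS xb _. Qed.

Lemma primitiveZ b f (c : R) x : integrable_on b f -> x <= b ->
  primitive (fun t => c * f t) x = c * primitive f x.
Proof. by move=> hf xb; apply: RintegralZl => //; exact: integrable_onS xb _. Qed.

Lemma eq_primitive b f g x : (forall t, 0 <= t <= b -> f t = g t) -> x <= b ->
  primitive f x = primitive g x.
Proof.
move=> fg xb; apply: eq_Rintegral => t; rewrite inE/= in_itv/= => /andP[t0 tx].
by rewrite fg// t0 (le_trans tx).
Qed.

(** [G - primitive f] and [G + primitive f] are both nondecreasing. A majorant given through its
    derivative need not be integrated. *)
Lemma primitive_le b f G g : integrable_on b f -> abs_cont 0 b G ->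
  {ae mu, forall x, x \in `]0, b[ -> is_derive x 1 G (g x)} ->
  (forall x, 0 < x < b -> `|f x| <= g x) ->
  forall u v, 0 <= u -> u <= v -> v <= b ->
    `|primitive f v - primitive f u| <= G v - G u.
Proof.
move=> hf Gac dG fg u v u0 uv vb.
have dd := ae_lebesgueI dG (is_derive_primitive hf).
have pac := abs_cont_primitive hf.
have h1 : G u - primitive f u <= G v - primitive f v.
  apply: (abs_cont_le (abs_contB Gac pac) _ u0 uv vb).
  apply: ae_lebesgueS dd => x [d1 d2] xb; exists (g x - f x).
    by apply: is_deriveB; [exact: d1|exact: d2].
  move: xb; rewrite in_itv/= => /fg; rewrite ler_norml; lra.
have h2 : G u + primitive f u <= G v + primitive f v.
  apply: (abs_cont_le (abs_contD Gac pac) _ u0 uv vb).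
  apply: ae_lebesgueS dd => x [d1 d2] xb; exists (g x + f x).
    by apply: is_deriveD; [exact: d1|exact: d2].
  move: xb; rewrite in_itv/= => /fg; rewrite ler_norml; lra.
rewrite ler_norml; lra.
Qed.

Lemma abs_cont_continuous a b f x : abs_cont a b f -> a < x < b -> {for x, continuous f}.
Proof.
move=> fac /andP[ax xb].
have ab : a <= b by rewrite ltW// (lt_trans ax).
have cf := abs_cont_clamp_continuous ab fac.
apply/cvgrPdist_lt => e e0.
have /cvgrPdist_lt/(_ _ e0) := cf x.
rewrite clamp_id; last by rewrite !ltW.
move=> h; near=> y.
have yE : clamp a b y = y.
  apply: clamp_id; apply/andP; split; apply: ltW; near: y.
    exact: lt_nbhsr.
  exact: lt_nbhsl.
by rewrite -yE; near: y.
Unshelve. all: by end_near. Qed.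

(** The partial sums widened by the possible tail [2 * B / 2 ^+ n] form nested intervals; the
    supremum of the lower ends lies in all of them. *)
Lemma geometric_limit (a : nat -> R) (B : R) :
  (forall k, `|a k| <= B / 2 ^+ k) ->
  exists s, forall n, `|s - \sum_(k < n) a k| <= 2 * B / 2 ^+ n.
Proof.
move=> aB; pose S n := \sum_(k < n) a k.
pose u n := S n - 2 * B / 2 ^+ n; pose v n := S n + 2 * B / 2 ^+ n.
have p2 n : 2 * B / 2 ^+ n = B / 2 ^+ n + 2 * B / 2 ^+ n.+1.
  rewrite exprS; field.
  by rewrite expf_neq0//= pnatr_eq0.
have uS n : u n <= u n.+1.
  rewrite /u /S big_ord_recr/= (p2 n); have := aB n; rewrite ler_norml => /andP[h _].
  lra.
have vS n : v n.+1 <= v n.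
  rewrite /v /S big_ord_recr/= (p2 n); have := aB n; rewrite ler_norml => /andP[_ h].
  lra.
have B0 : 0 <= B by have := aB 0%N; rewrite expr0 divr1; apply: le_trans.
have uv n : u n <= v n.
  have : 0 <= 2 * B / 2 ^+ n by rewrite divr_ge0 ?mulr_ge0 ?exprn_ge0.
  by rewrite /u /v; lra.
have um : {homo u : n m / (n <= m)%N >-> n <= m} by apply: homo_leq => //; exact: le_trans.
have vm n m : (n <= m)%N -> v m <= v n.
  by apply: (@homo_leq _ v (fun x y => y <= x)) => // y x z /[swap]; exact: le_trans.
have uvnm n m : u n <= v m.
  have [nm|/ltnW mn] := leqP n m; first exact: le_trans (um _ _ nm) (uv m).
  exact: le_trans (uv n) (vm _ _ mn).
exists (sup (range u)) => n.
have sU : has_sup (range u).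
  by split; [exists (u 0%N), 0%N|exists (v 0%N) => _ [m _ <-]].
have h1 : u n <= sup (range u) by apply: ub_le_sup; [exact: sU.2|exists n].
have h2 : sup (range u) <= v n.
  by apply: ge_sup; [exists (u 0%N), 0%N|move=> _ [m _ <-]].
by move: h1 h2; rewrite /u /v -/(S n) ler_norml; lra.
Qed.

End IntegrableOn.

(** * Complex integrals and polynomial dependence on z *)

Section ComplexPrimitive.
Context {R : realType}.
Local Notation C := R[i].
Local Notation cn := ComplexField.Normc.normc.
Implicit Types (b : R) (z w : C).

Definition cintegrable_on b (f : R -> C) : Prop :=
  integrable_on b (fun t => complex.Re (f t)) /\ integrable_on b (fun t => complex.Im (f t)).

Definition cprimitive (f : R -> C) (x : R) : C :=
  Complex (primitive (fun t => complex.Re (f t)) x) (primitive (fun t => complex.Im (f t)) x).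

Lemma cReD z w : complex.Re (z + w) = complex.Re z + complex.Re w.
Proof. by case: z w => [? ?] [? ?]. Qed.

Lemma cImD z w : complex.Im (z + w) = complex.Im z + complex.Im w.
Proof. by case: z w => [? ?] [? ?]. Qed.

Lemma cReM z w : complex.Re (z * w) = complex.Re z * complex.Re w - complex.Im z * complex.Im w.
Proof. by case: z w => [? ?] [? ?]. Qed.

Lemma cImM z w : complex.Im (z * w) = complex.Re z * complex.Im w + complex.Im z * complex.Re w.
Proof. by case: z w => [? ?] [? ?] /=; ring. Qed.

Lemma cReMr (c : R) w : complex.Re (c%:C%C * w) = c * complex.Re w.
Proof. by rewrite cReM /= mul0r subr0. Qed.

Lemma cImMr (c : R) w : complex.Im (c%:C%C * w) = c * complex.Im w.
Proof. by rewrite cImM /= mul0r addr0. Qed.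

Lemma complexP z w : complex.Re z = complex.Re w -> complex.Im z = complex.Im w -> z = w.
Proof. by case: z w => [? ?] [? ?] /= -> ->. Qed.

(* [zpoly b P f]: on [0, b], f z x is a polynomial in z whose coefficients are
   real functions of x in the class P. *)
Inductive zpoly b (P : (R -> R) -> Prop) : (C -> R -> C) -> Prop :=
| zpoly0 : zpoly b P (fun _ _ => 0)
| zpolyS f c n : zpoly b P f -> P c ->
    zpoly b P (fun z x => f z x + (c x)%:C%C * z ^+ n)
| zpoly_eq f g : (forall z x, 0 <= x <= b -> f z x = g z x) ->
    zpoly b P f -> zpoly b P g.

Lemma zpolyD b P f g : zpoly b P f -> zpoly b P g ->
  zpoly b P (fun z x => f z x + g z x).
Proof.
move=> hf; elim=> [|h c n _ IH Pc|h k hk _ IH].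
- by apply: zpoly_eq hf => z x _; rewrite addr0.
- by apply: zpoly_eq (zpolyS n IH Pc) => z x _; rewrite addrA.
- by apply: zpoly_eq IH => z x xb; rewrite hk.
Qed.

Lemma zpolyMz b P f : zpoly b P f -> zpoly b P (fun z x => z * f z x).
Proof.
elim=> [|h c n _ IH Pc|h k hk _ IH].
- by apply: zpoly_eq (zpoly0 b P) => z x _; rewrite mulr0.
- by apply: zpoly_eq (zpolyS n.+1 IH Pc) => z x _; rewrite exprS; ring.
- by apply: zpoly_eq IH => z x xb; rewrite hk.
Qed.

Lemma zpolyMr b (P Q : (R -> R) -> Prop) (q : R -> R) f :
  (forall c, P c -> Q (fun x => q x * c x)) ->
  zpoly b P f -> zpoly b Q (fun z x => (q x)%:C%C * f z x).
Proof.
move=> PQ; elim=> [|h c n _ IH Pc|h k hk _ IH].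
- by apply: zpoly_eq (zpoly0 b Q) => z x _; rewrite mulr0.
- by apply: zpoly_eq (zpolyS n IH (PQ _ Pc)) => z x _; rewrite rmorphM; ring.
- by apply: zpoly_eq IH => z x xb; rewrite hk.
Qed.

Lemma zpolyW b (P Q : (R -> R) -> Prop) f : (forall c, P c -> Q c) ->
  zpoly b P f -> zpoly b Q f.
Proof.
move=> PQ; elim=> [|h c n _ IH Pc|h k hk _ IH]; first exact: zpoly0.
- by apply: zpolyS => //; exact: PQ.
- exact: zpoly_eq IH.
Qed.

Lemma zpoly_cst b (P : (R -> R) -> Prop) (c : R) : P (fun=> c) ->
  zpoly b P (fun _ _ => c%:C%C).
Proof.
by move=> Pc; apply: zpoly_eq (zpolyS 0 (zpoly0 b P) Pc) => z x _; rewrite expr0 mulr1 add0r.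
Qed.

Lemma zpoly_cprimitive b f : 0 <= b -> zpoly b (fun c => integrable_on b c) f ->
  zpoly b (abs_cont 0 b) (fun z => cprimitive (f z)) /\ (forall z, cintegrable_on b (f z)).
Proof.
move=> b0; elim=> [|h c n _ [IH IHi] Pc|h k hk _ [IH IHi]].
- split; last by move=> z; split; exact: integrable_on_cst.
  apply: zpoly_eq (zpoly0 b _) => z x /andP[x0 xb].
  by rewrite /cprimitive /primitive /= Rintegral_cst//= !mul0r.
- split; last first.
    move=> z; have [i1 i2] := IHi z; split.
      apply: eq_integrable_on (integrable_onD i1 (integrable_onZ (complex.Re (z ^+ n)) Pc)).
      by move=> x _; rewrite cReD cReMr mulrC.
    apply: eq_integrable_on (integrable_onD i2 (integrable_onZ (complex.Im (z ^+ n)) Pc)).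
    by move=> x _; rewrite cImD cImMr mulrC.
  apply: zpoly_eq (zpolyS n IH (abs_cont_primitive Pc)) => z x /andP[x0 xb].
  have [i1 i2] := IHi z; rewrite /cprimitive; apply: complexP.
    rewrite cReD cReMr /= mulrC -(primitiveZ _ Pc xb) -(primitiveD i1 (integrable_onZ _ Pc) xb).
    by apply: (@eq_primitive _ b) => // t _; rewrite cReD cReMr mulrC.
  rewrite cImD cImMr /= mulrC -(primitiveZ _ Pc xb) -(primitiveD i2 (integrable_onZ _ Pc) xb).
  by apply: (@eq_primitive _ b) => // t _; rewrite cImD cImMr mulrC.
- split.
    apply: zpoly_eq IH => z x /andP[x0 xb]; congr Complex; apply: (@eq_primitive _ b) => // t tb;
    by rewrite hk.
  move=> z; have [i1 i2] := IHi z.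
  by split; [apply: eq_integrable_on i1|apply: eq_integrable_on i2] => x xb; rewrite hk.
Qed.

Lemma zpoly_polyapprox b P f x : zpoly b P f -> 0 <= x <= b -> polyapprox (f ^~ x).
Proof.
move=> + xb; elim=> [|h c n _ IH Pc|h k hk _ IH]; first exact: polyapprox_cst.
- apply: polyapproxD => //; apply: polyapproxM; first exact: polyapprox_cst.
  have := polyapprox_horner ('X^n : {poly C}).
  by under eq_fun do rewrite hornerXn.
- have -> : k^~ x = h^~ x by apply/funext => z; rewrite hk.
  exact: IH.
Qed.

(** The coefficients are real; applied to the Picard terms, this is the source of the conjugation
    symmetry of the solutions in [z]. *)
Lemma zpoly_conj b P f x z : zpoly b P f -> 0 <= x <= b -> f (conjc z) x = conjc (f z x).
Proof.
move=> + xb; elim=> [|h c n _ IH Pc|h k hk _ IH]; first by rewrite rmorph0.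
- rewrite IH rmorphD rmorphM rmorphXn; congr (_ + _ * _).
  by rewrite -[LHS]conjc_real.
- by rewrite -!hk.
Qed.

Lemma zpoly_cabs_cont b f z : 0 <= b -> zpoly b (abs_cont 0 b) f -> cabs_cont 0 b (f z).
Proof.
move=> b0; elim=> [|h c n _ IH Pc|h k hk _ IH]; first by split; exact: abs_cont_cst.
- split.
    apply: eq_abs_cont (abs_contD IH.1 (abs_contZ (complex.Re (z ^+ n)) Pc)) => x _.
    by rewrite cReD cReMr mulrC.
  apply: eq_abs_cont (abs_contD IH.2 (abs_contZ (complex.Im (z ^+ n)) Pc)) => x _.
  by rewrite cImD cImMr mulrC.
- by split; [apply: eq_abs_cont IH.1|apply: eq_abs_cont IH.2] => x xb; rewrite hk.
Qed.

(** Real and imaginary parts are estimated separately, hence the factor 2. *)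
Lemma cprimitive_le b f (G g : R -> R) : cintegrable_on b f -> abs_cont 0 b G ->
  {ae (@lebesgue_measure R), forall x, x \in `]0, b[ -> is_derive x 1 G (g x)} ->
  (forall x, 0 < x < b -> cn (f x) <= g x) ->
  forall u v, 0 <= u -> u <= v -> v <= b ->
    cn (cprimitive f v - cprimitive f u) <= 2 * (G v - G u).
Proof.
move=> [i1 i2] Gac dG fg u v u0 uv vb; apply: le_trans (cn_le _) _.
rewrite mulr_natl mulr2n; apply: lerD.
  apply: (primitive_le i1 Gac dG) => // x xb; exact: le_trans (cn_Re _) (fg x xb).
apply: (primitive_le i2 Gac dG) => // x xb; exact: le_trans (cn_Im _) (fg x xb).
Qed.

Lemma cprimitive0 f : cprimitive f 0 = 0.
Proof. by rewrite /cprimitive !primitive0. Qed.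

Lemma cgeometric_limit (a : nat -> C) (B : R) : (forall k, cn (a k) <= B / 2 ^+ k) ->
  exists s, forall n, cn (s - \sum_(k < n) a k) <= 4 * B / 2 ^+ n.
Proof.
move=> aB.
have [s1 h1] := @geometric_limit R (fun k => complex.Re (a k)) B (fun k => le_trans (cn_Re _) (aB k)).
have [s2 h2] := @geometric_limit R (fun k => complex.Im (a k)) B (fun k => le_trans (cn_Im _) (aB k)).
have hRe n : complex.Re (\sum_(k < n) a k) = \sum_(k < n) complex.Re (a k).
  by elim: n => [|n IH]; rewrite ?big_ord0// !big_ord_recr/= cReD IH.
have hIm n : complex.Im (\sum_(k < n) a k) = \sum_(k < n) complex.Im (a k).
  by elim: n => [|n IH]; rewrite ?big_ord0// !big_ord_recr/= cImD IH.
exists (Complex s1 s2) => n; apply: le_trans (cn_le _) _.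
have -> : 4 * B / 2 ^+ n = 2 * B / 2 ^+ n + 2 * B / 2 ^+ n.
  by field; rewrite expf_neq0//= pnatr_eq0.
apply: lerD; rewrite ?cReD ?cImD.
  have -> : complex.Re (- \sum_(k < n) a k) = - complex.Re (\sum_(k < n) a k) by case: (\sum_(_ < _) _).
  by rewrite hRe; exact: h1.
have -> : complex.Im (- \sum_(k < n) a k) = - complex.Im (\sum_(k < n) a k) by case: (\sum_(_ < _) _).
by rewrite hIm; exact: h2.
Qed.

End ComplexPrimitive.

(** * Solutions by Picard iteration *)

Section Picard.
Context {R : realType}.
Local Notation C := R[i].
Local Notation cn := ComplexField.Normc.normc.
Notation mu := (@lebesgue_measure R).
Implicit Types (z w : C).

Lemma geometric_small (A e : R) : 0 < e -> exists n, A / 2 ^+ n <= e.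
Proof.
move=> e0; pose n := Num.truncn (`|A| / e); exists n.+1.
have nA : `|A| / e < n.+1%:R by exact: truncnS_gt.
rewrite ler_pdivrMr ?exprn_gt0//.
have nP : n.+1%:R <= 2 ^+ n.+1 :> R by rewrite -natrX ler_nat ltnW// ltn_expl.
move: nA; rewrite ltr_pdivrMr// => nA; apply: le_trans (ler_norm A) _.
by apply: le_trans (ltW nA) _; rewrite mulrC ler_wpM2l// ltW.
Qed.

Lemma le_geometric (x y A : R) : (forall n, x <= y + A / 2 ^+ n) -> x <= y.
Proof.
move=> h; apply/ler_addgt0Pr => e e0.
have [n nA] := geometric_small A e0.
by apply: le_trans (h n) _; rewrite lerD2l.
Qed.

Lemma cn_geometric_eq0 w (A : R) : (forall n, cn w <= A / 2 ^+ n) -> w = 0.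
Proof.
move=> h; apply: cn_eq0; apply/eqP; rewrite eq_le cn_ge0 andbT.
by apply: (@le_geometric _ _ A) => n; rewrite add0r.
Qed.

Lemma cprimitiveD b (f g : R -> C) x : cintegrable_on b f -> cintegrable_on b g -> x <= b ->
  cprimitive (fun t => f t + g t) x = cprimitive f x + cprimitive g x.
Proof.
move=> [f1 f2] [g1 g2] xb; apply: complexP; rewrite /cprimitive/=.
  by rewrite -(primitiveD f1 g1 xb); apply: (@eq_primitive _ b) => // t _; rewrite cReD.
by rewrite -(primitiveD f2 g2 xb); apply: (@eq_primitive _ b) => // t _; rewrite cImD.
Qed.

Lemma cintegrable_onD b (f g : R -> C) : cintegrable_on b f -> cintegrable_on b g ->
  cintegrable_on b (fun t => f t + g t).
Proof.
move=> [f1 f2] [g1 g2]; split.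
  by apply: eq_integrable_on (integrable_onD f1 g1) => x _; rewrite cReD.
by apply: eq_integrable_on (integrable_onD f2 g2) => x _; rewrite cImD.
Qed.

Lemma cintegrable_onN b (f : R -> C) : cintegrable_on b f -> cintegrable_on b (fun t => - f t).
Proof.
move=> [f1 f2]; split.
  by apply: eq_integrable_on (integrable_onN f1) => x _; case: (f x).
by apply: eq_integrable_on (integrable_onN f2) => x _; case: (f x).
Qed.

Lemma cprimitiveB b (f g : R -> C) x : cintegrable_on b f -> cintegrable_on b g -> x <= b ->
  cprimitive (fun t => f t - g t) x = cprimitive f x - cprimitive g x.
Proof.
move=> hf hg xb; apply/eqP; rewrite eq_sym subr_eq; apply/eqP.
rewrite -(@cprimitiveD b)//; last exact/cintegrable_onD/cintegrable_onN.
by rewrite /cprimitive; congr Complex; apply: (@eq_primitive _ b) => // t _; rewrite subrK.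
Qed.

Lemma cintegrable_on_ac b (f : R -> C) : 0 <= b -> cabs_cont 0 b f -> cintegrable_on b f.
Proof. by move=> b0 [f1 f2]; split; exact: integrable_on_ac. Qed.

Lemma cintegrable_on0 b : cintegrable_on b (fun=> 0 : C).
Proof. by split; exact: integrable_on_cst. Qed.

Lemma cprimitive_sum b (f : nat -> R -> C) x n : (forall k, cintegrable_on b (f k)) ->
  0 <= x <= b ->
  cintegrable_on b (fun t => \sum_(k < n) f k t) /\
  cprimitive (fun t => \sum_(k < n) f k t) x = \sum_(k < n) cprimitive (f k) x.
Proof.
move=> hf /andP[x0 xb]; elim: n => [|n [IH1 IH2]].
  under eq_fun do rewrite big_ord0.
  rewrite big_ord0; split; first exact: cintegrable_on0.
  by rewrite /cprimitive /primitive/= Rintegral_cst// mul0r.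
under eq_fun do rewrite big_ord_recr/=.
split; first exact: cintegrable_onD.
by rewrite big_ord_recr/= -IH2 (@cprimitiveD b).
Qed.

Section Fixed.
Variables (b : R) (q : R -> R) (al be : R).
Hypotheses (b0 : 0 < b) (iq : integrable_on b q).

Let b0' : 0 <= b. Proof. exact: ltW. Qed.

(** The k-th term, not the k-th partial sum, of the Picard series for [y' = y1], [y1' = (q - z) y]
    with [y 0 = al] and [y1 0 = be]. *)
Fixpoint picard k : (C -> R -> C) * (C -> R -> C) :=
  if k is k'.+1 then
    (fun z => cprimitive ((picard k').2 z),
     fun z => cprimitive (fun x => ((q x)%:C%C - z) * (picard k').1 z x))
  else (fun _ _ => al%:C%C, fun _ _ => be%:C%C).

(** Up to the factor [1 + |z|], the integral of the size of the coefficients of the first-order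
    system. Increments of all Picard terms are measured against it. *)
Definition coef_mass (x : R) := primitive (fun t => 1 + `|q t|) x.

Lemma integrable_on_coef_mass : integrable_on b (fun t => 1 + `|q t|).
Proof. by apply: integrable_onD; [exact: integrable_on_cst|exact: integrable_on_norm]. Qed.

Lemma coef_mass_ac : abs_cont 0 b coef_mass.
Proof. exact: abs_cont_primitive integrable_on_coef_mass. Qed.

Lemma is_derive_coef_mass : {ae mu, forall x, x \in `]0, b[ -> is_derive x 1 coef_mass (1 + `|q x|)}.
Proof. exact: is_derive_primitive integrable_on_coef_mass. Qed.

Lemma coef_mass_le u v : 0 <= u -> u <= v -> v <= b -> coef_mass u <= coef_mass v.
Proof.
move=> u0 uv vb; apply: (abs_cont_le coef_mass_ac _ u0 uv vb).
apply: ae_lebesgueS is_derive_coef_mass => x /[apply] h; exists (1 + `|q x|) => //.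
Qed.

Lemma coef_mass0 : coef_mass 0 = 0. Proof. exact: primitive0. Qed.

Lemma picard_zpoly k : zpoly b (abs_cont 0 b) (picard k).1 /\ zpoly b (abs_cont 0 b) (picard k).2 /\
  (forall z, cintegrable_on b (fun x => ((q x)%:C%C - z) * (picard k).1 z x)).
Proof.
have mulq T : zpoly b (abs_cont 0 b) T ->
    zpoly b (fun c => integrable_on b c) (fun z x => ((q x)%:C%C - z) * T z x).
  move=> hT.
  have h1 : zpoly b (fun c => integrable_on b c) (fun z x => (q x)%:C%C * T z x).
    by apply: zpolyMr hT => c; exact: integrable_onMac.
  have h2 : zpoly b (fun c => integrable_on b c) (fun z x => (-1)%:C%C * (z * T z x)).
    apply: (@zpolyMr _ _ (abs_cont 0 b) _ (fun=> -1)); last exact: zpolyMz.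
    by move=> c cac; apply: integrable_onZ; exact: integrable_on_ac.
  apply: zpoly_eq (zpolyD h1 h2) => z x _; rewrite rmorphN1; ring.
elim: k => [|k [IH1 [IH2 _]]].
  have h1 : zpoly b (abs_cont 0 b) (picard 0).1 by apply: zpoly_cst; exact: abs_cont_cst.
  split=> //; split; first by apply: zpoly_cst; exact: abs_cont_cst.
  exact: (zpoly_cprimitive b0' (mulq _ h1)).2.
have h1 : zpoly b (abs_cont 0 b) (picard k.+1).1.
  apply: (zpoly_cprimitive b0' _).1.
  by apply: zpolyW IH2 => c; exact: integrable_on_ac.
split=> //; split; first exact: (zpoly_cprimitive b0' (mulq _ IH1)).1.
exact: (zpoly_cprimitive b0' (mulq _ h1)).2.
Qed.

Lemma cintegrable_on_picard2 k z : cintegrable_on b ((picard k).2 z).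
Proof.
by apply: cintegrable_on_ac => //; apply: zpoly_cabs_cont => //; have [_ []] := picard_zpoly k.
Qed.

Let M := `|al| + `|be|.
(** Exponential weight in which each Picard step halves the bound: of the constant 4, one factor 2
    compensates [cprimitive_le] and the other gives the halving. *)
Let W rho x := expR (4 * (1 + rho) * coef_mass x).

Lemma picard_step_le (rho : R) z k (B : R -> R) x : cn z <= rho -> 0 <= x <= b ->
  cn ((picard k).1 z x) <= B x -> cn ((picard k).2 z x) <= B x ->
  cn ((picard k).2 z x) <= (1 + rho) * B x * (1 + `|q x|) /\
  cn (((q x)%:C%C - z) * (picard k).1 z x) <= (1 + rho) * B x * (1 + `|q x|).
Proof.
move=> zr xb h1 h2; have B0 : 0 <= B x := le_trans (cn_ge0 _) h1.
have r0 : 0 <= rho := le_trans (cn_ge0 _) zr.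
have q0 := normr_ge0 (q x).
have rB : 0 <= rho * B x by rewrite mulr_ge0.
split.
  apply: le_trans h2 _; have : 0 <= B x * `|q x| by rewrite mulr_ge0.
  have : 0 <= rho * B x * `|q x| by rewrite mulr_ge0.
  nra.
rewrite cnM; apply: (@le_trans _ _ ((`|q x| + rho) * B x)).
  apply: ler_pM; rewrite ?cn_ge0//.
  by apply: le_trans (cnD _ _) _; rewrite cnN cn_real lerD2l.
have : 0 <= rho * B x * `|q x| by rewrite mulr_ge0.
nra.
Qed.

Lemma is_derive_weight (rho c : R) : 0 <= rho -> {ae mu, forall x, x \in `]0, b[ ->
  is_derive x 1 (fun t => c / (4 * (1 + rho)) * W rho t) (c * W rho x * (1 + `|q x|))}.
Proof.
move=> r0; apply: ae_lebesgueS is_derive_coef_mass => x /[apply] dV.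
have d1 : is_derive x 1 (fun t => 4 * (1 + rho) * coef_mass t) (4 * (1 + rho) * (1 + `|q x|)).
  exact: is_deriveZ.
have d2 := is_derive1_comp (is_derive_expR _) d1.
apply: (is_derive_eq (is_deriveZ (c / (4 * (1 + rho))) d2)).
by rewrite /W /GRing.scale/=; field; rewrite addrC; lra.
Qed.

Lemma weight_ac (rho c : R) : abs_cont 0 b (fun t => c * W rho t).
Proof. by apply: abs_contZ; apply: abs_cont_expR => //; apply: abs_contZ; exact: coef_mass_ac. Qed.

Lemma picard_bound (rho : R) z k x : cn z <= rho -> 0 <= x <= b ->
  cn ((picard k).1 z x) <= M / 2 ^+ k * W rho x /\
  cn ((picard k).2 z x) <= M / 2 ^+ k * W rho x.
Proof.
move=> zr; have r0 : 0 <= rho := le_trans (cn_ge0 _) zr.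
have W1 t : 0 <= t <= b -> 1 <= W rho t.
  move=> /andP[t0 tb]; rewrite -[leLHS]expR0 ler_expR mulr_ge0//; first by rewrite mulr_ge0//; lra.
  by rewrite -coef_mass0 coef_mass_le.
elim: k x => [|k IH] x xb.
  rewrite expr0 divr1 !cn_real /M; have := W1 x xb.
  by have := normr_ge0 al; have := normr_ge0 be; split; nra.
have /andP[x0 x1] := xb.
pose B t := M / 2 ^+ k * W rho t.
have step t : 0 < t < b ->
    cn ((picard k).2 z t) <= (1 + rho) * (M / 2 ^+ k) * W rho t * (1 + `|q t|) /\
    cn (((q t)%:C%C - z) * (picard k).1 z t) <= (1 + rho) * (M / 2 ^+ k) * W rho t * (1 + `|q t|).
  move=> /andP[t0 tb]; have tb' : 0 <= t <= b by rewrite !ltW.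
  have [h1 h2] := IH t tb'.
  by have := @picard_step_le rho z k B t zr tb' h1 h2; rewrite /B !mulrA.
have dG := is_derive_weight ((1 + rho) * (M / 2 ^+ k)) r0.
have Gac := weight_ac rho ((1 + rho) * (M / 2 ^+ k) / (4 * (1 + rho))).
have fin : 2 * ((1 + rho) * (M / 2 ^+ k) / (4 * (1 + rho)) * W rho x -
    (1 + rho) * (M / 2 ^+ k) / (4 * (1 + rho)) * W rho 0) <= M / 2 ^+ k.+1 * W rho x.
  have -> : M / 2 ^+ k.+1 * W rho x = 2 * ((1 + rho) * (M / 2 ^+ k) / (4 * (1 + rho)) * W rho x).
    rewrite exprS; field; rewrite addrC expf_neq0 ?andbT; lra.
  rewrite ler_wpM2l// gerBl mulr_ge0 ?expR_ge0// divr_ge0//; last lra.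
  by rewrite mulr_ge0 ?divr_ge0 ?exprn_ge0 ?addr_ge0.
split.
  rewrite -[_ z x]subr0 -(cprimitive0 ((picard k).2 z)); apply: le_trans fin.
  apply: (cprimitive_le (cintegrable_on_picard2 k z) Gac dG) => //.
  by move=> t /step[].
rewrite -[_ z x]subr0 -(cprimitive0 (fun x => ((q x)%:C%C - z) * (picard k).1 z x)).
apply: le_trans fin.
have [_ [_ iqz]] := picard_zpoly k.
apply: (cprimitive_le (iqz z) Gac dG) => //.
by move=> t /step[].
Qed.


Let M_ge0 : 0 <= M. Proof. exact: addr_ge0. Qed.

Lemma coef_mass_ge0 x : 0 <= x <= b -> 0 <= coef_mass x.
Proof. by move=> /andP[x0 xb]; rewrite -coef_mass0 coef_mass_le. Qed.

Let E rho := W rho b.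

Lemma weight_le (rho x : R) : 0 <= rho -> 0 <= x <= b -> W rho x <= E rho.
Proof.
move=> r0 /andP[x0 xb]; rewrite ler_expR ler_wpM2l ?coef_mass_le// mulr_ge0//; lra.
Qed.

(** The constants are summable in [k], so the limit inherits absolute continuity from
    [coef_mass]. *)
Lemma picard_incr z k u v : 0 <= u -> u <= v -> v <= b ->
  let L := 4 * (1 + cn z) * M * E (cn z) in
  cn ((picard k).1 z v - (picard k).1 z u) <= L / 2 ^+ k * (coef_mass v - coef_mass u) /\
  cn ((picard k).2 z v - (picard k).2 z u) <= L / 2 ^+ k * (coef_mass v - coef_mass u).
Proof.
move=> u0 uv vb L; pose rho := cn z; have r0 : 0 <= rho := cn_ge0 z.
have E0 : 0 <= E rho := expR_ge0 _.
have V0 : 0 <= coef_mass v - coef_mass u by rewrite subr_ge0 coef_mass_le.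
have L0 : 0 <= L by rewrite /L !mulr_ge0 ?M_ge0 ?expR_ge0//; have := cn_ge0 z; lra.
case: k => [|k]; first by split; rewrite [(picard 0)]/= subrr cn0 expr0 divr1 mulr_ge0.
pose c := (1 + rho) * (M / 2 ^+ k * E rho).
have -> : L / 2 ^+ k.+1 * (coef_mass v - coef_mass u) = 2 * (c * coef_mass v - c * coef_mass u).
  by rewrite /L /c -/rho exprS; field; rewrite expf_neq0//= pnatr_eq0.
have dG : {ae mu, forall x, x \in `]0, b[ -> is_derive x 1 (fun t => c * coef_mass t) (c * (1 + `|q x|))}.
  by apply: ae_lebesgueS is_derive_coef_mass => x /[apply] dV; exact: is_deriveZ.
have Gac : abs_cont 0 b (fun t => c * coef_mass t) by apply: abs_contZ; exact: coef_mass_ac.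
have step t : 0 < t < b -> cn ((picard k).2 z t) <= c * (1 + `|q t|) /\
    cn (((q t)%:C%C - z) * (picard k).1 z t) <= c * (1 + `|q t|).
  move=> /andP[t0 tb]; have tb' : 0 <= t <= b by rewrite !ltW.
  have [h1 h2] := picard_bound k (lexx (cn z)) tb'.
  have wl : M / 2 ^+ k * W (cn z) t <= M / 2 ^+ k * E rho.
    by rewrite ler_wpM2l ?weight_le// divr_ge0 ?M_ge0 ?exprn_ge0.
  exact: (@picard_step_le rho z k (fun=> M / 2 ^+ k * E rho) t (lexx _) tb'
    (le_trans h1 wl) (le_trans h2 wl)).
split.
  apply: (cprimitive_le (cintegrable_on_picard2 k z) Gac dG) => //.
  by move=> t /step[].
have [_ [_ iqz]] := picard_zpoly k.
apply: (cprimitive_le (iqz z) Gac dG) => //.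
by move=> t /step[].
Qed.

Let B rho := M * E rho.

Let B_homo (r s : R) : 0 <= r -> r <= s -> B r <= B s.
Proof.
move=> r0 rs; rewrite ler_wpM2l ?M_ge0// ler_expR ler_wpM2r ?coef_mass_ge0//; last lra.
by rewrite lexx b0'.
Qed.

Lemma picard_sol : exists y y1 : C -> R -> C, forall z x n, 0 <= x <= b ->
  cn (y z x - \sum_(k < n) (picard k).1 z x) <= 4 * B (cn z) / 2 ^+ n /\
  cn (y1 z x - \sum_(k < n) (picard k).2 z x) <= 4 * B (cn z) / 2 ^+ n.
Proof.
have bnd z x k : 0 <= x <= b ->
    cn ((picard k).1 z x) <= B (cn z) / 2 ^+ k /\ cn ((picard k).2 z x) <= B (cn z) / 2 ^+ k.
  move=> xb; have [h1 h2] := picard_bound k (lexx (cn z)) xb.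
  have wl : M / 2 ^+ k * W (cn z) x <= B (cn z) / 2 ^+ k.
    rewrite /B [leRHS]mulrAC ler_wpM2l ?weight_le ?cn_ge0// divr_ge0 ?M_ge0 ?exprn_ge0//.
  by split; [exact: le_trans wl|exact: le_trans wl].
have ex (p : C * R) : exists s : C * C, 0 <= p.2 <= b -> forall n,
   cn (s.1 - \sum_(k < n) (picard k).1 p.1 p.2) <= 4 * B (cn p.1) / 2 ^+ n /\
   cn (s.2 - \sum_(k < n) (picard k).2 p.1 p.2) <= 4 * B (cn p.1) / 2 ^+ n.
  have [xb|nxb] := boolP (0 <= p.2 <= b); last by exists (0, 0).
  have [s1 h1] := cgeometric_limit (fun k => (bnd p.1 p.2 k xb).1).
  have [s2 h2] := cgeometric_limit (fun k => (bnd p.1 p.2 k xb).2).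
  by exists (s1, s2) => _ n; split; [exact: h1|exact: h2].
have [f hf] := choice ex.
exists (fun z x => (f (z, x)).1), (fun z x => (f (z, x)).2) => z x n xb.
exact: (hf (z, x) xb n).
Qed.

Section Limit.
Variables y y1 : C -> R -> C.
Hypothesis hy : forall z x n, 0 <= x <= b ->
  cn (y z x - \sum_(k < n) (picard k).1 z x) <= 4 * B (cn z) / 2 ^+ n /\
  cn (y1 z x - \sum_(k < n) (picard k).2 z x) <= 4 * B (cn z) / 2 ^+ n.

Let B_ge0 (r : R) : 0 <= B r. Proof. by rewrite mulr_ge0 ?M_ge0 ?expR_ge0. Qed.

Lemma picard_limit_incr z u v : 0 <= u -> u <= v -> v <= b ->
  let L := 2 * (4 * (1 + cn z) * M * E (cn z)) in
  cn (y z v - y z u) <= L * (coef_mass v - coef_mass u) /\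
  cn (y1 z v - y1 z u) <= L * (coef_mass v - coef_mass u).
Proof.
move=> u0 uv vb L; have V0 : 0 <= coef_mass v - coef_mass u by rewrite subr_ge0 coef_mass_le.
have L0 : 0 <= L by rewrite /L !mulr_ge0 ?M_ge0 ?expR_ge0//; have := cn_ge0 z; lra.
have ub : 0 <= u <= b by rewrite u0 (le_trans uv).
have vb' : 0 <= v <= b by rewrite vb (le_trans u0).
have gen (g : nat -> C) (a c : C) (A : R) : 0 <= A ->
    (forall k, cn (g k) <= A / 2 ^+ k) ->
    (forall n, cn (a - c - \sum_(k < n) g k) <= 8 * B (cn z) / 2 ^+ n) ->
    cn (a - c) <= 2 * A.
  move=> A0 hg hs; apply: (@le_geometric _ _ (8 * B (cn z))) => n.
  rewrite -[a - c](subrK (\sum_(k < n) g k)) addrC; apply: le_trans (cnD _ _) _.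
  apply: lerD => //; have : cn (\sum_(k < n) g k) <= 2 * A - 2 * A / 2 ^+ n.
    elim: n => [|n IH]; first by rewrite big_ord0 cn0 expr0 divr1 subrr.
    rewrite big_ord_recr/=; apply: le_trans (cnD _ _) _; apply: le_trans (lerD IH (hg n)) _.
    rewrite exprS; have -> : 2 * A / (2 * 2 ^+ n) = A / 2 ^+ n.
      by field; rewrite expf_neq0//= pnatr_eq0.
    have -> : 2 * A / 2 ^+ n = A / 2 ^+ n + A / 2 ^+ n by field; rewrite expf_neq0//= pnatr_eq0.
    lra.
  move=> h; apply: le_trans h _; rewrite gerBl.
  by rewrite divr_ge0 ?mulr_ge0 ?exprn_ge0.
have V1 A : A * (coef_mass v - coef_mass u) = 2 * (A / 2 * (coef_mass v - coef_mass u)) by field.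
have e8 n : 8 * B (cn z) / 2 ^+ n = 4 * B (cn z) / 2 ^+ n + 4 * B (cn z) / 2 ^+ n.
  by field; rewrite expf_neq0//= pnatr_eq0.
have L2 : L / 2 = 4 * (1 + cn z) * M * E (cn z) by rewrite /L; field.
rewrite (V1 L); split.
  apply: (gen (fun k => (picard k).1 z v - (picard k).1 z u)) => [|k|n].
  - by rewrite mulr_ge0// divr_ge0.
  - by rewrite mulrAC L2; have [] := picard_incr z k u0 uv vb.
  - rewrite sumrB e8.
    have [h1 _] := hy z n vb'; have [h2 _] := hy z n ub.
    have -> : y z v - y z u - (\sum_(k < n) (picard k).1 z v - \sum_(k < n) (picard k).1 z u)
      = (y z v - \sum_(k < n) (picard k).1 z v) - (y z u - \sum_(k < n) (picard k).1 z u) by ring.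
    by apply: le_trans (cnD _ _) _; rewrite cnN lerD.
apply: (gen (fun k => (picard k).2 z v - (picard k).2 z u)) => [|k|n].
- by rewrite mulr_ge0// divr_ge0.
- by rewrite mulrAC L2; have [] := picard_incr z k u0 uv vb.
- rewrite sumrB e8.
  have [_ h1] := hy z n vb'; have [_ h2] := hy z n ub.
  have -> : y1 z v - y1 z u - (\sum_(k < n) (picard k).2 z v - \sum_(k < n) (picard k).2 z u)
    = (y1 z v - \sum_(k < n) (picard k).2 z v) - (y1 z u - \sum_(k < n) (picard k).2 z u) by ring.
  by apply: le_trans (cnD _ _) _; rewrite cnN lerD.
Qed.

Lemma cabs_cont_coef_mass (f : R -> C) (L : R) : (forall u v, 0 <= u -> u <= v -> v <= b ->
    cn (f v - f u) <= L * (coef_mass v - coef_mass u)) -> cabs_cont 0 b f.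
Proof.
move=> fL; split; apply: (@abs_cont_dom _ 0 b coef_mass (fun=> 0) _ L); try exact: coef_mass_ac;
  try exact: abs_cont_cst; move=> u v u0 uv vb; rewrite subrr normr0 addr0.
  rewrite (_ : `|coef_mass v - coef_mass u| = coef_mass v - coef_mass u); last first.
    by rewrite ger0_norm// subr_ge0 coef_mass_le.
  apply: le_trans (fL u v u0 uv vb); apply: le_trans (cn_Re _).
  by rewrite cReD; case: (f u).
rewrite (_ : `|coef_mass v - coef_mass u| = coef_mass v - coef_mass u); last first.
  by rewrite ger0_norm// subr_ge0 coef_mass_le.
apply: le_trans (fL u v u0 uv vb); apply: le_trans (cn_Im _).
by rewrite cImD; case: (f u).
Qed.

Lemma picard_limit_ac z : cabs_cont 0 b (y z) /\ cabs_cont 0 b (y1 z).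
Proof.
split; apply: cabs_cont_coef_mass => u v u0 uv vb.
  exact: (picard_limit_incr z u0 uv vb).1.
exact: (picard_limit_incr z u0 uv vb).2.
Qed.


(** Partial sums are polynomials in [z], and the error bound [4 * B (cn z) / 2 ^+ n] increases with
    [cn z], so convergence is uniform on discs. *)
Lemma picard_limit_polyapprox x : 0 <= x <= b -> polyapprox (y ^~ x).
Proof.
move=> xb; apply: polyapprox_lim => r e e0.
have [n nP] := geometric_small (4 * B (Num.max 0 r)) e0.
exists (fun z => \sum_(k < n) (picard k).1 z x).
  elim: n {nP} => [|n IH].
    by under eq_fun do rewrite big_ord0; exact: polyapprox_cst.
  under eq_fun do rewrite big_ord_recr/=.
  apply: polyapproxD => //; apply: (@zpoly_polyapprox _ b (abs_cont 0 b) (picard n).1) => //.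
  by have [] := picard_zpoly n.
move=> z zr; have [h _] := hy z n xb; apply: le_trans h _; apply: le_trans nP.
rewrite ler_wpM2r ?invr_ge0 ?exprn_ge0// ler_wpM2l// B_homo ?cn_ge0//.
by rewrite le_max zr orbT.
Qed.

Lemma picard_limit_conj z x : 0 <= x <= b -> y (conjc z) x = conjc (y z x).
Proof.
move=> xb; apply/eqP; rewrite -subr_eq0; apply/eqP.
apply: (@cn_geometric_eq0 _ (8 * B (cn z))) => n.
have [h1 _] := hy z n xb; have [h2 _] := hy (conjc z) n xb.
rewrite cn_conj in h2.
have E1 : \sum_(k < n) (picard k).1 (conjc z) x = conjc (\sum_(k < n) (picard k).1 z x).
  rewrite rmorph_sum; apply: eq_bigr => k _.
  by have [hz _] := picard_zpoly k; exact: (zpoly_conj z hz xb).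
have -> : y (conjc z) x - conjc (y z x) =
    (y (conjc z) x - \sum_(k < n) (picard k).1 (conjc z) x) -
    conjc (y z x - \sum_(k < n) (picard k).1 z x) by rewrite E1 rmorphB; ring.
have -> : 8 * B (cn z) / 2 ^+ n = 4 * B (cn z) / 2 ^+ n + 4 * B (cn z) / 2 ^+ n.
  by field; rewrite expf_neq0//= pnatr_eq0.
by apply: le_trans (cnD _ _) _; rewrite cnN cn_conj lerD.
Qed.

Lemma picard_integrable z : cintegrable_on b (y1 z) /\
  cintegrable_on b (fun x => ((q x)%:C%C - z) * y z x).
Proof.
have [[yR yI] y1ac] := picard_limit_ac z.
split; first exact: cintegrable_on_ac.
have qR := integrable_onMac b0' iq yR; have qI := integrable_onMac b0' iq yI.
have yRi := integrable_on_ac b0' yR; have yIi := integrable_on_ac b0' yI.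
split.
  apply: eq_integrable_on (integrable_onB (integrable_onB qR
    (integrable_onZ (complex.Re z) yRi)) (integrable_onZ (- complex.Im z) yIi)) => x _.
  by rewrite cReM; case: (z) (y z x) => [? ?] [? ?] /=; ring.
apply: eq_integrable_on (integrable_onB (integrable_onB qI
  (integrable_onZ (complex.Re z) yIi)) (integrable_onZ (complex.Im z) yRi)) => x _.
by rewrite cImM; case: (z) (y z x) => [? ?] [? ?] /=; ring.
Qed.

Lemma picard_limit_eq z x : 0 <= x <= b ->
  y z x = al%:C%C + cprimitive (y1 z) x /\
  y1 z x = be%:C%C + cprimitive (fun t => ((q t)%:C%C - z) * y z t) x.
Proof.
move=> xb; have /andP[x0 x1] := xb; have [iy1 iqy] := picard_integrable z.
(* Both integral equations are instances: [T] is the series of [w], its terms after the first are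
   the primitives of the [g k], and [f] is the sum of the [g k]. Comparing [n + 1] terms of [T] with
   [n] terms of [g] leaves two geometric errors. *)
have aux (w : C) (f : R -> C) (g : nat -> R -> C) (G : R -> R) gg (w0 : C) (T : nat -> C) :
    cintegrable_on b f -> (forall k, cintegrable_on b (g k)) ->
    abs_cont 0 b G ->
    {ae mu, forall x, x \in `]0, b[ -> is_derive x 1 G (gg x)} ->
    (forall t n, 0 < t < b -> cn (f t - \sum_(k < n) g k t) <= gg t / 2 ^+ n) ->
    T 0%N = w0 -> (forall k, T k.+1 = cprimitive (g k) x) ->
    (forall n, cn (w - \sum_(k < n) T k) <= 4 * B (cn z) / 2 ^+ n) ->
    w = w0 + cprimitive f x.
  move=> hf hg Gac dG hG T0 TS hw; apply/eqP; rewrite -subr_eq0; apply/eqP.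
  apply: (@cn_geometric_eq0 _ (4 * B (cn z) + 2 * (G x - G 0))) => n.
  have [gi gE] := cprimitive_sum n hg xb.
  have -> : w - (w0 + cprimitive f x) = (w - \sum_(k < n.+1) T k) -
      cprimitive (fun t => f t - \sum_(k < n) g k t) x.
    rewrite (@cprimitiveB b)// gE big_ord_recl/= T0.
    by under [in RHS]eq_bigr do rewrite TS; ring.
  rewrite mulrDl; apply: le_trans (cnD _ _) _; rewrite cnN; apply: lerD.
    apply: le_trans (hw n.+1) _; apply: ler_wpM2l; first by rewrite mulr_ge0 ?B_ge0.
    have P0 : 0 < (2 : R) ^+ n by rewrite exprn_gt0.
    rewrite lef_pV2 ?posrE ?exprn_gt0// exprS; lra.
  pose G' t := (2 ^+ n)^-1 * G t.
  have -> : 2 * (G x - G 0) / 2 ^+ n = 2 * (G' x - G' 0) by rewrite /G'; ring.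
  have i1 : cintegrable_on b (fun t => f t - \sum_(k < n) g k t).
    by apply: cintegrable_onD => //; exact: cintegrable_onN.
  have i2 : abs_cont 0 b G' by exact: abs_contZ.
  have i3 : {ae mu, forall x, x \in `]0, b[ -> is_derive x 1 G' ((2 ^+ n)^-1 * gg x)}.
    by apply: ae_lebesgueS dG => t /[apply] h; exact: is_deriveZ.
  have i4 t : 0 < t < b -> cn (f t - \sum_(k < n) g k t) <= (2 ^+ n)^-1 * gg t.
    by move=> tb; rewrite mulrC; exact: hG.
  by have := cprimitive_le i1 i2 i3 i4 (lexx 0) x0 x1; rewrite cprimitive0 subr0.
have ig1 k : cintegrable_on b ((picard k).2 z) by exact: cintegrable_on_picard2.
have ig2 k : cintegrable_on b (fun x => ((q x)%:C%C - z) * (picard k).1 z x).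
  by have [_ []] := picard_zpoly k.
split.
  apply: (aux _ _ (fun k => (picard k).2 z) (fun t => 4 * B (cn z) * t)
    (fun=> 4 * B (cn z)) _ (fun k => (picard k).1 z x)) => //.
  - by apply: abs_contZ; exact: abs_cont_id.
  - apply: aeW => t _; apply: (is_derive_eq (is_deriveZ (4 * B (cn z)) (is_derive_id t 1))).
    by rewrite /GRing.scale/= mulr1.
  - by move=> t n tb; have [] := hy z n (_ : 0 <= t <= b) => //; rewrite !ltW//; case/andP: tb.
  - by move=> n; have [] := hy z n xb.
apply: (aux _ _ (fun k t => ((q t)%:C%C - z) * (picard k).1 z t)
  (fun t => 4 * B (cn z) * (1 + cn z) * coef_mass t)
  (fun t => 4 * B (cn z) * (1 + cn z) * (1 + `|q t|)) _ (fun k => (picard k).2 z x)) => //.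
- by apply: abs_contZ; exact: coef_mass_ac.
- by apply: ae_lebesgueS is_derive_coef_mass => t /[apply] h; exact: is_deriveZ.
- move=> t n /andP[t0 tb]; have tb' : 0 <= t <= b by rewrite !ltW.
  have [h _] := hy z n tb'.
  rewrite -mulr_sumr -mulrBr cnM.
  have qz : cn ((q t)%:C%C - z) <= `|q t| + cn z.
    by apply: le_trans (cnD _ _) _; rewrite cnN cn_real.
  apply: le_trans (ler_pM (cn_ge0 _) (cn_ge0 _) qz h) _.
  have -> : 4 * B (cn z) * (1 + cn z) * (1 + `|q t|) / 2 ^+ n =
    (1 + cn z) * (1 + `|q t|) * (4 * B (cn z) / 2 ^+ n) by ring.
  have c0 : 0 <= 4 * B (cn z) / 2 ^+ n.
    by apply: divr_ge0; [apply: mulr_ge0 => //; exact: B_ge0|exact: exprn_ge0].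
  apply: ler_wpM2r => //.
  have := mulr_ge0 (cn_ge0 z) (normr_ge0 (q t)).
  lra.
- by move=> n; have [] := hy z n xb.
Qed.

Lemma picard_limit_solution z : is_solution q b z (y z) (y1 z).
Proof.
have [yac y1ac] := picard_limit_ac z.
have [[iR iI] [iqR iqI]] := picard_integrable z.
split => //.
- move=> x xb; have := xb; rewrite in_itv/= => /andP[x0 x1].
  have near_eq (g h : R -> R) (d : R) : (forall t, 0 <= t <= b -> g t = h t) ->
      is_derive x 1 h d -> is_derive x 1 g d.
    move=> gh; apply: near_eq_is_derive; near=> t; apply/esym/gh.
    by apply/andP; split; apply: ltW; near: t; [exact: lt_nbhsr|exact: lt_nbhsl].
  have x01 : 0 < x < b by rewrite x0.
  split.
    apply: (near_eq _ (fun t => al + primitive (fun t => complex.Re (y1 z t)) t)).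
      by move=> t tb; have [-> _] := picard_limit_eq z tb; rewrite cReD.
    rewrite -[complex.Re _]add0r; apply: is_deriveD.
    apply: (is_derive_primitive_continuous iR xb).
    exact: abs_cont_continuous y1ac.1 x01.
  apply: (near_eq _ (fun t => 0 + primitive (fun t => complex.Im (y1 z t)) t)).
    by move=> t tb; have [-> _] := picard_limit_eq z tb; rewrite cImD.
  rewrite -[complex.Im _]add0r; apply: is_deriveD.
  apply: (is_derive_primitive_continuous iI xb).
  exact: abs_cont_continuous y1ac.2 x01.
- apply: ae_lebesgueS (ae_lebesgueI (is_derive_primitive iqR) (is_derive_primitive iqI)).
  move=> x [dR dI] xb; exists (((q x)%:C%C - z) * y z x); last by rewrite addNr.
  have := xb; rewrite in_itv/= => /andP[x0 x1].
  have near_eq (g h : R -> R) (d : R) : (forall t, 0 <= t <= b -> g t = h t) ->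
      is_derive x 1 h d -> is_derive x 1 g d.
    move=> gh; apply: near_eq_is_derive; near=> t; apply/esym/gh.
    by apply/andP; split; apply: ltW; near: t; [exact: lt_nbhsr|exact: lt_nbhsl].
  split.
    apply: (near_eq _ (fun t => be + primitive (fun t => complex.Re (((q t)%:C%C - z) * y z t)) t)).
      by move=> t tb; have [_ ->] := picard_limit_eq z tb; rewrite cReD.
    by rewrite -[complex.Re _]add0r; apply: is_deriveD; exact: dR.
  apply: (near_eq _ (fun t => 0 + primitive (fun t => complex.Im (((q t)%:C%C - z) * y z t)) t)).
    by move=> t tb; have [_ ->] := picard_limit_eq z tb; rewrite cImD.
  by rewrite -[complex.Im _]add0r; apply: is_deriveD; exact: dI.
Unshelve. all: by end_near. Qed.

End Limit.

Lemma schrodinger_solution : exists y y1 : C -> R -> C,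
  [/\ forall z, is_solution q b z (y z) (y1 z),
      forall z, y z 0 = al%:C%C /\ y1 z 0 = be%:C%C,
      forall x, 0 <= x <= b -> polyapprox (y ^~ x) &
      forall z x, 0 <= x <= b -> y (conjc z) x = conjc (y z x)].
Proof.
have [y [y1 hy]] := picard_sol; exists y, y1; split.
- exact: (picard_limit_solution hy).
- move=> z; have z0 : (0 : R) <= 0 <= b by rewrite lexx b0'.
  by have [e1 e2] := picard_limit_eq hy z z0; rewrite e1 e2; split; rewrite cprimitive0 addr0.
- move=> x; exact: (picard_limit_polyapprox hy).
- move=> z x; exact: (picard_limit_conj hy).
Qed.

End Fixed.
End Picard.

(** * Growth and decay of solutions *)

Section Gronwall.
Context {R : realType}.
Notation mu := (@lebesgue_measure R).
Implicit Types (f h : R -> R) (a b x : R).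

Lemma is_derive_mul f g x df dg : is_derive x 1 f df -> is_derive x 1 g dg ->
  is_derive x 1 (fun t => f t * g t : R) (f x * dg + g x * df).
Proof. by move=> d1 d2; exact: is_deriveM. Qed.

Lemma is_derive_linear (c x : R) : is_derive x 1 (fun t : R => c * t) c.
Proof.
have d : is_derive x 1 (fun t : R => t) 1 by exact: is_derive_id.
by apply: (is_derive_eq (is_deriveZ c d)); rewrite /GRing.scale/= mulr1.
Qed.

Lemma is_derive_comp_expR f x df : is_derive x 1 f df ->
  is_derive x 1 (fun t => expR (f t)) (expR (f x) * df).
Proof. by move=> d; exact: (is_derive1_comp (is_derive_expR _) d). Qed.

Lemma gronwall_upper b f h u v : abs_cont 0 b f -> abs_cont 0 b h ->
  {ae mu, forall x, x \in `]0, b[ -> exists df dh,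
    [/\ is_derive x 1 f df, is_derive x 1 h dh & df <= dh * f x]} ->
  0 <= u -> u <= v -> v <= b -> f v <= f u * expR (h v - h u).
Proof.
move=> fac hac dfh u0 uv vb; have b0 : 0 <= b by lra.
have gac : abs_cont 0 b (fun x => - (f x * expR (- h x))).
  by apply: abs_contN; apply: abs_contM => //; apply: abs_cont_expR => //; exact: abs_contN.
have : - (f u * expR (- h u)) <= - (f v * expR (- h v)).
  apply: (abs_cont_le gac _ u0 uv vb).
  apply: ae_lebesgueS dfh => x /[apply] -[df [dh [d1 d2 le]]].
  have d3 := is_deriveN (is_derive_mul d1 (is_derive_comp_expR (is_deriveN d2))).
  exists (expR (- h x) * (dh * f x - df)).
    by apply: (is_derive_eq d3); rewrite /=; ring.
  by rewrite mulr_ge0 ?expR_ge0// subr_ge0.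
rewrite lerN2 expRD !expRN => le.
have hv := expR_gt0 (h v); have hu := expR_gt0 (h u).
rewrite -(@ler_pM2r _ (expR (h v))^-1) ?invr_gt0//.
apply: le_trans le _; rewrite le_eqVlt; apply/orP; left; apply/eqP; field.
by rewrite !lt0r_neq0.
Qed.

Lemma gronwall_lower b f h u v : abs_cont 0 b f -> abs_cont 0 b h ->
  {ae mu, forall x, x \in `]0, b[ -> exists df dh,
    [/\ is_derive x 1 f df, is_derive x 1 h dh & - (dh * f x) <= df]} ->
  0 <= u -> u <= v -> v <= b -> f u <= f v * expR (h v - h u).
Proof.
move=> fac hac dfh u0 uv vb; have b0 : 0 <= b by lra.
have gac : abs_cont 0 b (fun x => f x * expR (h x)).
  by apply: abs_contM => //; apply: abs_cont_expR.
have : f u * expR (h u) <= f v * expR (h v).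
  apply: (abs_cont_le gac _ u0 uv vb).
  apply: ae_lebesgueS dfh => x /[apply] -[df [dh [d1 d2 le]]].
  have d3 := is_derive_mul d1 (is_derive_comp_expR d2).
  exists (expR (h x) * (dh * f x + df)).
    by apply: (is_derive_eq d3); rewrite /=; ring.
  by rewrite mulr_ge0 ?expR_ge0//; lra.
rewrite expRD expRN => le.
have hv := expR_gt0 (h v); have hu := expR_gt0 (h u).
by rewrite mulrA ler_pdivlMr.
Qed.

(** The derivative of [J] in [decay], where [w] and [v] are the weights and [eP], [eN] the
    perturbations by [q]. The constant 5 is 1 + 4: after absorbing the perturbations, [g P] keeps
    the coefficient [4 (w - v)] and [g N] the coefficient [16 v - w]. *)
Lemma weighted_difference_ge0 (k P N g w v eP eN : R) : 0 <= k -> 0 <= P -> 0 <= N -> 0 <= g ->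
  1 <= w -> w <= 4 / 3 -> 3 / 4 <= v -> v <= 1 ->
  - (g * (P + N)) <= eP -> eN <= g * (P + N) ->
  0 <= w * (2 * k * P + eP + 5 * g * P) - 4 * v * (- (2 * k) * N + eN - 5 * g * N).
Proof.
move=> k0 P0 N0 g0 w1 w2 v1 v2 eP1 eN2.
have a1 : 0 <= w * (eP + g * (P + N)) by rewrite mulr_ge0; lra.
have a2 : 0 <= v * (g * (P + N) - eN) by rewrite mulr_ge0; lra.
have a3 : 0 <= w * (k * P) by rewrite mulr_ge0 ?mulr_ge0//; lra.
have a4 : 0 <= v * (k * N) by rewrite mulr_ge0 ?mulr_ge0//; lra.
have a5 : 0 <= g * P * (w - v) by rewrite mulr_ge0 ?mulr_ge0//; lra.
have a6 : 0 <= g * N * (16 * v - w) by rewrite mulr_ge0 ?mulr_ge0//; lra.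
nra.
Qed.

End Gronwall.

(** * Energy estimates for the two first-order factors *)

Section Energy.
Context {R : realType}.
Local Notation C := R[i].
Local Notation cn := ComplexField.Normc.normc.
Notation mu := (@lebesgue_measure R).
Variables (q : R -> R) (b : R) (z : C) (psi dpsi : R -> C).
Hypotheses (b0 : 0 < b) (iq : integrable_on b q) (sol : is_solution q b z psi dpsi).
Implicit Types (kp : C).

(* With z = - kp ^+ 2, the functions psi' + kp psi and psi' - kp psi satisfy
   p' = kp p + q psi and m' = - kp m + q psi; wfactor is their squared modulus. *)
Definition wfactor kp x : R := cn (dpsi x + kp * psi x) ^+ 2.

Let p1 kp x := complex.Re (dpsi x) + (complex.Re kp * complex.Re (psi x) - complex.Im kp * complex.Im (psi x)).
Let p2 kp x := complex.Im (dpsi x) + (complex.Re kp * complex.Im (psi x) + complex.Im kp * complex.Re (psi x)).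

Lemma factorE kp x : wfactor kp x = p1 kp x * p1 kp x + p2 kp x * p2 kp x.
Proof. by rewrite /wfactor cn_sqr !expr2 cReD cImD cReM cImM. Qed.

Lemma factor_ge0 kp x : 0 <= wfactor kp x. Proof. exact: sqr_ge0. Qed.

Lemma factor_ac kp : abs_cont 0 b (wfactor kp).
Proof.
have [[a1 a2] [a3 a4] _ _] := sol; have b0' := ltW b0.
have h1 : abs_cont 0 b (p1 kp).
  by apply: abs_contD => //; apply: abs_contB; apply: abs_contZ.
have h2 : abs_cont 0 b (p2 kp).
  by apply: abs_contD => //; apply: abs_contD; apply: abs_contZ.
apply: eq_abs_cont (abs_contD (abs_contM b0' h1 h1) (abs_contM b0' h2 h2)) => x _.
by rewrite factorE.
Qed.

Let err kp x := 2 * q x * (p1 kp x * complex.Re (psi x) + p2 kp x * complex.Im (psi x)).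

(** [kp] is quantified inside, so that one exceptional null set serves both [kp] and [- kp]. *)
Lemma is_derive_factor : {ae mu, forall x, x \in `]0, b[ -> forall kp, kp ^+ 2 = - z ->
  is_derive x 1 (wfactor kp) (2 * complex.Re kp * wfactor kp x + err kp x)}.
Proof.
have [_ _ d1 d2] := sol.
apply: ae_lebesgueS d2 => x /[swap] xb /(_ xb)[dd [dR dI] ddE] kp kpz.
have [uR uI] := d1 x xb.
have ddE' : dd = ((q x)%:C%C + kp ^+ 2) * psi x.
  by apply/eqP; rewrite -subr_eq0 -oppr_eq0 opprB addrC kpz ddE.
have -> : wfactor kp = (fun t => p1 kp t * p1 kp t + p2 kp t * p2 kp t).
  by apply/funext => t; rewrite factorE.
have e1 : is_derive x 1 (p1 kp) (complex.Re dd + (complex.Re kp * complex.Re (dpsi x) - complex.Im kp * complex.Im (dpsi x))).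
  by apply: is_deriveD; apply: is_deriveB; apply: is_deriveZ.
have e2 : is_derive x 1 (p2 kp) (complex.Im dd + (complex.Re kp * complex.Im (dpsi x) + complex.Im kp * complex.Re (dpsi x))).
  by apply: is_deriveD; apply: is_deriveD; apply: is_deriveZ.
have e3 := is_deriveD (is_derive_mul e1 e1) (is_derive_mul e2 e2).
apply: (is_derive_eq e3).
rewrite /err ddE' /p1 /p2.
case: kp {kpz e1 e2 e3 ddE'} => k l; case: (psi x) => u v; case: (dpsi x) => u' v' /=.
ring.
Qed.

(** The two factors differ by [2 kp psi]. Hence together they dominate [psi] here, while in the next
    bound a small first factor leaves [psi] comparable with the second. *)
Lemma factor_sum kp x : 4 * cn kp ^+ 2 * cn (psi x) ^+ 2 <= 2 * (wfactor kp x + wfactor (- kp) x).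
Proof.
have -> : 4 * cn kp ^+ 2 * cn (psi x) ^+ 2 = cn ((dpsi x + kp * psi x) - (dpsi x + - kp * psi x)) ^+ 2.
  have -> : (dpsi x + kp * psi x) - (dpsi x + - kp * psi x) = 2%:R * (kp * psi x) by ring.
  by rewrite !cnM cn_natr; ring.
rewrite /wfactor !cn_sqr.
case: (dpsi x + kp * psi x) (dpsi x + - kp * psi x) => [a1 a2] [c1 c2] /=.
have := sqr_ge0 (a1 + c1); have := sqr_ge0 (a2 + c2); nra.
Qed.

Lemma factor_diff kp x : wfactor (- kp) x / 2 - wfactor kp x <= 4 * cn kp ^+ 2 * cn (psi x) ^+ 2.
Proof.
have -> : 4 * cn kp ^+ 2 * cn (psi x) ^+ 2 = cn ((dpsi x + kp * psi x) - (dpsi x + - kp * psi x)) ^+ 2.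
  have -> : (dpsi x + kp * psi x) - (dpsi x + - kp * psi x) = 2%:R * (kp * psi x) by ring.
  by rewrite !cnM cn_natr; ring.
rewrite /wfactor !cn_sqr.
case: (dpsi x + kp * psi x) (dpsi x + - kp * psi x) => [a1 a2] [c1 c2] /=.
have := sqr_ge0 (2 * a1 - c1); have := sqr_ge0 (2 * a2 - c2); nra.
Qed.

(** Cauchy-Schwarz, with [psi] bounded through [factor_sum]: the perturbation by [q] gains a factor
    [1 / |kp|], so that for large [|z|] the equation behaves as if [q] were 0. *)
Lemma err_le kp x : 0 < cn kp ->
  `|err kp x| <= 2 * `|q x| / cn kp * (wfactor kp x + wfactor (- kp) x).
Proof.
move=> K0; set K := cn kp.
have hs := factor_sum kp x; rewrite -/K in hs.
have fE := factorE kp x; have fN := factor_ge0 (- kp) x.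
pose w := p1 kp x * complex.Re (psi x) + p2 kp x * complex.Im (psi x).
have psiE := cn_sqr (psi x).
have key : K * `|w| <= wfactor kp x + wfactor (- kp) x.
  set S := wfactor kp x + wfactor (- kp) x in hs *.
  have A : (K * w) ^+ 2 <= wfactor kp x * (K ^+ 2 * cn (psi x) ^+ 2).
    have -> : wfactor kp x * (K ^+ 2 * cn (psi x) ^+ 2) = K ^+ 2 * (wfactor kp x * cn (psi x) ^+ 2).
      by ring.
    rewrite exprMn; apply: ler_wpM2l; first exact: sqr_ge0.
    rewrite fE psiE /w.
    set a := p1 kp x; set c := p2 kp x; set u := complex.Re _; set v := complex.Im _.
    have := sqr_ge0 (a * v - c * u); nra.
  have f0 := factor_ge0 kp x.
  have S0 : 0 <= S by rewrite addr_ge0.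
  have fS : wfactor kp x <= S by rewrite lerDl.
  have B1 : K ^+ 2 * cn (psi x) ^+ 2 <= S by move: hs; nra.
  have B0 : 0 <= K ^+ 2 * cn (psi x) ^+ 2 by rewrite mulr_ge0 ?sqr_ge0.
  have B2 : wfactor kp x * (K ^+ 2 * cn (psi x) ^+ 2) <= S * S by apply: ler_pM.
  have -> : K * `|w| = `|K * w| by rewrite normrM gtr0_norm.
  rewrite -(@ler_pXn2r _ 2)// ?nnegrE// real_normK ?num_real// [leRHS]expr2.
  exact: le_trans B2.
have -> : `|err kp x| = 2 * `|q x| * `|w| by rewrite /err -/w !normrM ger0_norm.
have -> : 2 * `|q x| / K * (wfactor kp x + wfactor (- kp) x) = 2 * `|q x| * ((wfactor kp x + wfactor (- kp) x) / K).
  by rewrite mulrAC mulrA.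
by rewrite ler_wpM2l ?mulr_ge0// ler_pdivlMr// mulrC.
Qed.


Section WithFactor.
Variable kp : C.
Hypotheses (kpz : kp ^+ 2 = - z) (k0 : 0 <= complex.Re kp) (K0 : 0 < cn kp).
Let k := complex.Re kp.
Let K := cn kp.
Let P := wfactor kp.
Let N := wfactor (- kp).
Let Qn x := primitive (fun t => `|q t|) x.

Lemma primitive_norm_ac : abs_cont 0 b Qn.
Proof. exact/abs_cont_primitive/integrable_on_norm. Qed.

Lemma is_derive_primitive_norm :
  {ae mu, forall x, x \in `]0, b[ -> is_derive x 1 Qn `|q x|}.
Proof. exact/is_derive_primitive/integrable_on_norm. Qed.

Lemma primitive_norm_le u v : 0 <= u -> u <= v -> v <= b -> Qn u <= Qn v.
Proof.
move=> u0 uv vb; apply: (abs_cont_le primitive_norm_ac _ u0 uv vb).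
by apply: ae_lebesgueS is_derive_primitive_norm => x /[apply] h; exists `|q x|.
Qed.

Lemma primitive_norm0 : Qn 0 = 0. Proof. exact: primitive0. Qed.

Lemma factor_derivatives : {ae mu, forall x, x \in `]0, b[ -> exists eP eN,
  [/\ is_derive x 1 P (2 * k * P x + eP), is_derive x 1 N (- (2 * k) * N x + eN),
      is_derive x 1 Qn `|q x|, `|eP| <= 2 * `|q x| / K * (P x + N x) &
      `|eN| <= 2 * `|q x| / K * (P x + N x)]}.
Proof.
apply: ae_lebesgueS (ae_lebesgueI is_derive_factor is_derive_primitive_norm) => x [h1 h2] xb.
exists (err kp x), (err (- kp) x).
have Kn : cn (- kp) = K by rewrite cnN.
split; [exact: (h1 xb kp kpz)| |exact: h2|exact: err_le|].
- have kpz' : (- kp) ^+ 2 = - z by rewrite sqrrN.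
  have ReN : complex.Re (- kp) = - k by rewrite /k; case: (kp).
  by apply: (is_derive_eq (h1 xb _ kpz')); rewrite ReN /N; ring.
- by have := @err_le (- kp) x; rewrite Kn opprK addrC; apply.
Qed.

Let h x := 2 * k * x + 4 / K * Qn x.

Let hac : abs_cont 0 b h.
Proof.
by apply: abs_contD; apply: abs_contZ; [exact: abs_cont_id|exact: primitive_norm_ac].
Qed.

Let is_derive_h (x : R) : is_derive x 1 Qn `|q x| -> is_derive x 1 h (2 * k + 4 / K * `|q x|).
Proof.
move=> d; have d2 := is_deriveD (is_derive_linear (2 * k) x) (is_deriveZ (4 / K) d).
by apply: (is_derive_eq d2); rewrite /GRing.scale/=.
Qed.

Let S x := P x + N x.

(** Gronwall in both directions for [S]; the term [4 / K] in [h] collects the two perturbations,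
    each at most [2 |q| / K] times [S]. Forward it gives the growth of solutions, and in both
    directions together the uniqueness of the Cauchy problem from any point. *)
Lemma energy_bounds u v : 0 <= u -> u <= v -> v <= b ->
  S v <= S u * expR (h v - h u) /\ S u <= S v * expR (h v - h u).
Proof.
move=> u0 uv vb.
have Sac : abs_cont 0 b S by apply: abs_contD; exact: factor_ac.
have key : {ae mu, forall x, x \in `]0, b[ -> exists df dh,
    [/\ is_derive x 1 S df, is_derive x 1 h dh, df <= dh * S x & - (dh * S x) <= df]}.
  apply: ae_lebesgueS factor_derivatives => x /[apply] -[eP [eN [dP dN dQ leP leN]]].
  exists (2 * k * P x + eP + (- (2 * k) * N x + eN)), (2 * k + 4 / K * `|q x|).
  have P0 : 0 <= P x := factor_ge0 _ _; have N0 : 0 <= N x := factor_ge0 _ _.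
  have kP : 0 <= k * P x by rewrite mulr_ge0.
  have kN : 0 <= k * N x by rewrite mulr_ge0.
  have -> : (2 * k + 4 / K * `|q x|) * S x = 2 * (k * P x) + 2 * (k * N x) +
      2 * (2 * `|q x| / K * (P x + N x)) by rewrite /S; ring.
  move: leP leN; rewrite !ler_norml => /andP[? ?] /andP[? ?].
  split; [exact: is_deriveD|exact: is_derive_h|lra|lra].
split.
  apply: (gronwall_upper Sac hac _ u0 uv vb).
  by apply: ae_lebesgueS key => x /[apply] -[df [dh [? ? ? ?]]]; exists df, dh.
apply: (gronwall_lower Sac hac _ u0 uv vb).
by apply: ae_lebesgueS key => x /[apply] -[df [dh [? ? ? ?]]]; exists df, dh.
Qed.

Lemma energyE x : S x = 2 * (cn (dpsi x) ^+ 2 + K ^+ 2 * cn (psi x) ^+ 2).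
Proof.
rewrite -exprMn -cnM /S /P /N /wfactor mulNr !cn_sqr.
by case: (dpsi x) (kp * psi x) => [? ?] [? ?] /=; ring.
Qed.

Lemma solution_bound x : 0 <= x <= b ->
  cn (psi x) ^+ 2 <= (cn (dpsi 0) ^+ 2 / K ^+ 2 + cn (psi 0) ^+ 2) * expR (2 * k * x + 4 / K * Qn b).
Proof.
move=> /andP[x0 xb]; have [h1 _] := energy_bounds (lexx 0) x0 xb.
have h2 : h x - h 0 <= 2 * k * x + 4 / K * Qn b.
  rewrite /h primitive_norm0 !mulr0 addr0 subr0 lerD2l ler_wpM2l ?primitive_norm_le//.
  by rewrite divr_ge0// ltW.
have S0 : 0 <= S 0 by rewrite addr_ge0// factor_ge0.
have h3 : S x <= S 0 * expR (2 * k * x + 4 / K * Qn b).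
  by apply: le_trans h1 _; rewrite ler_wpM2l// ler_expR.
rewrite !energyE in h3.
have K20 : 0 < K ^+ 2 by rewrite exprn_gt0.
have d0 := sqr_ge0 (cn (dpsi x)).
rewrite -(@ler_pM2l _ (K ^+ 2))//.
have -> : K ^+ 2 * ((cn (dpsi 0) ^+ 2 / K ^+ 2 + cn (psi 0) ^+ 2) * expR (2 * k * x + 4 / K * Qn b)) =
  (cn (dpsi 0) ^+ 2 + K ^+ 2 * cn (psi 0) ^+ 2) * expR (2 * k * x + 4 / K * Qn b).
  by field; rewrite lt0r_neq0.
by move: h3; rewrite -!mulrA ler_pM2l//; lra.
Qed.

Lemma solution_eq0 x0 x : 0 <= x0 <= b -> psi x0 = 0 -> dpsi x0 = 0 -> 0 <= x <= b ->
  psi x = 0 /\ dpsi x = 0.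
Proof.
move=> /andP[x00 x0b] y0 y10 /andP[xx0 xb].
have Sx0 : S x0 = 0 by rewrite energyE y0 y10 cn0 expr0n/= mulr0 addr0 mulr0.
have Sx : S x <= 0.
  have [le|/ltW le] := leP x0 x.
    by have [+ _] := energy_bounds x00 le xb; rewrite Sx0 mul0r.
  by have [_] := energy_bounds xx0 le x0b; rewrite Sx0 mul0r.
rewrite energyE in Sx.
have K20 : 0 < K ^+ 2 by rewrite exprn_gt0.
have h1 := sqr_ge0 (cn (dpsi x)).
have h2 : 0 <= K ^+ 2 * cn (psi x) ^+ 2 by rewrite mulr_ge0 ?sqr_ge0.
have e1 : cn (dpsi x) ^+ 2 = 0 by lra.
have e2 : K ^+ 2 * cn (psi x) ^+ 2 = 0 by lra.
split; apply: cn_eq0; apply/eqP; last by rewrite -sqrf_eq0 e1.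
by move/eqP: e2; rewrite mulf_eq0 sqrf_eq0 gt_eqF//= sqrf_eq0.
Qed.

Let G x := 2 / K * Qn x.

(* The cone P <= 4 N is invariant as x decreases from b, because
   J = P exp (5 G) - 4 N exp (- 5 G) is nondecreasing; in the cone N decays like
   exp (- 2 k x). The bound P 0 <= N 0 / 4 makes psi 0 comparable to the factor
   psi' - kp psi at 0. *)
Lemma decay : G b <= 1 / 80 -> expR (- (4 * k * b)) <= 1 / 64 -> P b <= 2 * N b ->
  forall x, 0 <= x <= b -> cn (psi x) ^+ 2 <= 80 * expR (- (2 * k * x)) * cn (psi 0) ^+ 2.
Proof.
move=> Gb kb Pb.
have b0' := ltW b0.
have K20 : 0 <= 2 / K by rewrite divr_ge0// ltW.
have G0 x : 0 <= x <= b -> 0 <= G x <= 1 / 80.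
  move=> /andP[x0 xb]; apply/andP; split.
    by rewrite mulr_ge0// -primitive_norm0 primitive_norm_le.
  by apply: le_trans Gb; rewrite ler_wpM2l// primitive_norm_le.
have G00 : G 0 = 0 by rewrite /G primitive_norm0 mulr0.
have Gac : abs_cont 0 b G by apply: abs_contZ; exact: primitive_norm_ac.
pose w x := expR (5 * G x); pose v x := expR (- (5 * G x)).
have wv x : w x * v x = 1 by rewrite -expRD subrr expR0.
have w1 x : 0 <= x <= b -> 1 <= w x <= 4 / 3 /\ 3 / 4 <= v x <= 1.
  move=> /G0 /andP[g0 g1].
  have h1 := expR_ge1Dx (5 * G x); have h2 := expR_ge1Dx (- (5 * G x)).
  have := wv x; have := expR_gt0 (5 * G x); have := expR_gt0 (- (5 * G x)).
  rewrite -/(w x) -/(v x) in h1 h2 *; move=> v0 w0 wvE.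
  by split; apply/andP; split; nra.
have wac : abs_cont 0 b w by apply: abs_cont_expR => //; exact: abs_contZ.
have vac : abs_cont 0 b v by apply: abs_cont_expR => //; apply: abs_contN; exact: abs_contZ.
have Pac : abs_cont 0 b P by exact: factor_ac.
have Nac : abs_cont 0 b N by exact: factor_ac.
have P0 x : 0 <= P x := factor_ge0 _ _; have N0 x : 0 <= N x := factor_ge0 _ _.
pose g x := 2 / K * `|q x|.
have g0 x : 0 <= g x by rewrite mulr_ge0.
have fd : {ae mu, forall x, x \in `]0, b[ -> exists eP eN,
  [/\ is_derive x 1 P (2 * k * P x + eP), is_derive x 1 N (- (2 * k) * N x + eN),
      is_derive x 1 G (g x), `|eP| <= g x * (P x + N x) & `|eN| <= g x * (P x + N x)]}.
  apply: ae_lebesgueS factor_derivatives => x /[apply] -[eP [eN [dP dN dQ leP leN]]].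
  exists eP, eN; have gE : g x = 2 * `|q x| / K by rewrite /g mulrAC.
  by split => //; [exact: is_deriveZ|rewrite gE|rewrite gE].
have in01 x : x \in `]0, b[ -> 0 <= x <= b by rewrite in_itv/= => /andP[? ?]; rewrite !ltW.
pose J x := P x * w x - 4 * (N x * v x).
have JJ x : 0 <= x <= b -> J x <= 0.
  move=> /andP[x0 xb]; apply: (@le_trans _ _ (J b)).
    have Jac : abs_cont 0 b J.
      by apply: abs_contB; [exact: abs_contM|apply: abs_contZ; exact: abs_contM].
    apply: (abs_cont_le Jac _ x0 xb (lexx b)).
    apply: ae_lebesgueS fd => t /[swap] tb /(_ tb)[eP [eN [dP dN dG leP leN]]].
    have [/andP[w11 w12] /andP[v11 v12]] := w1 t (in01 t tb).
    have dw := is_derive_comp_expR (is_deriveZ 5 dG).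
    have dv := is_derive_comp_expR (is_deriveN (is_deriveZ 5 dG)).
    have dJ := is_deriveB (is_derive_mul dP dw) (is_deriveZ 4 (is_derive_mul dN dv)).
    exists (w t * (2 * k * P t + eP + 5 * g t * P t)
            - 4 * v t * (- (2 * k) * N t + eN - 5 * g t * N t)).
      by apply: (is_derive_eq dJ); rewrite /w /v /GRing.scale/=; ring.
    move: leP leN; rewrite !ler_norml => /andP[eP1 _] /andP[_ eN2].
    exact: (weighted_difference_ge0 k0 (P0 t) (N0 t) (g0 t)).
  (* The boundary bound with 2 lies inside the cone with 4 despite the weights, because
     [2 * (4 / 3) <= 4 * (3 / 4)]. *)
  have bb : 0 <= b <= b by rewrite b0' lexx.
  have [/andP[w11 w12] /andP[v11 v12]] := w1 b bb.
  have := P0 b; have := N0 b; rewrite /J => ? ?.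
  have : P b * w b <= 2 * N b * (4 / 3) by apply: ler_pM => //; lra.
  have : N b * (3 / 4) <= N b * v b by rewrite ler_wpM2l.
  lra.
have PN x : 0 <= x <= b -> P x <= 4 * N x.
  move=> xb; have := JJ x xb; have [/andP[w11 w12] /andP[v11 v12]] := w1 x xb.
  have := P0 x; have := N0 x; rewrite /J => ? ?.
  have : P x * 1 <= P x * w x by rewrite ler_wpM2l.
  have : N x * v x <= N x * 1 by rewrite ler_wpM2l.
  lra.
(* In the cone [P + N <= 5 N], so the perturbation costs at most the factor
   [expR (5 * G x) <= 4 / 3]. *)
have ND x : 0 <= x <= b -> N x <= 2 * N 0 * expR (- (2 * k * x)).
  move=> xb; have /andP[x0 x1] := xb.
  pose h1 x := - (2 * k) * x + 5 * G x.
  have h1ac : abs_cont 0 b h1.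
    by apply: abs_contD; apply: abs_contZ; [exact: abs_cont_id|].
  have : N x <= N 0 * expR (h1 x - h1 0).
    apply: (gronwall_upper Nac h1ac _ (lexx 0) x0 x1).
    apply: ae_lebesgueS fd => t /[swap] tb /(_ tb)[eP [eN [dP dN dG leP leN]]].
    exists (- (2 * k) * N t + eN), (- (2 * k) + 5 * g t); split => //.
      have dh := is_deriveD (is_derive_linear (- (2 * k)) t) (is_deriveZ 5 dG).
      by apply: (is_derive_eq dh); rewrite /GRing.scale/=.
    have h4 := PN t (in01 t tb).
    have : g t * (P t + N t) <= g t * (5 * N t) by rewrite ler_wpM2l//; lra.
    by move: leN; rewrite ler_norml => /andP[_ leN]; lra.
  rewrite /h1 G00 !mulr0 addr0 subr0 expRD mulNr -/(w x) => le.
  apply: le_trans le _.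
  have -> : 2 * N 0 * expR (- (2 * k * x)) = N 0 * (expR (- (2 * k * x)) * 2) by ring.
  apply: ler_wpM2l => //; apply: ler_wpM2l; first exact: expR_ge0.
  by have [/andP[_ w2] _] := w1 x xb; lra.
(* Going back from [b], [P exp (- 2 k x)] starts below [8 N 0 exp (- 4 k b)] and gains at most
   [10 N 0 G b], where 10 is 5 from the cone times 2 from [ND]. The thresholds 1/64 and 1/80 make
   each contribution at most [N 0 / 8]. *)
have PN0 : P 0 <= N 0 / 4.
  pose f x := P x * expR (- (2 * k * x)) + 10 * N 0 * G x.
  have fac : abs_cont 0 b f.
    apply: abs_contD; last exact: abs_contZ.
    by apply: abs_contM => //; apply: abs_cont_expR => //; apply: abs_contN; apply: abs_contZ; exact: abs_cont_id.
  have : f 0 <= f b.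
    apply: (abs_cont_nondecreasing b0' fac).
    apply: ae_lebesgueS fd => t /[swap] tb /(_ tb)[eP [eN [dP dN dG leP leN]]].
    have de := is_derive_comp_expR (is_deriveN (is_derive_linear (2 * k) t)).
    have df := is_deriveD (is_derive_mul dP de) (is_deriveZ (10 * N 0) dG).
    exists (expR (- (2 * k * t)) * eP + 10 * N 0 * g t).
      apply: (is_derive_eq df); rewrite /GRing.scale/=; ring.
    have t01 := in01 t tb; have /andP[t0 t1] := t01.
    have e1 : expR (- (2 * k * t)) <= 1.
      by rewrite -[leRHS]expR0 ler_expR oppr_le0 !mulr_ge0.
    have e0 := expR_ge0 (- (2 * k * t)).
    have hN := ND t t01; have hP := PN t t01.
    have hN2 : N t <= 2 * N 0.
      by apply: le_trans hN _; rewrite ler_piMr// mulr_ge0.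
    have : g t * (P t + N t) <= g t * (10 * N 0) by rewrite ler_wpM2l//; lra.
    move: leP; rewrite ler_norml => /andP[leP _] le2.
    have le3 : - (10 * N 0 * g t) <= eP by lra.
    have : 0 <= expR (- (2 * k * t)) * (eP + 10 * N 0 * g t) by rewrite mulr_ge0//; lra.
    have : 0 <= (1 - expR (- (2 * k * t))) * (10 * N 0 * g t).
      by apply: mulr_ge0; [rewrite subr_ge0|apply: mulr_ge0 => //; apply: mulr_ge0].
    lra.
  rewrite /f G00 !mulr0 oppr0 expR0 mulr1 addr0 => le.
  have bb : 0 <= b <= b by rewrite b0' lexx.
  have h1 : P b * expR (- (2 * k * b)) <= 8 * N 0 * expR (- (4 * k * b)).
    have -> : - (4 * k * b) = - (2 * k * b) + - (2 * k * b) by ring.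
    rewrite expRD mulrA ler_wpM2r ?expR_ge0//.
    by have := PN b bb; have := ND b bb; lra.
  have h2 : 8 * N 0 * expR (- (4 * k * b)) <= 8 * N 0 * (1 / 64).
    by rewrite ler_wpM2l// mulr_ge0.
  have h3 : 10 * N 0 * G b <= 10 * N 0 * (1 / 80) by rewrite ler_wpM2l// mulr_ge0.
  lra.
(* On one side [2 (P x + N x) <= 10 N x <= 20 N 0 exp (- 2 k x)]; on the other
   [N 0 / 4 <= N 0 / 2 - P 0], which [factor_diff] bounds by [psi 0]. Their quotient is the constant
   80. *)
move=> x xb.
have K20' : 0 < 4 * K ^+ 2 by rewrite mulr_gt0// exprn_gt0.
rewrite -(@ler_pM2l _ (4 * K ^+ 2))//.
have h1 := factor_sum kp x; have h2 := factor_diff kp 0.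
rewrite -/K -/P -/N -/(P x) -/(N x) in h1; rewrite -/K -/P -/N in h2.
have h3 := PN x xb; have h4 := ND x xb.
have e0 := expR_ge0 (- (2 * k * x)).
apply: le_trans h1 _.
have -> : 4 * K ^+ 2 * (80 * expR (- (2 * k * x)) * cn (psi 0) ^+ 2) =
  (80 * expR (- (2 * k * x))) * (4 * K ^+ 2 * cn (psi 0) ^+ 2) by ring.
apply: (@le_trans _ _ (80 * expR (- (2 * k * x)) * (N 0 / 4))); last first.
  by rewrite ler_wpM2l ?mulr_ge0//; lra.
lra.
Qed.

End WithFactor.
End Energy.

Section LinearCombination.
Context {R : realType}.
Local Notation C := R[i].
Notation mu := (@lebesgue_measure R).
Implicit Types (z w : C).

Lemma cabs_contD (a b : R) (f g : R -> C) : cabs_cont a b f -> cabs_cont a b g ->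
  cabs_cont a b (fun x => f x + g x).
Proof.
move=> [f1 f2] [g1 g2]; split.
  by apply: eq_abs_cont (abs_contD f1 g1) => x _; rewrite cReD.
by apply: eq_abs_cont (abs_contD f2 g2) => x _; rewrite cImD.
Qed.

Lemma cabs_contZ (a b : R) (f : R -> C) w : cabs_cont a b f -> cabs_cont a b (fun x => w * f x).
Proof.
move=> [f1 f2]; split.
  apply: eq_abs_cont (abs_contB (abs_contZ (complex.Re w) f1) (abs_contZ (complex.Im w) f2)) => x _.
  by rewrite cReM.
apply: eq_abs_cont (abs_contD (abs_contZ (complex.Re w) f2) (abs_contZ (complex.Im w) f1)) => x _.
by rewrite cImM.
Qed.

Lemma is_cderiveD (f g : R -> C) x df dg : is_cderive f x df -> is_cderive g x dg ->
  is_cderive (fun t => f t + g t) x (df + dg).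
Proof.
move=> [f1 f2] [g1 g2]; split.
  under eq_fun do rewrite cReD.
  by rewrite cReD; exact: is_deriveD.
under eq_fun do rewrite cImD.
by rewrite cImD; exact: is_deriveD.
Qed.

Lemma is_cderiveZ (f : R -> C) x df w : is_cderive f x df ->
  is_cderive (fun t => w * f t) x (w * df).
Proof.
move=> [f1 f2]; split.
  under eq_fun do rewrite cReM.
  by rewrite cReM; apply: is_deriveB; apply: is_deriveZ.
under eq_fun do rewrite cImM.
by rewrite cImM; apply: is_deriveD; apply: is_deriveZ.
Qed.

Lemma is_solutionD q (b : R) z f df g dg : is_solution q b z f df -> is_solution q b z g dg ->
  is_solution q b z (fun x => f x + g x) (fun x => df x + dg x).
Proof.
move=> [f1 f2 f3 f4] [g1 g2 g3 g4]; split; [exact: cabs_contD|exact: cabs_contD| |].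
  by move=> x xb; apply: is_cderiveD; [exact: f3|exact: g3].
apply: ae_lebesgueS (ae_lebesgueI f4 g4) => x [hf hg] xb.
have [a a1 a2] := hf xb; have [c c1 c2] := hg xb.
exists (a + c); first exact: is_cderiveD.
by rewrite mulrDr opprD addrACA a2 c2 addr0.
Qed.

Lemma is_solutionZ q (b : R) z f df w : is_solution q b z f df ->
  is_solution q b z (fun x => w * f x) (fun x => w * df x).
Proof.
move=> [f1 f2 f3 f4]; split; [exact: cabs_contZ|exact: cabs_contZ| |].
  by move=> x xb; apply: is_cderiveZ; exact: f3.
apply: ae_lebesgueS f4 => x hf xb; have [a a1 a2] := hf xb.
exists (w * a); first exact: is_cderiveZ.
by rewrite -[RHS](mulr0 w) -a2; ring.
Qed.

End LinearCombination.

(** * The Weyl solution and its decay along the ray *)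

Section WeylSolution.
Context {R : realType}.
Local Notation C := R[i].
Local Notation cn := ComplexField.Normc.normc.
Implicit Types (z w : C).

(* kp = - i z^(1/2). *)
Lemma kappaP z : exists kp : C, [/\ kp ^+ 2 = - z, complex.Re kp = im_sqrt z,
  0 <= im_sqrt z & cn kp = Num.sqrt (cn z)].
Proof.
pose s := sqrtC z; have sE : s ^+ 2 = z by exact: sqrtCK.
exists (Complex (complex.Im s) (- complex.Re s)).
have kE : (Complex (complex.Im s) (- complex.Re s)) ^+ 2 = - z.
  rewrite -sE; case: (s) => a c; rewrite !expr2; congr Complex => /=; ring.
split => //.
  have := @Im_rootC_ge0 C 2 z isT; rewrite -/s /im_sqrt -/s -complexIm.
  by rewrite ler0c.
by rewrite -(cnN z) -kE cnX sqrtr_sqr ger0_norm// cn_ge0.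
Qed.

(** On the ray the real part of [z] is at most 0, so the imaginary part of the square root dominates
    its real part and is comparable with the modulus. *)
Lemma im_sqrt_ray (r eps : R) : 0 <= r -> 0 < eps < pi / 2 ->
  r <= 2 * im_sqrt (polar r (pi - eps)) ^+ 2.
Proof.
move=> r0 /andP[e0 e1]; set z := polar _ _.
pose s := sqrtC z; have sE : s ^+ 2 = z by exact: sqrtCK.
have h1 : complex.Re s ^+ 2 + complex.Im s ^+ 2 = r.
  by rewrite -cn_sqr -cnX sE cn_polar.
have h2 : complex.Re s ^+ 2 - complex.Im s ^+ 2 = - (r * cos eps).
  have <- : complex.Re z = - (r * cos eps).
    by rewrite /z/= cosB cospi sinpi mulN1r mul0r addr0 mulrN.
  by rewrite -sE expr2 cReM !expr2.
have : 0 <= cos eps by apply: cos_ge0_pihalf; have pi0 := @pi_gt0 R; apply/andP; split; lra.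
rewrite /im_sqrt -/s => c0; have : 0 <= r * cos eps by rewrite mulr_ge0.
lra.
Qed.

(** The condition at [b] reads [psi' = - h psi] with [h] the cotangent of [beta], so the factors are
    [(kp - h) psi] and [- (kp + h) psi]. The claim becomes [0 <= |kp|^2 + 6 k h + h^2], whence the
    6. In the Dirichlet case [psi b = 0] and the factors coincide; the quotient is then 0 by
    convention. *)
Lemma boundary_factor q (b beta : R) z psi dpsi kp : is_weyl_solution q b beta z psi dpsi ->
  0 <= complex.Re kp -> 6 * `|cos beta / sin beta| <= cn kp ->
  wfactor psi dpsi kp b <= 2 * wfactor psi dpsi (- kp) b.
Proof.
move=> [_ _ bc] k0 hK; rewrite /wfactor.
have [s0|s0] := eqVneq (sin beta) 0.
  have c0 : cos beta != 0.
    by have := cos2Dsin2 beta; rewrite s0 expr0n/= addr0 => /eqP; apply: contraTneq => ->; rewrite expr0n/= eq_sym oner_eq0.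
  have -> : psi b = 0.
    move: bc; rewrite s0 rmorph0 mul0r add0r => /eqP; rewrite mulf_eq0 => /orP[|/eqP//].
    by rewrite eq_complex/= eqxx andbT (negPf c0).
  by rewrite !mulr0 addr0; have := sqr_ge0 (cn (dpsi b)); lra.
set h := cos beta / sin beta in hK.
have dE : dpsi b = - (h%:C%C * psi b).
  have sC : (sin beta)%:C%C != 0 :> C by rewrite eq_complex/= eqxx andbT.
  apply: (mulfI sC); move/eqP: bc; rewrite addr_eq0 => /eqP ->.
  by rewrite mulrN mulrA -rmorphM /h [sin beta * _]mulrC divfK.
have -> : dpsi b + kp * psi b = (kp - h%:C%C) * psi b by rewrite dE; ring.
have -> : dpsi b + - kp * psi b = - ((kp + h%:C%C) * psi b) by rewrite dE; ring.
rewrite cnN !cnM !exprMn [leRHS]mulrA; apply: ler_wpM2r; first exact: sqr_ge0.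
have hh : h ^+ 2 = `|h| ^+ 2 by rewrite real_normK ?num_real.
have n0 := normr_ge0 h; have le1 := ler_norm (- h); rewrite normrN in le1.
have kK : complex.Re kp <= cn kp by apply: le_trans (cn_Re _); exact: ler_norm.
have K0 := cn_ge0 kp.
have KE := cn_sqr kp.
rewrite !cn_sqr; move: k0 hK kK K0 KE; move: (cn kp) => K.
case: kp => k l /= k0 hK kK K0 KE.
rewrite subr0 addr0.
have h2 : - (6 * k * h) <= K ^+ 2.
  have : 0 <= (`|h| + h) * k by rewrite mulr_ge0//; lra.
  have : 6 * `|h| * k <= K * K by apply: ler_pM => //; rewrite mulr_ge0.
  by rewrite expr2; lra.
have := sqr_ge0 h; nra.
Qed.

Section Fundamental.
Variables (q : R -> R) (b : R).
Hypotheses (b0 : 0 < b) (iq : integrable_on b q).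
Let Qb := primitive (fun t => `|q t|) b.

Let Qb_ge0 : 0 <= Qb.
Proof. by apply: Rintegral_ge0. Qed.

Lemma solution_growth z psi dpsi x : is_solution q b z psi dpsi -> 1 <= cn z -> 0 <= x <= b ->
  cn (psi x) <= (cn (dpsi 0) / Num.sqrt (cn z) + cn (psi 0)) * expR (im_sqrt z * x + 2 * Qb) /\
  im_sqrt z <= Num.sqrt (cn z).
Proof.
move=> sol z1 xb; have [kp [kpz kE k0 KE]] := kappaP z.
have K1 : 1 <= cn kp by rewrite KE -[leLHS]sqrtr1; exact: ler_wsqrtr.
have K0 : 0 < cn kp by lra.
rewrite -kE in k0 *; rewrite -KE; split; last first.
  by apply: le_trans (cn_Re _); exact: ler_norm.
have := @solution_bound R q b z psi dpsi b0 iq sol kp kpz k0 K0 x xb.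
rewrite -/Qb => h.
have A0 : 0 <= cn (dpsi 0) / cn kp by rewrite divr_ge0 ?cn_ge0.
rewrite -(@ler_pXn2r _ 2)// ?nnegrE ?cn_ge0//; last first.
  by rewrite mulr_ge0 ?expR_ge0// addr_ge0 ?cn_ge0.
apply: le_trans h _; rewrite exprMn.
apply: ler_pM; rewrite ?expR_ge0//.
- by rewrite addr_ge0 ?divr_ge0 ?sqr_ge0.
- rewrite -expr_div_n sqrrD; have : 0 <= cn (dpsi 0) / cn kp * cn (psi 0) by rewrite mulr_ge0 ?cn_ge0.
  by lra.
- rewrite -expRM_natl ler_expR.
  have : 4 / cn kp * Qb <= 4 * Qb.
    by rewrite ler_wpM2r ?Qb_ge0// ler_pdivrMr//; lra.
  by rewrite mulr_natl mulr2n; lra.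
Qed.

Variables (phi dphi theta dtheta : C -> R -> C).
Hypotheses (sphi : forall z, is_solution q b z (phi z) (dphi z))
  (phi0 : forall z, phi z 0 = (0 : R)%:C%C /\ dphi z 0 = (1 : R)%:C%C)
  (stheta : forall z, is_solution q b z (theta z) (dtheta z))
  (theta0 : forall z, theta z 0 = (1 : R)%:C%C /\ dtheta z 0 = (0 : R)%:C%C).

(** The combination [A theta + B phi] satisfies the condition at [b] by the choice of [A] and [B],
    and takes the value [A] at 0. If [A = 0], then [phi] itself satisfies the condition. *)
Lemma weyl_solution_exists beta z : z != 0 -> exists psi dpsi, is_weyl_solution q b beta z psi dpsi.
Proof.
move=> z0; have [kp [kpz kE k0 KE]] := kappaP z.
have K0 : 0 < cn kp.
  rewrite lt0r cn_ge0 andbT; apply: contraNneq z0 => /cn_eq0 kp0.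
  by rewrite -oppr_eq0 -kpz kp0 expr0n.
rewrite -kE in k0.
pose L (psi dpsi : R -> C) := (sin beta)%:C%C * dpsi b + (cos beta)%:C%C * psi b.
pose A := - L (phi z) (dphi z); pose B := L (theta z) (dtheta z).
have [phi00 dphi00] := phi0 z; have [theta00 dtheta00] := theta0 z.
have [A0|A0] := eqVneq A 0.
  exists (phi z), (dphi z); split => //; last by apply/eqP; rewrite -oppr_eq0; apply/eqP.
  apply: contrapT => nex.
  have phiz x : 0 <= x <= b -> phi z x = 0.
    move=> xb; apply/eqP; apply: contrapT => h; apply: nex.
    by exists x; [rewrite in_itv|apply/negP].
  have [_ _ d _] := sphi z.
  (* If [phi] vanished identically, its Cauchy data at the midpoint would be zero, hence also
     [dphi z 0] by uniqueness. An interior point is taken because [dphi] is a derivative on the open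
     interval. *)
  have b2 : b / 2 \in `]0, b[.
    by rewrite in_itv/= divr_gt0//= ltr_pdivrMr// mulr_natr mulr2n ltrDl.
  have b2' : 0 <= b / 2 <= b by move: b2; rewrite in_itv/= => /andP[/ltW -> /ltW ->].
  have [dR dI] := d _ b2.
  have /andP[b2a b2b] : 0 < b / 2 < b by move: b2; rewrite in_itv.
  have near0 (g : C -> R) (t : R) : g 0 = 0 -> is_derive (b / 2) 1 (fun x => g (phi z x)) t -> t = 0.
    move=> g0 dt.
    have d0 : is_derive (b / 2) 1 (fun x => g (phi z x)) 0.
      have dc : is_derive (b / 2) 1 (fun=> 0 : R) 0 by exact: is_derive_cst.
      apply: near_eq_is_derive dc.
      near=> x; rewrite phiz ?g0//; apply/andP; split; apply: ltW; near: x.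
        exact: lt_nbhsr b2a.
      exact: lt_nbhsl b2b.
    by have [_ <-] := dt; have [_ ->] := d0.
  have dphi2 : dphi z (b / 2) = 0.
    by apply: complexP; [exact: (near0 (@complex.Re R))|exact: (near0 (@complex.Im R))].
  have b00 : 0 <= (0 : R) <= b by rewrite lexx ltW.
  have [_] := @solution_eq0 R q b z (phi z) (dphi z) b0 iq (sphi z) kp kpz k0 K0 (b / 2) 0 b2' (phiz _ b2') dphi2 b00.
  by rewrite dphi00 => -[/eqP]; rewrite oner_eq0.
exists (fun x => A * theta z x + B * phi z x), (fun x => A * dtheta z x + B * dphi z x); split.
- by apply: is_solutionD; apply: is_solutionZ.
- exists 0; first by rewrite in_itv/= lexx ltW.
  by rewrite phi00 theta00 mulr0 addr0 mulr1.
- by rewrite /A /B /L; ring.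
Unshelve. all: by end_near. Qed.

(** With [m] formed from [psi], [theta + m phi] is [psi / psi 0], to which [decay] applies directly.
    The constant 9 comes from [80 <= 81]. *)
Lemma weyl_decay beta eps : 0 < eps < pi / 2 -> exists r0, forall r, r0 <= r ->
  forall x z, 0 <= x <= b -> z = polar r (pi - eps) ->
  cn (theta z x + m_function q b beta z * phi z x) <= 9 * expR (- (im_sqrt z * x)).
Proof.
(* For [r >= T], [|kp| >= 160 Qb] gives [2 Qb / |kp| <= 1 / 80], [k >= 16 / b] gives
   [exp (- 4 k b) <= 1 / 64] (the 2 in front comes from [im_sqrt_ray]), and the last term is the
   threshold of [boundary_factor]. *)
move=> heps; pose T := 1 + (160 * Qb) ^+ 2 + 2 * (16 / b) ^+ 2 + (6 * `|cos beta / sin beta|) ^+ 2.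
have T1 : 1 <= T.
  rewrite /T; have := sqr_ge0 (160 * Qb); have := sqr_ge0 (16 / b).
  by have := sqr_ge0 (6 * `|cos beta / sin beta|); lra.
exists T => r Tr x z xb zE.
have r0 : 0 < r by lra.
have zr : cn z = r by rewrite zE cn_polar// ltW.
have z0 : z != 0 by apply: contraTneq r0 => zz; rewrite -zr zz cn0 ltxx.
have [kp [kpz kE k0 KE]] := kappaP z.
have ray := im_sqrt_ray (ltW r0) heps; rewrite -zE in ray.
rewrite zr in KE; rewrite -kE in k0 ray *.
have K2 : cn kp ^+ 2 = r by rewrite KE sqr_sqrtr// ltW.
have K0 : 0 < cn kp by rewrite KE sqrtr_gt0.
have s1 := sqr_ge0 (160 * Qb); have s2 := sqr_ge0 (16 / b).
have s3 := sqr_ge0 (6 * `|cos beta / sin beta|).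
have hQ : 160 * Qb <= cn kp.
  rewrite -(@ler_pXn2r _ 2)// ?nnegrE ?cn_ge0 ?mulr_ge0 ?Qb_ge0// K2.
  by move: Tr; rewrite /T; lra.
have hh : 6 * `|cos beta / sin beta| <= cn kp.
  rewrite -(@ler_pXn2r _ 2)// ?nnegrE ?cn_ge0 ?mulr_ge0// K2.
  by move: Tr; rewrite /T; lra.
have hk : 16 / b <= complex.Re kp.
  rewrite -(@ler_pXn2r _ 2)// ?nnegrE ?divr_ge0 ?(ltW b0)//.
  by move: Tr; rewrite /T; lra.
have [psi0 [dpsi0 W0]] := weyl_solution_exists beta z0.
(* Existence makes [xget] return a genuine quotient together with the Weyl solution it comes
   from. *)
have [psi [dpsi [W mE]]] : exists psi dpsi, is_weyl_solution q b beta z psi dpsi /\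
    m_function q b beta z = dpsi 0 / psi 0.
  have wex : exists w : C, exists psi dpsi, is_weyl_solution q b beta z psi dpsi /\ w = dpsi 0 / psi 0.
    by exists (dpsi0 0 / psi0 0), psi0, dpsi0.
  exact: (xgetPex 0 wex).
have bf := boundary_factor W k0 hh.
have [sol [x0 x0b psix0] _] := W.
have Gb : 2 / cn kp * primitive (fun t => `|q t|) b <= 1 / 80.
  by rewrite -/Qb mulrAC ler_pdivrMr//; lra.
have kb : expR (- (4 * complex.Re kp * b)) <= 1 / 64.
  rewrite expRN -[leRHS]invrK lef_pV2 ?posrE ?invr_gt0 ?expR_gt0//.
  have : 16 <= complex.Re kp * b by rewrite -ler_pdivrMr.
  by have := expR_ge1Dx (4 * complex.Re kp * b); rewrite invf_div divr1; lra.
have dec := @decay R q b z psi dpsi b0 iq sol kp kpz k0 K0 Gb kb bf.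
(* The decay bound is relative to [psi 0]: were it zero, [psi] would vanish everywhere. *)
have psi00 : psi 0 != 0.
  apply: contra_neq psix0 => p0; apply: cn_eq0; apply/eqP; rewrite -sqrf_eq0 eq_le sqr_ge0 andbT.
  apply: le_trans (dec x0 _) _; first by move: x0b; rewrite in_itv.
  by rewrite p0 cn0 expr0n/= mulr0.
(* [psi] and [psi 0 (theta + m phi)] have the same Cauchy data at 0, so their difference
   vanishes. *)
have sol2 := is_solutionD sol (is_solutionZ (- psi 0)
  (is_solutionD (stheta z) (is_solutionZ (m_function q b beta z) (sphi z)))).
have [phi00 dphi00] := phi0 z; have [theta00 dtheta00] := theta0 z.
have b00 : 0 <= (0 : R) <= b by rewrite lexx ltW.
have [|| e _] := @solution_eq0 R q b z _ _ b0 iq sol2 kp kpz k0 K0 0 x b00 _ _ xb.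
- by rewrite phi00 theta00 mulr0 addr0 mulr1 subrr.
- by rewrite dphi00 dtheta00 add0r mulr1 mE mulNr mulrC divfK// subrr.
have uE : psi x = psi 0 * (theta z x + m_function q b beta z * phi z x).
  by apply/eqP; rewrite -subr_eq0 -mulNr e.
have := dec x xb; rewrite uE cnM exprMn.
have p0 : 0 < cn (psi 0) ^+ 2.
  by rewrite exprn_gt0// lt0r cn_ge0 andbT; apply: contra_neq psi00 => /cn_eq0.
rewrite mulrC ler_pM2r// => le.
rewrite -(@ler_pXn2r _ 2)// ?nnegrE ?cn_ge0 ?mulr_ge0 ?expR_ge0//.
apply: le_trans le _; rewrite exprMn -expRM_natl.
have -> : - (2 * complex.Re kp * x) = 2%:R * (- (complex.Re kp * x)) by ring.
by rewrite ler_wpM2r ?expR_ge0//; lra.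
Qed.

End Fundamental.
End WeylSolution.

(** * Uniqueness *)

Section RealUniqueness.
Context {R : realType}.
Notation mu := (@lebesgue_measure R).
Implicit Types (f g q : R -> R).

Definition real_solution q (b : R) f df : Prop :=
  [/\ abs_cont 0 b f, abs_cont 0 b df,
      (forall x, 0 < x < b -> is_derive x 1 f (df x)) &
      {ae mu, forall x, x \in `]0, b[ -> is_derive x 1 df (q x * f x)}].

Lemma is_derive_near_eq f g (x u v : R) : {near x, f =1 g} ->
  is_derive x 1 f u -> is_derive x 1 g v -> u = v.
Proof.
by move=> fg du dv; have [_ <-] := near_eq_is_derive fg du; have [_ ->] := dv.
Qed.

Lemma near_itv (a x : R) f g : 0 < x < a -> (forall t, 0 < t < a -> f t = g t) ->
  {near x, f =1 g}.
Proof.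
move=> /andP[x0 xa] fg; near=> t; apply: fg; apply/andP; split; near: t.
  exact: lt_nbhsr.
exact: lt_nbhsl.
Unshelve. all: by end_near. Qed.

Lemma wronskian q (a : R) f df g dg x : 0 < a -> real_solution q a f df -> real_solution q a g dg ->
  f 0 = 0 -> df 0 = 1 -> g 0 = 1 -> 0 <= x <= a -> g x * df x - dg x * f x = 1.
Proof.
move=> a0 [f1 f2 f3 f4] [g1 g2 g3 g4] f0 df0 g0 xa; have a0' := ltW a0.
have Wac : abs_cont 0 a (fun x => g x * df x - dg x * f x).
  by apply: abs_contB; apply: abs_contM.
rewrite (abs_cont_constant Wac _ xa); first by rewrite f0 df0 g0 mulr0 subr0 mulr1.
apply: ae_lebesgueS (ae_lebesgueI f4 g4) => t [hf hg] ta.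
have ta' : 0 < t < a by move: ta; rewrite in_itv.
have d := is_deriveB (is_derive_mul (g3 t ta') (hf ta)) (is_derive_mul (hg ta) (f3 t ta')).
by apply: (is_derive_eq d); ring.
Qed.

(** The vectors [(f1, g1)] and [(f2, g2)] are proportional, so they turn at the same angular speed;
    the Wronskian is this speed times the squared length. Equal Wronskians give equal lengths, hence
    equality up to sign. *)
Lemma cross_squares (f1 f2 g1 g2 f1' f2' g1' g2' : R) : f1 * g2 = f2 * g1 ->
  f1 * g2' + g2 * f1' = f2 * g1' + g1 * f2' ->
  g1 * f1' - g1' * f1 = 1 -> g2 * f2' - g2' * f2 = 1 ->
  f1 ^+ 2 = f2 ^+ 2 /\ g1 ^+ 2 = g2 ^+ 2.
Proof.
move=> A B W1 W2; split; apply/esym/eqP; rewrite -subr_eq0; apply/eqP.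
  have : f2 ^+ 2 * (g1 * f1' - g1' * f1) - f1 ^+ 2 * (g2 * f2' - g2' * f2) =
      f1 * f2 * ((f1 * g2' + g2 * f1') - (f2 * g1' + g1 * f2')) +
      (f2 * g1 - f1 * g2) * (f2 * f1' + f1 * f2') by ring.
  by rewrite W1 W2 A B !subrr !mulr1 mulr0 mul0r addr0.
have : g2 ^+ 2 * (g1 * f1' - g1' * f1) - g1 ^+ 2 * (g2 * f2' - g2' * f2) =
    g1 * g2 * ((f1 * g2' + g2 * f1') - (f2 * g1' + g1 * f2')) +
    (f2 * g1 - f1 * g2) * (g2 * g1' + g1 * g2') by ring.
by rewrite W1 W2 A B !subrr !mulr1 mulr0 mul0r addr0.
Qed.

Lemma ae_itv_oo_cc (a : R) (Q : R -> Prop) :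
  {ae mu, forall x, x \in `]0, a[ -> Q x} -> {ae mu, forall x, x \in `[0, a] -> Q x}.
Proof.
move=> h; have nn : {ae mu, forall x, x <> 0 /\ x <> a}.
  apply: ae_lebesgueI.
    exists [set 0]; split => //; first exact: lebesgue_measure_set1.
    by move=> x /= /contrapT.
  exists [set a]; split => //; first exact: lebesgue_measure_set1.
  by move=> x /= /contrapT.
apply: ae_lebesgueS (ae_lebesgueI h nn) => x [hx [/eqP x0 /eqP xa]].
rewrite in_itv/= => /andP[x1 x2]; apply: hx.
by rewrite in_itv/= !lt_neqAle x1 x2 xa eq_sym x0.
Qed.

(** After [cross_squares] only a common sign is open, and continuity from the initial data fixes it.
    The potential is then recovered from the two equations together. *)
Lemma real_uniqueness (a : R) q1 q2 f1 df1 g1 dg1 f2 df2 g2 dg2 : 0 < a ->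
  real_solution q1 a f1 df1 -> real_solution q1 a g1 dg1 ->
  real_solution q2 a f2 df2 -> real_solution q2 a g2 dg2 ->
  f1 0 = 0 -> df1 0 = 1 -> g1 0 = 1 -> f2 0 = 0 -> df2 0 = 1 -> g2 0 = 1 ->
  (forall x, 0 < x < a -> f1 x * g2 x = f2 x * g1 x) ->
  {ae mu, forall x, x \in `[0, a] -> q1 x = q2 x}.
Proof.
move=> a0 F1 G1 F2 G2 f10 df10 g10 f20 df20 g20 cross.
have [f1ac _ f1d f1dd] := F1; have [g1ac _ g1d g1dd] := G1.
have [f2ac _ f2d f2dd] := F2; have [g2ac _ g2d g2dd] := G2.
have W1 x : 0 < x < a -> g1 x * df1 x - dg1 x * f1 x = 1.
  by move=> /andP[x0 xa]; apply: (wronskian a0 F1 G1) => //; rewrite !ltW.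
have W2 x : 0 < x < a -> g2 x * df2 x - dg2 x * f2 x = 1.
  by move=> /andP[x0 xa]; apply: (wronskian a0 F2 G2) => //; rewrite !ltW.
have sq x : 0 < x < a -> f1 x ^+ 2 = f2 x ^+ 2 /\ g1 x ^+ 2 = g2 x ^+ 2.
  move=> xa; apply: (cross_squares (cross x xa) _ (W1 x xa) (W2 x xa)).
  have d1 := is_derive_mul (f1d x xa) (g2d x xa).
  have d2 := is_derive_mul (f2d x xa) (g1d x xa).
  exact: (is_derive_near_eq (near_itv xa cross) d1 d2).
have pos x : 0 < x < a -> 0 < f1 x ^+ 2 + g1 x ^+ 2.
  move=> xa; rewrite lt_neqAle addr_ge0 ?sqr_ge0// andbT eq_sym; apply/eqP => h.
  have f0 : f1 x = 0 by apply/eqP; rewrite -sqrf_eq0; have := sqr_ge0 (f1 x); have := sqr_ge0 (g1 x); lra.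
  have g0 : g1 x = 0 by apply/eqP; rewrite -sqrf_eq0; have := sqr_ge0 (f1 x); have := sqr_ge0 (g1 x); lra.
  by have := W1 x xa; rewrite f0 g0 mul0r mulr0 subrr => /eqP; rewrite eq_sym oner_eq0.
(* This inner product is plus or minus the squared length, which is nonzero by the Wronskian; it
   equals 1 at 0, so the sign is plus throughout. *)
pose sg x := f1 x * f2 x + g1 x * g2 x.
have sgE x : 0 < x < a -> sg x ^+ 2 = (f1 x ^+ 2 + g1 x ^+ 2) ^+ 2.
  move=> xa; have [e1 e2] := sq x xa.
  have : sg x ^+ 2 = (f1 x ^+ 2 + g1 x ^+ 2) * (f2 x ^+ 2 + g2 x ^+ 2) -
     (f1 x * g2 x - f2 x * g1 x) ^+ 2 by rewrite /sg; ring.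
  by rewrite cross// subrr expr0n/= subr0 -e1 -e2 -expr2.
have sgac : abs_cont 0 a sg.
  by apply: abs_contD; apply: abs_contM => //; exact: ltW.
have sg_gt0 x : 0 < x < a -> 0 < sg x.
  move=> /andP[x0 xa].
  have sgx : abs_cont 0 x sg by apply: abs_contS sgac => //; exact: ltW.
  apply: (abs_cont_IVT_gt0 (ltW x0) sgx); last by rewrite /sg f10 g10 f20 g20 mul0r mul1r add0r.
  move=> t /andP[t0 tx]; have [t00|tn0] := eqVneq t 0.
    by rewrite t00 /sg f10 g10 f20 g20 mul0r mul1r add0r oner_eq0.
  have ta : 0 < t < a by rewrite lt_neqAle eq_sym tn0 t0 (le_lt_trans tx).
  by rewrite -sqrf_eq0 sgE// sqrf_eq0 gt_eqF// pos.
have eqs x : 0 < x < a -> f1 x = f2 x /\ g1 x = g2 x.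
  move=> xa; have [e1 e2] := sq x xa.
  have sgx : sg x = f1 x ^+ 2 + g1 x ^+ 2.
    by apply/eqP; rewrite -(@eqrXn2 _ 2)// ?ltW ?sg_gt0 ?pos// sgE.
  have : (f1 x - f2 x) ^+ 2 + (g1 x - g2 x) ^+ 2 = 0.
    have -> : (f1 x - f2 x) ^+ 2 + (g1 x - g2 x) ^+ 2 =
      (f1 x ^+ 2 + g1 x ^+ 2) + (f2 x ^+ 2 + g2 x ^+ 2) - 2 * sg x by rewrite /sg; ring.
    by rewrite sgx -e1 -e2; ring.
  have := sqr_ge0 (f1 x - f2 x); have := sqr_ge0 (g1 x - g2 x) => h1 h2 h3.
  by split; apply/eqP; rewrite -subr_eq0 -sqrf_eq0; lra.
have deqs x : 0 < x < a -> df1 x = df2 x /\ dg1 x = dg2 x.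
  move=> xa; split.
    by apply: (is_derive_near_eq (near_itv xa _) (f1d x xa) (f2d x xa)) => t /eqs[].
  by apply: (is_derive_near_eq (near_itv xa _) (g1d x xa) (g2d x xa)) => t /eqs[].
apply: ae_itv_oo_cc.
apply: ae_lebesgueS (ae_lebesgueI (ae_lebesgueI f1dd g1dd) (ae_lebesgueI f2dd g2dd)).
move=> x [[h1 h2] [h3 h4]] xa; have xa' : 0 < x < a by move: xa; rewrite in_itv.
have [ef eg] := eqs x xa'.
have k1 : q1 x * f1 x = q2 x * f2 x.
  by apply: (is_derive_near_eq (near_itv xa' _) (h1 xa) (h3 xa)) => t /deqs[].
have k2 : q1 x * g1 x = q2 x * g2 x.
  by apply: (is_derive_near_eq (near_itv xa' _) (h2 xa) (h4 xa)) => t /deqs[].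
rewrite -ef in k1; rewrite -eg in k2.
(* Either [f1] or [g1] may vanish at [x]; the Wronskian combines the two relations into one with
   coefficient 1. *)
have : q1 x * (g1 x * df1 x - dg1 x * f1 x) = q2 x * (g1 x * df1 x - dg1 x * f1 x).
  by rewrite !mulrBr !mulrA k2 ![_ * dg1 x * f1 x]mulrAC k1.
by rewrite W1// !mulr1.
Qed.

End RealUniqueness.

Section ZeroEnergy.
Context {R : realType}.
Local Notation C := R[i].

Lemma real_solution_Re (q : R -> R) (b a : R) (y dy : R -> C) : a <= b -> 0 < a ->
  is_solution q b 0 y dy ->
  real_solution q a (fun x => complex.Re (y x)) (fun x => complex.Re (dy x)).
Proof.
move=> ab a0 [[y1 _] [y2 _] d dd]; split.
- exact: abs_contS y1.
- exact: abs_contS y2.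
- move=> x /andP[x0 xa]; have xb : x \in `]0, b[ by rewrite in_itv/= x0 (lt_le_trans xa).
  by have [] := d x xb.
apply: ae_lebesgueS dd => x h; rewrite in_itv/= => /andP[x0 xa].
have xb : x \in `]0, b[ by rewrite in_itv/= x0 (lt_le_trans xa).
have [w [wR _] e] := h xb; apply: (is_derive_eq wR).
have : complex.Re (- w + ((q x)%:C%C - 0) * y x) = 0 by rewrite e.
by rewrite cReD subr0 cReMr; case: (w) => a1 a2 /= /eqP; rewrite addrC subr_eq0 => /eqP.
Qed.

End ZeroEnergy.

(** * Bounds for the fundamental solutions and vanishing of F at 0 *)

Section Main.
Context {R : realType}.
Local Notation C := R[i].
Local Notation cn := ComplexField.Normc.normc.

(** Two regimes: a crude bound for all [|z| >= 1], responsible for the order 1/2 of [F], and sharp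
    bounds on the ray, where [phi] gains [1 / sqrt r] because it vanishes at 0. *)
Lemma fundamental_bounds (q : R -> R) (b beta eps : R)
    (phi dphi theta dtheta : C -> R -> C) : 0 < b -> integrable_on b q ->
  (forall z, is_solution q b z (phi z) (dphi z)) ->
  (forall z, phi z 0 = (0 : R)%:C%C /\ dphi z 0 = (1 : R)%:C%C) ->
  (forall z, is_solution q b z (theta z) (dtheta z)) ->
  (forall z, theta z 0 = (1 : R)%:C%C /\ dtheta z 0 = (0 : R)%:C%C) ->
  0 < eps < pi / 2 ->
  exists M r0, [/\ 0 < M,
    (forall z x, 0 <= x <= b -> 1 <= cn z ->
       cn (phi z x) <= M * expR (b * Num.sqrt (cn z)) /\
       cn (theta z x) <= M * expR (b * Num.sqrt (cn z))) &
    (forall r x z, r0 <= r -> 1 <= r -> 0 <= x <= b -> z = polar r (pi - eps) ->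
       cn (phi z x) <= M / Num.sqrt r * expR (im_sqrt z * x) /\
       cn (theta z x + m_function q b beta z * phi z x) <= 9 * expR (- (im_sqrt z * x)))].
Proof.
move=> b0 iq sphi phi0 stheta theta0 heps.
pose Qb := primitive (fun t => `|q t|) b.
have [r0 dec] := weyl_decay b0 iq sphi phi0 stheta theta0 beta heps.
have gphi z x : 1 <= cn z -> 0 <= x <= b ->
    cn (phi z x) <= expR (2 * Qb) / Num.sqrt (cn z) * expR (im_sqrt z * x).
  move=> z1 xb; have [h _] := solution_growth b0 iq (sphi z) z1 xb.
  have [e1 e2] := phi0 z; rewrite e1 e2 cn0 cn1 addr0 expRD in h.
  by apply: le_trans h _; rewrite le_eqVlt; apply/orP; left; apply/eqP; rewrite /Qb; ring.
exists (expR (2 * Qb)), r0; split; first exact: expR_gt0.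
  move=> z x xb z1.
  have K1 : 1 <= Num.sqrt (cn z) by rewrite -[leLHS]sqrtr1; exact: ler_wsqrtr.
  have [h kK] := solution_growth b0 iq (stheta z) z1 xb.
  have [e1 e2] := theta0 z; rewrite e1 e2 cn0 cn1 mul0r add0r mul1r -/Qb in h.
  have /andP[x0 x1] := xb.
  have [_ [_ _ k0 _]] := kappaP z.
  have kx : im_sqrt z * x <= b * Num.sqrt (cn z).
    by rewrite mulrC; apply: ler_pM.
  split.
    apply: le_trans (gphi z x z1 xb) _; apply: ler_pM.
    - by rewrite divr_ge0 ?expR_ge0 ?sqrtr_ge0.
    - exact: expR_ge0.
    - have K0 : 0 < Num.sqrt (cn z) by lra.
      by rewrite ler_pdivrMr// ler_peMr ?expR_ge0.
    - by rewrite ler_expR.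
  apply: le_trans h _; rewrite expRD mulrC ler_wpM2l ?expR_ge0// ler_expR//.
move=> r x z rr0 r1 xb zE; split; last exact: (dec r rr0 x z xb zE).
have zr : cn z = r by rewrite zE cn_polar//; lra.
by rewrite -zr; apply: gphi => //; rewrite zr.
Qed.

End Main.

Section CrossProduct.
Context {R : realType}.
Local Notation C := R[i].
Local Notation cn := ComplexField.Normc.normc.

Lemma cross_product_eq0 (b1 b2 beta1 beta2 a eps K : R) (q1 q2 : R -> R)
    (phi1 dphi1 theta1 dtheta1 phi2 dphi2 theta2 dtheta2 : C -> R -> C) (x : R) :
  0 < b1 -> 0 < b2 -> integrable_on b1 q1 -> integrable_on b2 q2 ->
  0 < x < a -> a < b1 -> a < b2 -> 0 < eps < pi / 2 ->
  (\forall r \near +oo, cn (m_function q1 b1 beta1 (polar r (pi - eps))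
                          - m_function q2 b2 beta2 (polar r (pi - eps)))
     <= K * expR (- 2 * im_sqrt (polar r (pi - eps)) * a)) ->
  (forall z, is_solution q1 b1 z (phi1 z) (dphi1 z)) ->
  (forall z, phi1 z 0 = (0 : R)%:C%C /\ dphi1 z 0 = (1 : R)%:C%C) ->
  (forall z, is_solution q1 b1 z (theta1 z) (dtheta1 z)) ->
  (forall z, theta1 z 0 = (1 : R)%:C%C /\ dtheta1 z 0 = (0 : R)%:C%C) ->
  (forall z, is_solution q2 b2 z (phi2 z) (dphi2 z)) ->
  (forall z, phi2 z 0 = (0 : R)%:C%C /\ dphi2 z 0 = (1 : R)%:C%C) ->
  (forall z, is_solution q2 b2 z (theta2 z) (dtheta2 z)) ->
  (forall z, theta2 z 0 = (1 : R)%:C%C /\ dtheta2 z 0 = (0 : R)%:C%C) ->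
  polyapprox (phi1 ^~ x) -> polyapprox (theta1 ^~ x) ->
  polyapprox (phi2 ^~ x) -> polyapprox (theta2 ^~ x) ->
  (forall z, phi1 (conjc z) x = conjc (phi1 z x)) ->
  (forall z, theta1 (conjc z) x = conjc (theta1 z x)) ->
  (forall z, phi2 (conjc z) x = conjc (phi2 z x)) ->
  (forall z, theta2 (conjc z) x = conjc (theta2 z x)) ->
  phi1 0 x * theta2 0 x = phi2 0 x * theta1 0 x.
Proof.
move=> b10 b20 iq1 iq2 /andP[x0 xa] ab1 ab2 heps [r3 [_ hr3]].
move=> sphi1 phi10 stheta1 theta10 sphi2 phi20 stheta2 theta20.
move=> pphi1 ptheta1 pphi2 ptheta2 cphi1 ctheta1 cphi2 ctheta2.
have [M1 [r1 [M10 g1 d1]]] := fundamental_bounds beta1 b10 iq1 sphi1 phi10 stheta1 theta10 heps.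
have [M2 [r2 [M20 g2 d2]]] := fundamental_bounds beta2 b20 iq2 sphi2 phi20 stheta2 theta20 heps.
have xb1 : 0 <= x <= b1 by rewrite !ltW// (lt_trans xa).
have xb2 : 0 <= x <= b2 by rewrite !ltW// (lt_trans xa).
pose F z := phi1 z x * theta2 z x + (-1) * (phi2 z x * theta1 z x).
have pF : polyapprox F.
  apply: polyapproxD; first exact: polyapproxM.
  by apply: polyapproxM; [exact: polyapprox_cst|exact: polyapproxM].
suff : F 0 = 0 by rewrite /F mulN1r => /eqP; rewrite subr_eq0 => /eqP.
have conjF z : cn (F (conjc z)) = cn (F z).
  rewrite -[RHS]cn_conj /F cphi1 ctheta2 cphi2 ctheta1.
  by rewrite rmorphD !rmorphM rmorphN1.
have [B B0 hB] := polyapprox_bounded 1 pF.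
(* One constant majorises the prefactor, the exponent and the bound on the unit disc. *)
pose A := 2 * (M1 * M2) + (b1 + b2) + B.
have M120 : 0 < M1 * M2 by rewrite mulr_gt0.
have A0 : 0 < A by rewrite /A; lra.
have growth z : cn (F z) <= A * expR (A * Num.sqrt (cn z)).
  have [z1|z1] := leP 1 (cn z); last first.
    apply: le_trans (hB z (ltW z1)) _; apply: (@le_trans _ _ (A * 1)).
      by rewrite /A; lra.
    rewrite ler_wpM2l ?(ltW A0)//.
    by rewrite -[leLHS]expR0 ler_expR mulr_ge0 ?sqrtr_ge0// ltW.
  have [p1 t1] := g1 z x xb1 z1; have [p2 t2] := g2 z x xb2 z1.
  pose S := Num.sqrt (cn z); have S0 : 0 <= S by exact: sqrtr_ge0.
  apply: (@le_trans _ _ (2 * (M1 * M2) * expR ((b1 + b2) * S))).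
    apply: le_trans (cnD _ _) _; rewrite mulN1r cnN !cnM.
    have E : M1 * M2 * expR ((b1 + b2) * S) = (M1 * expR (b1 * S)) * (M2 * expR (b2 * S)).
      by rewrite mulrDl expRD; ring.
    have -> : 2 * (M1 * M2) * expR ((b1 + b2) * S) =
      M1 * M2 * expR ((b1 + b2) * S) + M1 * M2 * expR ((b1 + b2) * S) by ring.
    apply: lerD; rewrite E; first by apply: ler_pM; rewrite ?cn_ge0.
    by rewrite mulrC; apply: ler_pM; rewrite ?cn_ge0.
  apply: ler_pM; rewrite ?expR_ge0 ?mulr_ge0 ?(ltW M10) ?(ltW M20)//.
    by rewrite /A; lra.
  by rewrite ler_expR ler_wpM2r// /A; lra.
(* [r3 + 1] because the bound on the m-functions is given for [r > r3] only. *)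
pose T := Num.max 1 (Num.max r1 (Num.max r2 (r3 + 1))).
pose D1 := 9 * M1 + 9 * M2 + `|K| * (M1 * M2).
have far r : T <= r -> cn (F (polar r (pi - eps))) * Num.sqrt r <= D1.
  rewrite /T !ge_max => /and4P[r1_ r2_ r3_ r4_].
  set z := polar r (pi - eps).
  have S1 : 1 <= Num.sqrt r by rewrite -[leLHS]sqrtr1; exact: ler_wsqrtr.
  have S0 : 0 < Num.sqrt r by lra.
  have [p1 u1] := d1 r x z r2_ r1_ xb1 erefl.
  have [p2 u2] := d2 r x z r3_ r1_ xb2 erefl.
  have r34 : r3 < r by lra.
  have hm := hr3 r r34; rewrite -/z in hm.
  set m1 := m_function q1 b1 beta1 z in u1 hm; set m2 := m_function q2 b2 beta2 z in u2 hm.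
  set k := im_sqrt z in p1 p2 u1 u2 hm.
  have [_ [_ _ k0 _]] := kappaP z; rewrite -/k in k0.
  set s := Num.sqrt r in S1 S0 p1 p2 *.
  have e1 : expR (k * x) * expR (- (k * x)) = 1 by rewrite -expRD subrr expR0.
  have FE : F z = phi1 z x * (theta2 z x + m2 * phi2 z x) -
      phi2 z x * (theta1 z x + m1 * phi1 z x) + (m1 - m2) * (phi1 z x * phi2 z x).
    by rewrite /F; ring.
  have c1 : cn (phi1 z x * (theta2 z x + m2 * phi2 z x)) <= 9 * M1 / s.
    rewrite cnM; apply: le_trans (ler_pM (cn_ge0 _) (cn_ge0 _) p1 u2) _.
    have -> : M1 / s * expR (k * x) * (9 * expR (- (k * x))) =
       9 * M1 / s * (expR (k * x) * expR (- (k * x))) by ring.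
    by rewrite e1 mulr1.
  have c2 : cn (phi2 z x * (theta1 z x + m1 * phi1 z x)) <= 9 * M2 / s.
    rewrite cnM; apply: le_trans (ler_pM (cn_ge0 _) (cn_ge0 _) p2 u1) _.
    have -> : M2 / s * expR (k * x) * (9 * expR (- (k * x))) =
       9 * M2 / s * (expR (k * x) * expR (- (k * x))) by ring.
    by rewrite e1 mulr1.
  (* The growth [exp (2 k x)] of the two [phi] is absorbed by [exp (- 2 k a)]. Two factors [1 / s]
     appear; one is given away using [s >= 1]. *)
  have c3 : cn ((m1 - m2) * (phi1 z x * phi2 z x)) <= `|K| * (M1 * M2) / s.
    rewrite !cnM.
    have hm' : cn (m1 - m2) <= `|K| * (expR (- (k * x)) * expR (- (k * x))).
      apply: le_trans hm _; apply: (@le_trans _ _ (`|K| * expR (- 2 * k * a))).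
        by rewrite ler_wpM2r ?expR_ge0// ler_norm.
      rewrite ler_wpM2l// -expRD ler_expR.
      have : k * x <= k * a by rewrite ler_wpM2l// ltW.
      lra.
    have pp : cn (phi1 z x) * cn (phi2 z x) <=
        (M1 / s * expR (k * x)) * (M2 / s * expR (k * x)) by apply: ler_pM; rewrite ?cn_ge0.
    have pp0 : 0 <= cn (phi1 z x) * cn (phi2 z x) by rewrite mulr_ge0 ?cn_ge0.
    apply: le_trans (ler_pM (cn_ge0 _) pp0 hm' pp) _.
    have -> : `|K| * (expR (- (k * x)) * expR (- (k * x))) *
       (M1 / s * expR (k * x) * (M2 / s * expR (k * x))) =
       `|K| * (M1 * M2) / s / s * (expR (k * x) * expR (- (k * x))) ^+ 2 by ring.
    rewrite e1 expr1n mulr1 ler_pdivrMr// ler_peMr//.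
    by rewrite divr_ge0 ?(ltW S0)// mulr_ge0// ltW.
  rewrite -ler_pdivlMr// FE; apply: le_trans (cnD _ _) _.
  have -> : D1 / s = 9 * M1 / s + 9 * M2 / s + `|K| * (M1 * M2) / s by rewrite /D1; ring.
  apply: lerD => //; apply: le_trans (cnD _ _) _; rewrite cnN; exact: lerD.
(* The part of the ray below [T] lies in a disc on which [F] is bounded, so enlarging the constant
   covers the whole ray. *)
have [B2 B20 hB2] := polyapprox_bounded T pF.
apply: (@bounded_ray_eq0 R F eps (D1 + B2 * Num.sqrt T) A pF heps conjF growth) => r r0.
have D10 : 0 <= D1.
  have : 0 <= `|K| * (M1 * M2) by rewrite mulr_ge0// ltW.
  by rewrite /D1; lra.
have BT0 : 0 <= B2 * Num.sqrt T by rewrite mulr_ge0 ?sqrtr_ge0// ltW.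
have [Tr|rT] := leP T r; first by have := far r Tr; lra.
have : cn (F (polar r (pi - eps))) * Num.sqrt r <= B2 * Num.sqrt T.
  apply: ler_pM; rewrite ?cn_ge0 ?sqrtr_ge0//.
    by apply: hB2; rewrite cn_polar ltW.
  by apply: ler_wsqrtr; exact: ltW.
lra.
Qed.

End CrossProduct.

Theorem mainTheorem5 (R : realType) (b1 b2 beta1 beta2 a eps : R)
  (q1 q2 : R -> R)
  (hb1 : 0 < b1) (hb2 : 0 < b2)
  (hbeta1 : 0 <= beta1 < pi) (hbeta2 : 0 <= beta2 < pi)
  (hq1 : (@lebesgue_measure R).-integrable `[0, b1] (EFin \o q1))
  (hq2 : (@lebesgue_measure R).-integrable `[0, b2] (EFin \o q2))
  (ha : 0 < a < Num.min b1 b2)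
  (heps : 0 < eps < pi / 2)
  (hm : exists K : R, \forall r \near +oo,
     ComplexField.Normc.normc (m_function q1 b1 beta1 (polar r (pi - eps))
                               - m_function q2 b2 beta2 (polar r (pi - eps)))
     <= K * expR (- 2 * im_sqrt (polar r (pi - eps)) * a)) :
  {ae @lebesgue_measure R, forall x, x \in `[0, a] -> q1 x = q2 x}.
Proof.
have [K hK] := hm.
move: ha => /andP[a0]; rewrite lt_min => /andP[ab1 ab2].
have [phi1 [dphi1 [sphi1 iphi1 pphi1 cphi1]]] := schrodinger_solution 0 1 hb1 hq1.
have [theta1 [dtheta1 [stheta1 itheta1 ptheta1 ctheta1]]] := schrodinger_solution 1 0 hb1 hq1.
have [phi2 [dphi2 [sphi2 iphi2 pphi2 cphi2]]] := schrodinger_solution 0 1 hb2 hq2.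
have [theta2 [dtheta2 [stheta2 itheta2 ptheta2 ctheta2]]] := schrodinger_solution 1 0 hb2 hq2.
have cross x : 0 < x < a -> phi1 0 x * theta2 0 x = phi2 0 x * theta1 0 x.
  move=> xa; have /andP[x0 xa1] := xa.
  have xb1 : 0 <= x <= b1 by rewrite !ltW// (lt_trans xa1).
  have xb2 : 0 <= x <= b2 by rewrite !ltW// (lt_trans xa1).
  by apply: (@cross_product_eq0 R b1 b2 beta1 beta2 a eps K q1 q2 phi1 dphi1 theta1 dtheta1
    phi2 dphi2 theta2 dtheta2 x) => //; [exact: pphi1|exact: ptheta1|exact: pphi2|exact: ptheta2
    |move=> z; exact: cphi1|move=> z; exact: ctheta1|move=> z; exact: cphi2|move=> z; exact: ctheta2].
have Im0 (w : R[i]) : w = conjc w -> complex.Im w = 0.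
  by case: w => u v [] /= /eqP; rewrite -subr_eq0 opprK -mulr2n mulrn_eq0 => /eqP.
(* Conjugation fixes [z = 0], so the solutions are real there and the cross relation passes to their
   real parts. *)
have real0 (y : R[i] -> R -> R[i]) b x : 0 <= x <= b ->
    (forall z x, 0 <= x <= b -> y (conjc z) x = conjc (y z x)) -> complex.Im (y 0 x) = 0.
  by move=> xb cy; apply: Im0; rewrite -cy// conjc0.
apply: (real_uniqueness a0 (real_solution_Re (ltW ab1) a0 (sphi1 0))
  (real_solution_Re (ltW ab1) a0 (stheta1 0)) (real_solution_Re (ltW ab2) a0 (sphi2 0))
  (real_solution_Re (ltW ab2) a0 (stheta2 0))).
- by have [-> _] := iphi1 0.
- by have [_ ->] := iphi1 0.
- by have [-> _] := itheta1 0.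
- by have [-> _] := iphi2 0.
- by have [_ ->] := iphi2 0.
- by have [-> _] := itheta2 0.
move=> x xa; have /andP[x0 xa1] := xa.
have xb1 : 0 <= x <= b1 by rewrite !ltW// (lt_trans xa1).
have xb2 : 0 <= x <= b2 by rewrite !ltW// (lt_trans xa1).
have : complex.Re (phi1 0 x * theta2 0 x) = complex.Re (phi2 0 x * theta1 0 x) by rewrite cross.
rewrite !cReM (real0 _ _ _ xb1 cphi1) (real0 _ _ _ xb2 cphi2).
by rewrite !mul0r !subr0.
Qed.
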